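(* Let $r,R>0$. The Radon transform $\mathcal{R}$ is a Hilbert space isomorphism (a linear bijection that is continuous and has a continuous inverse) between the Hilbert spaces $\mathcal{BP}_{rR}(\mathbb{R}^2)$ and $\mathcal{R}(\mathcal{BP}_{rR}(\mathbb{R}^2))\subset L^2(\mathbb{R}\times S^1, ds\otimes d\omega)$, where both carry the respective $L^2$-norms; in particular the range $\mathcal{R}(\mathcal{BP}_{rR}(\mathbb{R}^2))$ is a Hilbert space, i.e. a closed subspace of $L^2(\mathbb{R}\times S^1)$.
   Context: $S^1$ is the unit circle in $\mathbb{R}^2$ with arc length measure $d\omega$. $\mathcal{F}$ denotes the Fourier transform $(\mathcal{F}f)(\xi)=\int f(x)e^{-ix\cdot\xi}\,dx$, extended to $L^2(\mathbb{R}^d)$, and $\mathcal{F}_s$ denotes the one-dimensional Fourier transform (same convention) of a function $g(s,\omega)$ on $\mathbb{R}\times S^1$ with respect to the radial variable $s$, with dual variable $\sigma\in\mathbb{R}$. Bandpass space: for $r,R>0$, with $B_\rho^d$ the ball of radius $\rho$ centered at the origin of $\mathbb{R}^d$, $$\mathcal{BP}_{rR}(\mathbb{R}^d)=\{f\in L^2(\mathbb{R}^d): \mathcal{F}f=0 \text{ (a.e.) on } \mathbb{R}^d\setminus(B_R^d\setminus B_r^d)\},$$ a Hilbert space with the $L^2$-norm. Radon transform on bandpass functions: it is defined through the Fourier slice theorem, $\mathcal{R}=\mathcal{F}_s^{-1}\circ\mathrm{id}\circ\Phi\circ\mathcal{F}$. Here $\Phi: L^2(\mathbb{R}^2)\to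 L^2(\mathbb{R}^+\times S^1,\sigma\,d\sigma\otimes d\omega)$ is the change to polar coordinates, and $\mathrm{id}$ regards a function $g$ on $\mathbb{R}^+\times S^1$ as a function on $\mathbb{R}\times S^1$ with measure $d\sigma\otimes d\omega$ by setting $(\mathrm{id}\,g)(\sigma,\omega)=g(-\sigma,-\omega)$ for $\sigma<0$. Equivalently, $\mathcal{R}f$ is the element of $L^2(\mathbb{R}\times S^1)$ determined by $(\mathcal{F}_s\mathcal{R}f)(\sigma,\omega)=(\mathcal{F}f)(\sigma\omega)$ for a.e. $(\sigma,\omega)\in\mathbb{R}\times S^1$. For Schwartz functions this coincides with the classical Radon transform $(\mathcal{R}f)(s,\omega)=\int_{x\cdot\omega=s}f$. ''Hilbert space isomorphism'' means a bounded linear bijection with bounded inverse; it is not required to be isometric. *)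

(* Defs.v *)
From HB Require Import structures.
From mathcomp Require Import all_boot all_order all_algebra.
From mathcomp Require Import complex.
From mathcomp Require Import all_classical all_reals all_analysis.
From mathcomp Require Import measurable_realfun.

Set Implicit Arguments.
Unset Strict Implicit.
Unset Printing Implicit Defensive.

Import Order.TTheory GRing.Theory Num.Theory.
Import numFieldNormedType.Exports.
Import Normc.

Local Open Scope classical_set_scope.
Local Open Scope complex_scope.
Local Open Scope ring_scope.
Local Open Scope quotient_scope.

Section square_integrable.
Context d (T : measurableType d) (R : realType).
Variable mu : {measure set T -> \bar R}.
Implicit Types f g : T -> R[i].

Definition cmeasurable f : Prop :=
  measurable_fun setT (fun x => complex.Re (f x)) /\
  measurable_fun setT (fun x => complex.Im (f x)).

Local Notation "'N f" := ('N[mu]_2%:E [EFin \o (fun x => normc (f x))])%E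
  (at level 10, f at level 8).

Definition L2fun_pred : {pred T -> R[i]} :=
  mem [set f | cmeasurable f /\ finite_norm mu 2%:E (fun x => normc (f x))].

Lemma cmeasurable_normc f :
  cmeasurable f -> measurable_fun setT (fun x => normc (f x)).
Proof.
move=> [mr mi].
have -> : (fun x => normc (f x)) =
    Num.sqrt \o (fun x => complex.Re (f x) ^+ 2 + complex.Im (f x) ^+ 2).
  by apply/funext => x /=; case: (f x).
apply: measurableT_comp.
  by apply: continuous_measurable_fun; exact: sqrt_continuous.
by apply: measurable_funD; exact: measurable_funX.
Qed.

Lemma cmeasurableD f g : cmeasurable f -> cmeasurable g -> cmeasurable (f + g).
Proof.
move=> [fr fi] [gr gi]; split.
- rewrite (_ : (fun _ => _) =
    (fun x => complex.Re (f x)) \+ (fun x => complex.Re (g x))).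
    exact: measurable_funD.
  by apply/funext => x /=; rewrite /= fctE; case: (f x) (g x) => ? ? [].
- rewrite (_ : (fun _ => _) =
    (fun x => complex.Im (f x)) \+ (fun x => complex.Im (g x))).
    exact: measurable_funD.
  by apply/funext => x /=; rewrite /= fctE; case: (f x) (g x) => ? ? [].
Qed.

Lemma cmeasurableZ (a : R[i]) f : cmeasurable f -> cmeasurable (a *: f).
Proof.
case: a => a b [fr fi]; split.
- rewrite (_ : (fun _ => _) =
    (fun x => a * complex.Re (f x)) \- (fun x => b * complex.Im (f x))).
    by apply: measurable_funB; apply: measurable_funM.
  by apply/funext => x /=; rewrite fctE; case: (f x).
- rewrite (_ : (fun _ => _) =
    (fun x => a * complex.Im (f x)) \+ (fun x => b * complex.Re (f x))).
    by apply: measurable_funD; apply: measurable_funM.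
  by apply/funext => x /=; rewrite fctE; case: (f x).
Qed.

Lemma cLnorm_le (u v : T -> R) : measurable_fun setT u -> measurable_fun setT v ->
  (forall x, `|u x| <= `|v x|) ->
  ('N[mu]_2%:E[EFin \o u] <= 'N[mu]_2%:E[EFin \o v])%E.
Proof.
move=> mu' mv uv; rewrite unlock.
have i0 (w : T -> R) : (0 <= \int[mu]_x `|(EFin \o w) x| `^ 2)%E.
  by apply: integral_ge0 => x _; exact: poweR_ge0.
apply: gt0_ler_poweR; rewrite ?in_itv/= ?leey ?andbT ?i0//.
have mh (w : T -> R) : measurable_fun setT w ->
    measurable_fun setT (fun x : T => (`|w x| `^ 2)%:E).
  move=> mw.
  apply/measurable_EFinP.
  apply: (@measurableT_comp _ _ _ _ _ _ (@powR R ^~ 2)) => //.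
  exact: measurableT_comp.
apply: ge0_le_integral => //; [exact: mh|exact: mh|].
move=> x _ /=; rewrite lee_fin ge0_ler_powR ?nnegrE//.
Qed.

Lemma cLnormD f g : cmeasurable f -> cmeasurable g ->
  ('N (f + g)%R <= 'N f + 'N g)%E.
Proof.
move=> mf mg.
have mnf := cmeasurable_normc mf; have mng := cmeasurable_normc mg.
apply: le_trans (minkowski_EFin mu mnf mng _); last by rewrite ler1n.
apply: cLnorm_le.
- exact/cmeasurable_normc/cmeasurableD.
- exact: measurable_funD.
move=> x /=.
have n0 (z : R[i]) : 0 <= normc z by case: z => *; exact: sqrtr_ge0.
by rewrite !ger0_norm ?addr_ge0// le_normcD.
Qed.

Lemma cLnormZ (a : R[i]) f : cmeasurable f ->
  finite_norm mu 2%:E (fun x => normc (f x)) ->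
  ('N (a *: f)%R = (normc a)%:E * 'N f)%E.
Proof.
move=> mf ff.
have nfL : (fun x => normc (f x)) \in Lfun mu 2%:E.
  by rewrite inE; apply/andP; split; rewrite inE //=; exact: cmeasurable_normc.
have p1 : (1 <= 2%:E :> \bar R)%E by rewrite lee_fin ler1n.
have := LnormZ (Lfun_Sub p1 nfL) (normc a).
rewrite ger0_norm; last by case: (a) => *; exact: sqrtr_ge0.
move=> <-; congr ('N[mu]_2%:E [ _ ])%E; apply/funext => x /=.
by rewrite fctE normcM.
Qed.

Lemma cLnorm_ae f g : cmeasurable f -> cmeasurable g -> f = g %[ae mu] ->
  'N f = 'N g.
Proof.
move=> mf mg fg; rewrite unlock; congr (_ `^ _)%E.
have mh w : cmeasurable w ->
    measurable_fun setT (fun x : T => (`|normc (w x)| `^ 2)%:E).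
  move=> /cmeasurable_normc mw.
  apply/measurable_EFinP.
  apply: (@measurableT_comp _ _ _ _ _ _ (@powR R ^~ 2)) => //.
  exact: measurableT_comp.
apply: ge0_ae_eq_integral => //; [exact: mh|exact: mh| | |].
- by move=> x _; exact: poweR_ge0.
- by move=> x _; exact: poweR_ge0.
by apply: filterS fg => x /= /[apply] ->.
Qed.

Lemma cLnorm_eq0 f : cmeasurable f -> 'N f = 0%E -> f = 0 %[ae mu].
Proof.
move=> mf /Lnorm_eq0_eq0 H.
have {}H : (EFin \o (fun x => normc (f x)))%E = \0%E %[ae mu].
  by apply: H => //; exact/measurable_EFinP/cmeasurable_normc.
apply: filterS H => x /= /[apply] -[]; exact: eq0_normc.
Qed.

End square_integrable.

Section L2fun_type.
Context d (T : measurableType d) (R : realType).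
Variable mu : {measure set T -> \bar R}.

Lemma L2fun_submod_closed : submod_closed (L2fun_pred mu).
Proof.
split.
  rewrite inE /=; split.
    by split; rewrite (_ : (fun _ => _) = cst 0)//; exact: measurable_cst.
  rewrite /finite_norm (_ : _ \o _ = cst 0%E) ?Lnorm0//.
  by apply/funext => x /=; congr EFin; exact: normc0.
move=> a f g; rewrite !inE /= => -[mf nf] [mg ng].
have maf := cmeasurableZ a mf.
split; first exact: cmeasurableD.
apply: le_lt_trans (cLnormD mu maf mg) _.
rewrite cLnormZ// lte_add_pinfty// lte_mul_pinfty// lee_fin.
by case: (a) => *; exact: sqrtr_ge0.
Qed.

HB.instance Definition _ :=
  GRing.isSubmodClosed.Build R[i] (T -> R[i]) (L2fun_pred mu) L2fun_submod_closed.

Record L2fun := MkL2fun {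
  L2fun_val :> T -> R[i] ;
  _ : L2fun_val \in L2fun_pred mu }.

HB.instance Definition _ := [isSub for L2fun_val].
HB.instance Definition _ := [Choice of L2fun by <:].
HB.instance Definition _ := [SubChoice_isSubLmodule of L2fun by <:].

Lemma L2funP (f : L2fun) :
  cmeasurable f /\ finite_norm mu 2%:E (fun x => normc (f x)).
Proof. by have := valP f; rewrite inE. Qed.

Definition L2fun_ae (f g : L2fun) : bool := `[< f = g %[ae mu] >].

Lemma L2fun_ae_refl : reflexive L2fun_ae.
Proof. by move=> f; apply/asboolP; exact: ae_eq_refl. Qed.

Lemma L2fun_ae_sym : symmetric L2fun_ae.
Proof. by move=> f g; apply/asboolP/asboolP => /ae_eq_sym. Qed.

Lemma L2fun_ae_trans : transitive L2fun_ae.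
Proof.
by move=> g f h /asboolP fg /asboolP gh; apply/asboolP/(ae_eq_trans fg gh).
Qed.

Canonical L2fun_ae_equiv :=
  EquivRel L2fun_ae L2fun_ae_refl L2fun_ae_sym L2fun_ae_trans.

(** Complex L^2 space: square-integrable functions modulo equality almost
    everywhere. The coercion to functions picks a representative, so it is only
    meaningful up to null sets. *)
Definition L2 : Type := {eq_quot L2fun_ae}.
HB.instance Definition _ := Choice.on L2.
HB.instance Definition _ := EqQuotient.on L2.

Definition L2_fun (f : L2) : T -> R[i] := repr f.
Coercion L2_fun : L2 >-> Funclass.

Implicit Types f g h : L2.

Lemma L2_piE (u v : L2fun) : (\pi_L2 u = \pi_L2 v) <-> u = v %[ae mu].
Proof.
by split=> [/eqmodP /asboolP//|uv]; apply/eqmodP/asboolP.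
Qed.

Lemma L2_eqP f g : f = g <-> f = g %[ae mu].
Proof. by rewrite -(reprK f) -(reprK g) L2_piE !reprK. Qed.

Lemma L2_pi (u : L2fun) : (\pi_L2 u : L2) = u %[ae mu].
Proof. by apply/L2_piE; rewrite reprK. Qed.

Definition L2zero : L2 := \pi_L2 (0 : L2fun).
Definition L2opp f : L2 := \pi_L2 (- repr f : L2fun).
Definition L2add f g : L2 := \pi_L2 (repr f + repr g : L2fun).
Definition L2scale (a : R[i]) f : L2 := \pi_L2 (a *: repr f : L2fun).

Fact L2zeroE : L2zero = 0 %[ae mu]. Proof. exact: L2_pi. Qed.
Fact L2oppE f : L2opp f = - (f : T -> R[i]) %[ae mu]. Proof. exact: L2_pi. Qed.
Fact L2addE f g : L2add f g = (f : T -> R[i]) + g %[ae mu].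
Proof. exact: L2_pi. Qed.
Fact L2scaleE a f : L2scale a f = a *: (f : T -> R[i]) %[ae mu].
Proof. exact: L2_pi. Qed.

Fact ae_eqT (u v : T -> R[i]) : u = v %[ae mu] -> \forall x \ae mu, u x = v x.
Proof. by apply: filterS => x; exact. Qed.

Fact L2addA : associative L2add.
Proof.
move=> f g h; apply/L2_eqP; near=> x => _.
have -> : L2add f (L2add g h) x = f x + L2add g h x.
  by near: x; exact: ae_eqT (L2addE f (L2add g h)).
have -> : L2add g h x = g x + h x by near: x; exact: ae_eqT (L2addE g h).
have -> : L2add (L2add f g) h x = L2add f g x + h x.
  by near: x; exact: ae_eqT (L2addE (L2add f g) h).
have -> : L2add f g x = f x + g x by near: x; exact: ae_eqT (L2addE f g).
by rewrite addrA.
Unshelve. all: by end_near. Qed.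

Fact L2addC : commutative L2add.
Proof. by move=> f g; rewrite /L2add addrC. Qed.

Fact L2add0 : left_id L2zero L2add.
Proof.
move=> f; apply/L2_eqP; move: (L2addE L2zero f) L2zeroE.
apply: filterS2 => x /(_ I) + /(_ I) + _.
by rewrite !fctE => -> ->; rewrite add0r.
Qed.

Fact L2addN : left_inverse L2zero L2opp L2add.
Proof.
move=> f; apply/L2_eqP; move: (L2addE (L2opp f) f) (L2oppE f) L2zeroE.
apply: filterS3 => x /(_ I) + /(_ I) + /(_ I) + _.
by rewrite !fctE => -> -> ->; rewrite addNr.
Qed.

HB.instance Definition _ :=
  GRing.isZmodule.Build L2 L2addA L2addC L2add0 L2addN.

Fact L2scaleA a b f : L2scale a (L2scale b f) = L2scale (a * b) f.
Proof.
apply/L2_eqP.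
move: (L2scaleE a (L2scale b f)) (L2scaleE b f) (L2scaleE (a * b) f).
apply: filterS3 => x /(_ I) + /(_ I) + /(_ I) + _.
by rewrite !fctE => -> -> ->; rewrite scalerA.
Qed.

Fact L2scale1 : left_id 1 L2scale.
Proof.
move=> f; apply/L2_eqP; move: (L2scaleE 1 f).
by apply: filterS => x /(_ I) + _; rewrite !fctE => ->; rewrite scale1r.
Qed.

Fact L2scaleDr : right_distributive L2scale +%R.
Proof.
move=> a f g; apply/L2_eqP; near=> x => _.
have -> : L2scale a (f + g) x = a *: ((f + g : L2) x).
  by near: x; exact: ae_eqT (L2scaleE a (f + g)).
have -> : (f + g : L2) x = f x + g x.
  by near: x; exact: ae_eqT (L2addE f g).
have -> : (L2scale a f + L2scale a g : L2) x = L2scale a f x + L2scale a g x.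
  by near: x; exact: ae_eqT (L2addE (L2scale a f) (L2scale a g)).
have -> : L2scale a f x = a *: f x.
  by near: x; exact: ae_eqT (L2scaleE a f).
have -> : L2scale a g x = a *: g x.
  by near: x; exact: ae_eqT (L2scaleE a g).
by rewrite scalerDr.
Unshelve. all: by end_near. Qed.

Fact L2scaleDl f : {morph L2scale^~ f : a b / a + b}.
Proof.
move=> a b; apply/L2_eqP; near=> x => _.
have -> : (L2scale a f + L2scale b f : L2) x = L2scale a f x + L2scale b f x.
  by near: x; exact: ae_eqT (L2addE (L2scale a f) (L2scale b f)).
have -> : L2scale a f x = a *: f x.
  by near: x; exact: ae_eqT (L2scaleE a f).
have -> : L2scale b f x = b *: f x.
  by near: x; exact: ae_eqT (L2scaleE b f).
have -> : L2scale (a + b) f x = (a + b) *: f x.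
  by near: x; exact: ae_eqT (L2scaleE (a + b) f).
by rewrite scalerDl.
Unshelve. all: by end_near. Qed.

HB.instance Definition _ := GRing.Zmodule_isLmodule.Build R[i] L2
  L2scaleA L2scale1 L2scaleDr L2scaleDl.

Lemma L2_0E : (0 : L2) = (0 : T -> R[i]) %[ae mu]. Proof. exact: L2zeroE. Qed.

Lemma L2_DE f g : (f + g : L2) = (f : T -> R[i]) + g %[ae mu].
Proof. exact: L2addE. Qed.

Lemma L2_ZE a f : (a *: f : L2) = a *: (f : T -> R[i]) %[ae mu].
Proof. exact: L2scaleE. Qed.

Definition L2norm f : R := fine ('N[mu]_2%:E [EFin \o (fun x => normc (f x))]).

Lemma L2normE f : (L2norm f)%:E = 'N[mu]_2%:E [EFin \o (fun x => normc (f x))]%E.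
Proof.
rewrite fineK// ge0_fin_numE ?Lnorm_ge0//.
by have [] := L2funP (repr f).
Qed.

Fact L2_cmeasurable f : cmeasurable f. Proof. by have [] := L2funP (repr f). Qed.
Hint Resolve L2_cmeasurable : core.

Lemma L2norm_ae f (u : T -> R[i]) : cmeasurable u -> f = u %[ae mu] ->
  (L2norm f)%:E = 'N[mu]_2%:E [EFin \o (fun x => normc (u x))]%E.
Proof. by move=> mu' fu; rewrite L2normE; exact: cLnorm_ae. Qed.

Fact L2normD f g : (L2norm (f + g))%:C <= (L2norm f)%:C + (L2norm g)%:C.
Proof.
rewrite -rmorphD lecR -lee_fin EFinD !L2normE.
rewrite -L2normE (L2norm_ae _ (L2_DE f g)); last exact: cmeasurableD.
exact: cLnormD.
Qed.

Fact L2normZ (a : R[i]) f : (L2norm (a *: f))%:C = `|a| * (L2norm f)%:C.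
Proof.
have -> : `|a| = (normc a)%:C by [].
rewrite -rmorphM; congr (_%:C); apply: EFin_inj.
rewrite EFinM (L2norm_ae _ (L2_ZE a f)); last exact: cmeasurableZ.
by rewrite L2normE cLnormZ//; have [] := L2funP (repr f).
Qed.

Fact L2norm0_eq0 f : (L2norm f)%:C = 0 -> f = 0.
Proof.
move=> [] f0; apply/L2_eqP.
apply: (ae_eq_trans _ (ae_eq_sym L2_0E)).
by apply: cLnorm_eq0 => //; rewrite -L2normE f0.
Qed.

(* The norm has values in the scalar field R[i], as required of normed modules
   over R[i]; it is the real number [L2norm f], seen in R[i]. *)
HB.instance Definition _ := Lmodule_isNormed.Build R[i] L2
  L2normD L2normZ L2norm0_eq0.

Lemma L2_normE f : `|f| = (L2norm f)%:C. Proof. by []. Qed.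

End L2fun_type.

Section complex_integral.
Context d (T : measurableType d) (R : realType).
Variable mu : {measure set T -> \bar R}.

Definition cintegrable (f : T -> R[i]) : Prop :=
  cmeasurable f /\ mu.-integrable setT (EFin \o (fun x => normc (f x))).

Definition cintegral (f : T -> R[i]) : R[i] :=
  (\int[mu]_x complex.Re (f x)) +i* (\int[mu]_x complex.Im (f x)).

End complex_integral.

(** exp(-it) *)
Definition expNi (R : realType) (t : R) : R[i] := cos t -i* sin t.

(** [L2_extension F f] is the set of the values at [f] of the extension by
    continuity to [L2 mu] of an integral operator [F] that is given pointwise
    on integrable functions: its graph is the closure, in [L2 mu * L2 nu], of
    the graph of [F] on integrable elements of [L2 mu]. *)
Definition L2_extension d d' (T : measurableType d) (U : measurableType d')
    (R : realType) (mu : {measure set T -> \bar R})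
    (nu : {measure set U -> \bar R}) (F : (T -> R[i]) -> (U -> R[i]))
    (f : L2 mu) : set (L2 nu) :=
  [set g | closure [set p : L2 mu * L2 nu |
    cintegrable mu p.1 /\ p.2 = F p.1 %[ae nu]] (f, g)].

Section plane_and_cylinder.
Variable R : realType.

Definition line : measurableType _ := measurableTypeR R.
Definition plane : measurableType _ := (line * line)%type.

Definition circle : Type := {x : plane | x.1 ^+ 2 + x.2 ^+ 2 == 1 :> R}.

Fact circle_angle_subproof (t : R) : cos t ^+ 2 + sin t ^+ 2 == 1 :> R.
Proof. by rewrite cos2Dsin2. Qed.

Definition circle_angle (t : line) : circle :=
  exist _ (cos t, sin t) (circle_angle_subproof t).

HB.instance Definition _ := gen_eqMixin circle.
HB.instance Definition _ := gen_choiceMixin circle.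
HB.instance Definition _ := isPointed.Build circle (circle_angle 0).

(* the Borel sets of the circle are the traces of the Borel sets of the plane *)
HB.instance Definition _ := Measurable.copy circle
  (g_sigma_algebra_preimageType (fun w : circle => sval w)).

Lemma measurable_circle_angle : measurable_fun setT circle_angle.
Proof.
move=> _ _ [B mB <-]; rewrite !setTI.
rewrite [X in measurable X](_ : _ = setT `&`
    (fun t : line => (cos t, sin t) : plane) @^-1` B); last by rewrite setTI.
apply: (@measurable_fun_pair _ _ _ line line line) => //.
  exact: continuous_measurable_fun (@continuous_cos R).
exact: continuous_measurable_fun (@continuous_sin R).
Qed.

HB.instance Definition _ :=
  isMeasurableFun.Build _ _ line circle circle_angle measurable_circle_angle.

Definition angles : set line := `[0, 2 * pi[%classic.

Fact measurable_angles : measurable angles. Proof. exact: measurable_itv. Qed.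

(** Image of the Lebesgue measure on [0, 2pi[ under the unit-speed
    parametrization of the circle. *)
Definition arc_length : set circle -> \bar R :=
  pushforward (mrestr lebesgue_measure measurable_angles) circle_angle.

Fact arc_length0 : arc_length set0 = 0%E.
Proof. by rewrite /arc_length /pushforward preimage_set0 measure0. Qed.

Fact arc_length_ge0 A : (0 <= arc_length A)%E. Proof. exact: measure_ge0. Qed.

Fact arc_length_sigma_additive : semi_sigma_additive arc_length.
Proof.
exact: (@measure_semi_sigma_additive _ _ _ (pushforward
  (mrestr lebesgue_measure measurable_angles) circle_angle)).
Qed.

HB.instance Definition _ := isMeasure.Build _ _ _ arc_length
  arc_length0 arc_length_ge0 arc_length_sigma_additive.

Fact arc_length_fin : fin_num_fun arc_length.
Proof.
move=> A mA; rewrite ge0_fin_numE//.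
apply: (@le_lt_trans _ _ (lebesgue_measure angles)); last first.
  by rewrite /angles lebesgue_measure_itv/=; case: ifP => _; rewrite ltry.
apply: le_measure; rewrite ?inE//; last exact: measurable_angles.
rewrite -[X in measurable (X `&` _)]setTI.
by apply: measurableI; [exact: measurable_circle_angle|exact: measurable_angles].
Qed.

HB.instance Definition _ := Measure_isFinite.Build _ _ _ arc_length arc_length_fin.

Definition leb2 : {measure set plane -> \bar R} :=
  (@lebesgue_measure R \x @lebesgue_measure R)%E.

Definition leb_arc : {measure set (line * circle) -> \bar R} :=
  (@lebesgue_measure R \x arc_length)%E.

Definition fourier_integral (f : plane -> R[i]) (xi : plane) : R[i] :=
  cintegral leb2 (fun x => f x * expNi (x.1 * xi.1 + x.2 * xi.2)).

(** The [xget] here, and in [radial_fourier], picks the unique element of a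
    singleton, by Plancherel's theorem. *)
Definition fourier (f : L2 leb2) : L2 leb2 :=
  xget 0 (L2_extension fourier_integral f).

(** Fourier transform in the first variable, with dual variable [p.1]. *)
Definition radial_fourier_integral (g : line * circle -> R[i])
    (p : line * circle) : R[i] :=
  cintegral (@lebesgue_measure R) (fun s => g (s, p.2) * expNi (s * p.1)).

Definition radial_fourier (g : L2 leb_arc) : L2 leb_arc :=
  xget 0 (L2_extension radial_fourier_integral g).

(** Euclidean disk; [ball] on a product type would be that of the sup norm. *)
Definition disk (rho : R) : set plane :=
  [set x | Num.sqrt (x.1 ^+ 2 + x.2 ^+ 2) < rho].

Definition bandpass (r R' : R) : set (L2 leb2) :=
  [set f | \forall xi \ae leb2, (~` (disk R' `\` disk r)) xi -> fourier f xi = 0].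

Definition polar (p : line * circle) : plane :=
  (p.1 * (sval p.2).1, p.1 * (sval p.2).2).

(** Radon transform, defined by the Fourier slice theorem
      F_s (radon f) (sigma, w) = (F f) (sigma w)   for a.e. (sigma, w).
    There is at most one such element; it exists whenever the right-hand side
    is square-integrable on the cylinder, in particular for bandpass functions.
    The default value 0 is taken otherwise. *)
Definition radon (f : L2 leb2) : L2 leb_arc :=
  xget 0 [set g | radial_fourier g = fourier f \o polar %[ae leb_arc]].

End plane_and_cylinder.

(** Only subspaces of L^2 spaces are considered, so that the norm they inherit
    always comes from an inner product. *)
Definition hilbert_subspace d (T : measurableType d) (R : realType)
    (mu : {measure set T -> \bar R}) (A : set (L2 mu)) : Prop :=
  [/\ A 0,
      forall (a : R[i]) (u v : L2 mu), A u -> A v -> A (a *: u + v),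
      closed A &
      forall F : set_system (L2 mu), ProperFilter F -> F A -> cauchy F ->
        exists v, A v /\ F --> v].

Definition hilbert_isomorphism d d' (T : measurableType d)
    (U : measurableType d') (R : realType)
    (mu : {measure set T -> \bar R}) (nu : {measure set U -> \bar R})
    (A : set (L2 mu)) (B : set (L2 nu)) (F : L2 mu -> L2 nu) : Prop :=
  [/\ hilbert_subspace A /\ hilbert_subspace B,
      forall (a : R[i]) (u v : L2 mu),
        A u -> A v -> F (a *: u + v) = a *: F u + F v,
      set_bij A B F,
      {within A, continuous F} &
      exists G : L2 nu -> L2 mu,
        {in A, cancel F G} /\ {within B, continuous G}].

(* Main.v *)
From HB Require Import structures.
Require Import Defs.
From mathcomp Require Import all_boot all_order all_algebra.
From mathcomp Require Import complex.
From mathcomp Require Import all_classical all_reals all_analysis.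
From mathcomp Require Import measurable_realfun ring lra.

(** On functions that are both integrable and square integrable, Plancherel's
    theorem is proved by Abel summation: with the weight exp(- e |xi|), the
    energy of the Fourier transform of a real function u equals
    2 pi |u|^2 - 1/2 int int (u(x) - u(x - e t))^2 2 / (1 + t^2) dt dx, and the
    correction vanishes as e tends to 0. Applied on almost every fiber, this
    gives Plancherel's theorem for the radial transform F_s (factor 2 pi) and,
    applied twice, for the transform F of the plane (factor (2 pi)^2); both
    transforms extend to L^2 by continuity. The symmetry of the kernel of F_s
    yields F_s (conj (F_s g)) = 2 pi conj g, so F_s is onto and the Radon
    transform of a bandpass function exists. Finally, in polar coordinates
    int int |F f (sigma w)|^2 |sigma| dsigma dw = 2 |F f|^2, where
    r <= |sigma| <= R on the support of F f: hence |radon f|^2 lies between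
    (4 pi / R) |f|^2 and (4 pi / r) |f|^2. A linear map with such bounds on a
    closed subspace is an isomorphism onto its range, which is closed since L^2
    is complete. *)

Set Implicit Arguments.
Unset Strict Implicit.
Unset Printing Implicit Defensive.

Import Order.TTheory GRing.Theory Num.Theory.
Import numFieldNormedType.Exports.
Import Normc.

Local Open Scope classical_set_scope.
Local Open Scope complex_scope.
Local Open Scope ring_scope.
Local Open Scope quotient_scope.

(** * Iterated integrals and affine substitutions *)

(** The maps [fourier], [radial_fourier] and [radon] are chosen elements with default value 0, so
    nothing can be said about them before existence and uniqueness are known. For the two Fourier
    transforms these follow from an energy identity on a dense class and from the completeness of
    L^2. For [radon], existence asks that F f in polar coordinates lie in the range of F_s, which is
    why F_s must be onto. The transform of an integrable function is a priori only bounded. The Abel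
    weight makes every double integral absolutely convergent, and since it increases to 1 it can be
    removed before the transform is known to be square integrable. The correction term is the
    integral of a square: it is stable under L^2 approximation, so that only bounded continuous
    functions have to be treated by hand. The two radii play dual roles. The weight |sigma| of polar
    coordinates degenerates at low frequencies, where r keeps the Radon transform bounded; R bounds
    the weight at high frequencies and with it the inverse. *)

Lemma measurable_swapF d1 d2 d3 (X : measurableType d1) (Y : measurableType d2)
    (Z : measurableType d3) (h : X * Y -> Z) :
  measurable_fun setT h -> measurable_fun setT (fun p : Y * X => h (p.2, p.1)).
Proof.
move=> mh; apply: (measurableT_comp mh).
by apply: measurable_fun_pair.
Qed.

Section iterated_integrals.
Context d1 d2 (X : measurableType d1) (Y : measurableType d2) (R : realType).
Variable m1 : {sigma_finite_measure set X -> \bar R}.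
Variable m2 : {sigma_finite_measure set Y -> \bar R}.

(** Tonelli's theorem gives measurability for the positive and the negative part separately, and the
    integral is by definition the difference of the two. *)
Lemma measurable_integral_param (h : X * Y -> \bar R) :
  measurable_fun setT h -> measurable_fun setT (fun x => \int[m2]_y h (x, y))%E.
Proof.
move=> mh; rewrite (_ : (fun _ => _) =
  (fun x => \int[m2]_y (h^\+ (x, y)) - \int[m2]_y (h^\- (x, y)))%E); last first.
  apply/funext => x; rewrite integralE.
  under eq_integral do rewrite funepos_comp/=.
  by under [X in (_ - X)%E = _]eq_integral do rewrite funeneg_comp/=.
apply: emeasurable_funB.
  apply: (measurable_fun_fubini_tonelli_F (m2 := m2) h^\+%E) => //.
  exact: measurable_funepos.
apply: (measurable_fun_fubini_tonelli_F (m2 := m2) h^\-%E) => //.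
exact: measurable_funeneg.
Qed.

Lemma measurable_Rintegral_param (h : X -> Y -> R) :
  measurable_fun setT (fun p : X * Y => h p.1 p.2) ->
  measurable_fun setT (fun x => \int[m2]_y h x y).
Proof.
move=> mh; rewrite /Rintegral.
apply: (@measurableT_comp _ _ _ _ _ _ (@fine R)) => //.
apply: (@measurable_integral_param (fun p => (h p.1 p.2)%:E)).
exact/measurable_EFinP.
Qed.

End iterated_integrals.

Section Rfubini.
Context d1 d2 (X : measurableType d1) (Y : measurableType d2) (R : realType).
Variable m1 : {sigma_finite_measure set X -> \bar R}.
Variable m2 : {sigma_finite_measure set Y -> \bar R}.
Variable h : X -> Y -> R.
Hypothesis ih : (m1 \x m2)%E.-integrable setT (fun p => (h p.1 p.2)%:E).

Let mh : measurable_fun setT (fun p : X * Y => h p.1 p.2).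
Proof. by apply/measurable_EFinP; exact: measurable_int ih. Qed.

(** A real-valued integral is the [fine] part of the extended one. Fubini's theorem makes the inner
    integral finite almost everywhere, so the two differ on a null set only. *)
Lemma Rintegral12 :
  \int[m1]_x \int[m2]_y h x y = \int[(m1 \x m2)%E]_p h p.1 p.2.
Proof.
rewrite /Rintegral -(integral12_prod_meas1 ih); congr fine.
apply: ae_eq_integral => //.
- apply/measurable_EFinP; exact: measurable_Rintegral_param.
- exact: measurable_fubini_F ih.
have := integrable_ae measurableT (integrable_fubini_F ih).
by apply: filterS => x /= /(_ I) + _ => ?; rewrite fineK.
Qed.

Lemma Rintegral21 :
  \int[m2]_y \int[m1]_x h x y = \int[(m1 \x m2)%E]_p h p.1 p.2.
Proof.
rewrite /Rintegral -(integral21_prod_meas1 ih); congr fine.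
apply: ae_eq_integral => //.
- have mG : measurable_fun setT (fun y => \int[m1]_x h x y).
    apply: (measurable_Rintegral_param m1 (h := fun y x => h x y)).
    exact: (measurable_swapF (h := fun p => h p.1 p.2)).
  exact/measurable_EFinP.
- exact: measurable_fubini_G ih.
have : {ae m2, forall y, (\int[m1]_x (h x y)%:E)%E \is a fin_num}.
  have := ae_integrable2 ih; apply: filterS => y /= i.
  exact: integrable_fin_num.
by apply: filterS => x /= + _ => ?; rewrite fineK.
Qed.

Lemma Rfubini :
  \int[m1]_x \int[m2]_y h x y = \int[m2]_y \int[m1]_x h x y.
Proof. by rewrite Rintegral12 Rintegral21. Qed.

End Rfubini.

(** * Affine changes of variable on the line *)

Section affine.
Variable R : realType.
Local Notation mu := (@lebesgue_measure R).
Local Open Scope ereal_scope.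

Lemma measurable_affine (a b : R) : measurable_fun [set: measurableTypeR R]
  ((fun x : measurableTypeR R => (a * x + b)%R) : measurableTypeR R -> measurableTypeR R).
Proof. by apply: measurable_funD => //; exact: measurable_funM. Qed.

Lemma preimage_itv_oc_affine (a b c d : R) : (0 < a)%R ->
  (fun x : R => (a * x + b)%R) @^-1` `]c, d]%classic =
  `](c - b) / a, (d - b) / a]%classic%R.
Proof.
move=> a0; apply/seteqP; split=> x /=; rewrite !in_itv/=.
  by rewrite ltr_pdivrMr// ler_pdivlMr// ltrBlDr lerBrDr mulrC.
by rewrite ltr_pdivrMr// ler_pdivlMr// ltrBlDr lerBrDr mulrC.
Qed.

(** Uniqueness of Lebesgue measure: the push-forward under x -> a x + b, multiplied by [a], gives
    every interval ]c, d] its length. *)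
Lemma ge0_integral_affine_pos (a b : R) (f : R -> \bar R) : (0 < a)%R ->
  measurable_fun setT f -> (forall x, 0 <= f x) ->
  \int[mu]_x f x = a%:E * \int[mu]_x f (a * x + b)%R.
Proof.
move=> a0 mf f0.
have mphi := measurable_affine a b.
have a0' : (0 <= a)%R by exact: ltW.
pose phi : measurableTypeR R -> measurableTypeR R := fun x => (a * x + b)%R.
unshelve epose (pf := (pushforward mu phi : {measure set (measurableTypeR R) -> \bar R})); first exact: mphi.
pose m : {measure set (measurableTypeR R) -> \bar R} := mscale (NngNum a0') pf.
transitivity (\int[m]_x f x).
  apply: eq_measure_integral => A mA _.
  apply: (@lebesgue_measure_unique R m) => // _ [[c d]] _ <-.
  rewrite /m/= /mscale/= /pushforward preimage_itv_oc_affine// !lebesgue_measure_itv/=.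
  rewrite !lte_fin ltr_pM2r ?invr_gt0// ltrD2r.
  case: ifP => _; last by rewrite mule0.
  by rewrite -EFinM; congr EFin; field; rewrite gt_eqF.
rewrite ge0_integral_mscale//=; congr (_ * _).
by rewrite ge0_integral_pushforward.
Qed.

Lemma ge0_integral_oppr (f : R -> \bar R) :
  measurable_fun setT f -> (forall x, 0 <= f x) ->
  \int[mu]_x f (- x)%R = \int[mu]_x f x.
Proof.
move=> mf f0.
transitivity (\int[pushforward mu (-%R : _ -> measurableTypeR R)]_x f x).
  by rewrite ge0_integral_pushforward//.
by apply: eq_measure_integral => A mA _; exact: lebesgue_measureN.
Qed.

Lemma ge0_integral_affine (a b : R) (f : R -> \bar R) : (a != 0)%R ->
  measurable_fun setT f -> (forall x, 0 <= f x) ->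
  \int[mu]_x f x = `|a|%:E * \int[mu]_x f (a * x + b)%R.
Proof.
move=> a0 mf f0; have [|a1|/eqP] := ltgtP a 0%R; last by rewrite (negbTE a0).
  move=> a1; rewrite ltr0_norm// (@ge0_integral_affine_pos (- a) b)//; last by rewrite oppr_gt0.
  congr (_ * _).
  rewrite -(@ge0_integral_oppr (fun x => f (- a * x + b)%R))//; last first.
    by apply: measurableT_comp => //; exact: measurable_affine.
  by under eq_integral do rewrite mulrNN.
by rewrite gtr0_norm// (@ge0_integral_affine_pos a b).
Qed.

Lemma integrable_affine (a b : R) (f : R -> \bar R) : (a != 0)%R ->
  measurable_fun setT f -> mu.-integrable setT f ->
  mu.-integrable setT (fun x => f (a * x + b)%R).
Proof.
move=> a0 mf /integrableP[_ fi]; apply/integrableP; split.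
  by apply: (measurableT_comp mf); exact: measurable_affine.
move: fi; rewrite (@ge0_integral_affine a b (fun x => `|f x|))//; last exact: measurableT_comp.
rewrite -(lte_pdivlMl _ _ (_ : 0 < `|a|)%R) ?normr_gt0//.
by rewrite gt0_muley ?lte_fin ?invr_gt0 ?normr_gt0.
Qed.

Lemma integral_affine (a b : R) (f : R -> \bar R) : (a != 0)%R ->
  measurable_fun setT f -> mu.-integrable setT f ->
  \int[mu]_x f x = `|a|%:E * \int[mu]_x f (a * x + b)%R.
Proof.
move=> a0 mf fi0; have fi := integrable_affine b a0 mf fi0.
rewrite [in LHS]integralE.
rewrite (@ge0_integral_affine a b f^\+)//; last exact: measurable_funepos.
rewrite (@ge0_integral_affine a b f^\-)//; last exact: measurable_funeneg.
rewrite -muleBr//; last first.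
  apply: fin_num_adde_defl; rewrite fin_numN.
  rewrite (_ : (fun x => f^\- (a * x + b)%R) = (fun x => f (a * x + b)%R)^\-).
    exact: (integrable_neg_fin_num _ fi).
  first [by apply/funext => x; rewrite /funeneg /= | exact/esym/funeneg_comp].
congr (_ * _); rewrite [RHS]integralE.
under [in RHS]eq_integral do rewrite funepos_comp/=.
by under [X in _ = _ - X]eq_integral do rewrite funeneg_comp/=.
Qed.

End affine.

(** * Plancherel theorem for real functions on the line *)

Section poisson.
Variable R : realType.
Local Notation mu := (@lebesgue_measure R).
Implicit Types (e t x : R).

Lemma is_derive_ext (f g : R -> R) x (d d' : R) :
  is_derive x 1 f d -> f =1 g -> d = d' -> is_derive x 1 g d'.
Proof. by move=> + /funext <- <-. Qed.

Lemma is_derive_mull t x : is_derive x 1 (fun y : R => t * y) t.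
Proof.
apply: is_derive_ext (is_deriveZ t (is_derive_id x (1:R))) _ _ => //.
by rewrite /GRing.scale/= mulr1.
Qed.

Lemma is_derive_expNM e x :
  is_derive x 1 (fun y => expR (- (e * y))) (- e * expR (- (e * x))).
Proof.
apply: is_derive_ext (is_derive1_comp (is_derive_expR _) (is_derive_mull (- e) x)) _ _.
  by move=> y /=; rewrite mulNr.
by rewrite mulrC !mulNr.
Qed.

Lemma is_derive_cosM t x : is_derive x 1 (fun y => cos (t * y)) (- t * sin (t * x)).
Proof.
apply: is_derive_ext (is_derive1_comp (is_derive_cos _) (is_derive_mull t x)) _ _ => //.
by ring.
Qed.

Lemma is_derive_sinM t x : is_derive x 1 (fun y => sin (t * y)) (t * cos (t * x)).
Proof.
apply: is_derive_ext (is_derive1_comp (is_derive_sin _) (is_derive_mull t x)) _ _ => //.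
by rewrite mulrC.
Qed.

Lemma is_derive_continuous (f : R -> R) x (d : R) : is_derive x 1 f d -> {for x, continuous f}.
Proof. by move=> [df _]; apply: differentiable_continuous; exact/derivable1_diffP. Qed.

(** The 1 added to the cosine makes the integrand nonnegative, as the improper form of the
    fundamental theorem of calculus requires; its contribution is subtracted afterwards. [F] is the
    primitive that vanishes at infinity. *)
Let f e t x := expR (- (e * x)) * (1 + cos (t * x)).
Let F e t x := expR (- (e * x)) *
  (- e^-1 + (t * sin (t * x) - e * cos (t * x)) / (e ^+ 2 + t ^+ 2)).

Let is_derive_F e t x : 0 < e -> is_derive x 1 (F e t) (f e t x).
Proof.
move=> e0; pose q := (e ^+ 2 + t ^+ 2)^-1.
have et0 : e ^+ 2 + t ^+ 2 != 0 by rewrite gt_eqF// ltr_pwDl ?exprn_gt0// sqr_ge0.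
have dG : is_derive x 1 (fun y => - e^-1 + (t * sin (t * y) - e * cos (t * y)) * q)
    ((t * (t * cos (t * x)) - e * (- t * sin (t * x))) * q).
  have d1 := is_deriveZ t (is_derive_sinM t x).
  have d2 := is_deriveZ e (is_derive_cosM t x).
  have d3 := is_deriveZ q (is_deriveB d1 d2).
  have d4 := is_deriveD (is_derive_cst (- e^-1) x (1:R)) d3.
  apply: is_derive_ext d4 _ _.
    by move=> y; rewrite /= mulrC.
  by rewrite /GRing.scale/= add0r mulrC.
have d5 := is_deriveM (is_derive_expNM e x) dG.
apply: is_derive_ext d5 _ _ => //.
rewrite /GRing.scale/= /f /q; field; rewrite et0 gt_eqF//.
Qed.

Let f_ge0 e t x : 0 <= f e t x.
Proof. by rewrite mulr_ge0 ?expR_ge0// -lerBlDl sub0r cos_geN1. Qed.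

Let cont_f e t : continuous (f e t).
Proof.
move=> x; have d := is_deriveM (is_derive_expNM e x)
  (is_deriveD (is_derive_cst (1:R) x (1:R)) (is_derive_cosM t x)).
exact: is_derive_continuous d.
Qed.

Let cvg_F e t : 0 < e -> F e t x @[x --> +oo] --> (0 : R).
Proof.
move=> e0.
have et0 : 0 < e ^+ 2 + t ^+ 2 by rewrite ltr_pwDl ?exprn_gt0// sqr_ge0.
pose M := e^-1 + (`|t| + e) / (e ^+ 2 + t ^+ 2).
have cE : M * expR (- (e * x)) @[x --> +oo] --> (0 : R).
  rewrite -[X in _ --> X](mulr0 M); apply: cvgM; first exact: cvg_cst.
  apply: (@cvg_comp _ _ _ (fun z : R => e * z) (fun z => expR (- z)) _ (pinfty_nbhs R)); last exact: cvgr_expR.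
  exact: gt0_cvgMry.
have FM x : `|F e t x| <= M * expR (- (e * x)).
  rewrite normrM ger0_norm ?expR_ge0// mulrC ler_wpM2r ?expR_ge0//.
  apply: le_trans (ler_normD _ _) _; apply: lerD.
    by rewrite normrN ger0_norm// invr_ge0 ltW.
  rewrite normrM [X in _ * X]ger0_norm ?invr_ge0 ?(ltW et0)//.
  rewrite ler_wpM2r ?invr_ge0 ?(ltW et0)//.
  apply: le_trans (ler_normB _ _) _; apply: lerD; rewrite normrM.
    by rewrite ler_piMr// sin_max.
  by rewrite (ger0_norm (ltW e0)) ler_piMr ?cos_max// ltW.
apply: (@squeeze_cvgr _ _ _ _ (fun x => - (M * expR (- (e * x)))) (fun x => M * expR (- (e * x)))) => //.
  by near=> x; rewrite -ler_norml.
by rewrite -oppr0; exact: cvgN.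
Unshelve. all: by end_near. Qed.

Let integral_f e t : 0 < e ->
  (\int[mu]_(x in [set x | (0 <= x)%R]) (f e t x)%:E = (e^-1 + e / (e ^+ 2 + t ^+ 2))%:E)%E.
Proof.
move=> e0.
rewrite -set_itvcy (@ge0_continuous_FTC2y _ (f e t) (F e t) 0 0)//.
- rewrite /F !mulr0 oppr0 expR0 sin0 cos0 mul1r mulr0 sub0r mulr1 -EFinD; congr EFin.
  by rewrite mulNr; ring.
- exact/continuous_subspaceT/cont_f.
- exact: cvg_F.
- apply/cvg_at_right_filter.
  exact: is_derive_continuous (is_derive_F t 0 e0).
- by move=> x _; rewrite derive1E; case: (is_derive_F t x e0).
Qed.

Let integral_ft e t : 0 < e ->
  (\int[mu]_x (expR (- (e * `|x|)) * (1 + cos (t * x)))%:E =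
   (2 / e + 2 * e / (e ^+ 2 + t ^+ 2))%:E)%E.
Proof.
move=> e0.
have fE x : expR (- (e * `|x|)) * (1 + cos (t * x)) = f e t `|x|.
  by rewrite /f; congr (_ * (1 + _)); case: (ler0P x) => _ //; rewrite mulrN cosN.
rewrite (@ge0_symfun_integralT _ (fun x => expR (- (e * `|x|)) * (1 + cos (t * x)))).
- rewrite (@eq_integral _ _ _ mu _ (EFin \o f e t)); last first.
    by move=> x; rewrite inE/= => x0; rewrite fE ger0_norm.
  by rewrite integral_f// -EFinM mulrDr mulrA.
- by move=> x; rewrite fE.
- move=> x; rewrite (_ : (fun _ => _) = f e t \o Num.norm); last exact/funext.
  by apply: continuous_comp; [exact: norm_continuous|exact: cont_f].
- by move=> x; rewrite /= normrN mulrN cosN.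
Qed.

Lemma measurable_expNabs e : measurable_fun setT (fun x : R => expR (- (e * `|x|))).
Proof.
apply: (measurableT_comp (@measurable_expR R)).
apply: measurableT_comp => //.
by apply: measurable_funM => //; exact: measurable_normr.
Qed.

(** The case t = 0 of the previous integral, where the factor 1 + cos (t x) is the constant 2. *)
Lemma integral_expNabs e : 0 < e ->
  (\int[mu]_x (expR (- (e * `|x|)))%:E = (2 / e)%:E)%E.
Proof.
move=> e0; have := integral_ft 0 e0.
under eq_integral do rewrite mul0r cos0 -(mulr2n 1) mulrC EFinM.
rewrite ge0_integralZl//; last first.
  by apply/measurable_EFinP; exact: measurable_expNabs.
move=> H; rewrite -[LHS]mul1e (_ : 1%E = (2^-1)%:E * 2%:E)%E; last first.
  by rewrite -EFinM mulVf.
by rewrite -muleA [X in (_ * X)%E]H -EFinM; congr EFin; field; rewrite gt_eqF.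
Qed.

Lemma integrable_expNabs e : 0 < e ->
  mu.-integrable setT (fun x => (expR (- (e * `|x|)))%:E).
Proof.
move=> e0; apply/integrableP; split.
  by apply/measurable_EFinP; exact: measurable_expNabs.
under eq_integral do rewrite /= ger0_norm ?expR_ge0//.
by rewrite integral_expNabs// ltry.
Qed.

Lemma integrable_expNabsM (g : R -> R) e : 0 < e -> measurable_fun setT g ->
  (forall x, `|g x| <= 1) ->
  mu.-integrable setT (fun x => (expR (- (e * `|x|)) * g x)%:E).
Proof.
move=> e0 mg g1; apply: (le_integrable _ _ _ (integrable_expNabs e0)) => //.
  apply/measurable_EFinP; apply: measurable_funM => //; exact: measurable_expNabs.
move=> x _; rewrite lee_fin normrM ler_piMr//.
Qed.

(** The right-hand side is 2 pi times the Poisson kernel of the half-plane at height [e]. *)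
Lemma Rintegral_expNabs_cos e t : 0 < e ->
  \int[mu]_x (expR (- (e * `|x|)) * cos (t * x)) = 2 * e / (e ^+ 2 + t ^+ 2).
Proof.
move=> e0.
have mc : measurable_fun setT (fun x : R => cos (t * x)).
  apply: continuous_measurable_fun => x.
  exact: is_derive_continuous (is_derive_cosM t x).
have := integral_ft t e0.
under eq_integral do rewrite mulrDr mulr1 EFinD.
rewrite integralD//; last 2 first.
- exact: integrable_expNabs.
- by apply: integrable_expNabsM => // x; exact: cos_max.
rewrite integral_expNabs// -[X in (_ + X)%E]fineK; last first.
  apply: integrable_fin_num => //.
  by apply: integrable_expNabsM => // x; exact: cos_max.
by rewrite -EFinD => -[] /addrI.
Qed.

Lemma continuous_cauchy_kernel a e : 0 < e -> continuous (fun t => a / (e + t ^+ 2)).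
Proof.
move=> e0 x.
apply: (@continuousM _ _ (cst a) (fun t => (e + t ^+ 2)^-1)); first exact: cst_continuous.
apply: (@continuousV _ _ (fun t : R => e + t ^+ 2)).
  by rewrite gt_eqF// ltr_pwDl// sqr_ge0.
by apply: cvgD; [exact: cvg_cst|exact: exprn_continuous].
Qed.

Lemma measurable_cauchy_kernel a e : 0 < e ->
  measurable_fun setT (fun t : R => a / (e + t ^+ 2)).
Proof.
by move=> e0; apply: continuous_measurable_fun; exact: continuous_cauchy_kernel.
Qed.

(** This total mass is the origin of the constant 2 pi in Plancherel's theorem. *)
Lemma integral_cauchy_kernel : (\int[mu]_t (2 / (1 + t ^+ 2))%:E = (2 * pi)%:E :> \bar R)%E.
Proof.
have p0 (x : R) : 0 < 1 + x ^+ 2 by rewrite ltr_pwDl// sqr_ge0.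
have cf : continuous (fun t : R => 2 / (1 + t ^+ 2)) by exact: continuous_cauchy_kernel.
have dF (x : R) : is_derive x 1 (fun y : R => 2 * atan y) (2 / (1 + x ^+ 2)).
  exact: is_deriveZ.
rewrite ge0_symfun_integralT//; last 2 first.
- by move=> x; rewrite divr_ge0// ltW.
- by move=> x /=; rewrite sqrrN.
rewrite -set_itvcy (@ge0_continuous_FTC2y _ _ (fun y : R => 2 * atan y) 0 (2 * (pi / 2)))//.
- by rewrite atan0 mulr0 sube0 -EFinM; congr EFin; field.
- by move=> x _; rewrite divr_ge0// ltW.
- exact: continuous_subspaceT.
- by apply: cvgM; [exact: cvg_cst|exact: cvgy_atan].
- apply/cvg_at_right_filter; exact: is_derive_continuous (dF 0).
- by move=> x _; rewrite derive1E; case: (dF x).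
Qed.

End poisson.

(** Measurability by recursion on the term, with the hypotheses of the context for its atoms. *)
Ltac meas := repeat lazymatch goal with
  | H : measurable_fun setT ?u |- measurable_fun _ ?u => exact: H
  | |- measurable_fun _ (fun x => x) => exact: measurable_id
  | |- measurable_fun _ (fun _ => ?a) => exact: measurable_cst
  | |- measurable_fun _ fst => exact: measurable_fst
  | |- measurable_fun _ snd => exact: measurable_snd
  | |- measurable_fun _ (fun x => (@?f x * @?g x)%R) => apply: (@measurable_funM _ _ _ _ f g)
  | |- measurable_fun _ (fun x => (@?f x - @?g x)%R) => apply: (@measurable_funB _ _ _ _ f g)
  | |- measurable_fun _ (fun x => (@?f x + @?g x)%R) => apply: (@measurable_funD _ _ _ _ f g)
  | |- measurable_fun _ (fun x => (- @?f x)%R) => apply: (measurableT_comp (@oppr_measurable _ setT) (g := f))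
  | |- measurable_fun _ (fun x => (@?f x ^+ _)%R) => apply: (@measurable_funX _ _ _ _ f)
  | |- measurable_fun _ (fun x => (`| @?f x |)%R) => apply: (measurableT_comp (@normr_measurable _ setT) (g := f))
  | |- measurable_fun _ (fun x => expR (@?f x)) => apply: (measurableT_comp (@measurable_expR _) (g := f))
  | |- measurable_fun _ (fun x => cos (@?f x)) =>
      apply: (measurableT_comp (continuous_measurable_fun (@continuous_cos _)) (g := f))
  | |- measurable_fun _ (fun x => sin (@?f x)) =>
      apply: (measurableT_comp (continuous_measurable_fun (@continuous_sin _)) (g := f))
  | H : measurable_fun setT ?u |- measurable_fun _ (fun x => ?u (@?f x)) => apply: (measurableT_comp H (g := f))
  | |- measurable_fun _ (fun x => fst (@?f x)) => apply: (measurableT_comp measurable_fst (g := f))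
  | |- measurable_fun _ (fun x => snd (@?f x)) => apply: (measurableT_comp measurable_snd (g := f))
  end.

Section integrable_helpers.
Context d (T : measurableType d) (R : realType) (mu : {measure set T -> \bar R}).

Lemma le_Rintegrable (f g : T -> R) : measurable_fun setT f ->
  (forall x, `|f x| <= g x) ->
  mu.-integrable setT (fun x => (g x)%:E) ->
  mu.-integrable setT (fun x => (f x)%:E).
Proof.
move=> mf fg; apply: le_integrable => //; first exact/measurable_EFinP.
by move=> x _ /=; rewrite lee_fin (le_trans (fg x))// ler_norm.
Qed.

Lemma ge0_Rintegrable (f : T -> R) : measurable_fun setT f -> (forall x, 0 <= f x) ->
  (\int[mu]_x (f x)%:E < +oo)%E -> mu.-integrable setT (fun x => (f x)%:E).
Proof.
move=> mf f0 fi; apply/integrableP; split; first exact/measurable_EFinP.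
by under eq_integral do rewrite /= ger0_norm//.
Qed.

Lemma Rintegrable_measurable (f : T -> R) :
  mu.-integrable setT (fun x => (f x)%:E) -> measurable_fun setT f.
Proof. by move=> /measurable_int /measurable_EFinP. Qed.

Lemma EFin_Rintegral (f : T -> R) : mu.-integrable setT (fun x => (f x)%:E) ->
  ((\int[mu]_x f x)%:E = \int[mu]_x (f x)%:E)%E.
Proof. by move=> fi; rewrite /Rintegral fineK//; exact: integrable_fin_num. Qed.

Lemma integrable_mul_bounded (f g : T -> R) (M : R) : measurable_fun setT g ->
  (forall x, `|g x| <= M) ->
  mu.-integrable setT (fun x => (f x)%:E) ->
  mu.-integrable setT (fun x => (f x * g x)%:E).
Proof.
move=> mg gM fi; have mf := Rintegrable_measurable fi.
apply: (@le_Rintegrable _ (fun x => M * `|f x|)).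
- exact: measurable_funM.
- by move=> x; rewrite normrM mulrC ler_wpM2r.
- have := integrableZl measurableT M (integrable_abse fi).
  by [].
Qed.

End integrable_helpers.

Lemma integrable_prod d1 d2 (X : measurableType d1) (Y : measurableType d2) (R : realType)
  (m1 : {sigma_finite_measure set X -> \bar R})
  (m2 : {sigma_finite_measure set Y -> \bar R}) (f : X -> R) (g : Y -> R) :
  m1.-integrable setT (fun x => (f x)%:E) -> m2.-integrable setT (fun x => (g x)%:E) ->
  (m1 \x m2)%E.-integrable setT (fun p => (f p.1 * g p.2)%:E).
Proof.
move=> fi gi; have mf := Rintegrable_measurable fi; have mg := Rintegrable_measurable gi.
apply/integrable12ltyP.
  by apply/measurable_EFinP; meas.
under eq_integral => x _.
  under eq_integral => y _ do rewrite /= normrM EFinM.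
  rewrite ge0_integralZl//; last first.
    by apply/measurable_EFinP; meas.
  over.
rewrite ge0_integralZr//; last 2 first.
- by apply/measurable_EFinP; meas.
- exact: integral_ge0.
move/integrableP : fi => [_ fi]; move/integrableP : gi => [_ gi].
rewrite lte_mul_pinfty// ?integral_ge0// ge0_fin_numE//; exact: integral_ge0.
Qed.

(** 2 pi times the standard Cauchy density; it is the cosine transform of exp(- |x|). *)
Definition cauchy_kernel (R : realType) (t : R) : R := 2 / (1 + t ^+ 2).

(** * Weighted energy of the Fourier transform *)

Section fourier_energy.
Variable R : realType.
Local Notation mu := (@lebesgue_measure R).

Definition cos_transform (u : R -> R) (xi : R) := \int[mu]_x (u x * cos (x * xi)).
Definition sin_transform (u : R -> R) (xi : R) := \int[mu]_x (u x * sin (x * xi)).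

Variable u : R -> R.
Hypothesis iu : mu.-integrable setT (fun x => (u x)%:E).

Let mu_ : measurable_fun setT u. Proof. exact: Rintegrable_measurable iu. Qed.

Lemma integrable_mul_cos xi : mu.-integrable setT (fun x => (u x * cos (x * xi))%:E).
Proof.
by apply: (@integrable_mul_bounded _ _ _ _ _ _ 1) => //; [meas | move=> x; exact: cos_max].
Qed.

Lemma integrable_mul_sin xi : mu.-integrable setT (fun x => (u x * sin (x * xi))%:E).
Proof.
by apply: (@integrable_mul_bounded _ _ _ _ _ _ 1) => //; [meas | move=> x; exact: sin_max].
Qed.

Lemma measurable_cos_transform : measurable_fun setT (cos_transform u).
Proof.
apply: (@measurable_Rintegral_param _ _ _ _ _ mu (fun xi x => u x * cos (x * xi))).
by meas.
Qed.

Lemma measurable_sin_transform : measurable_fun setT (sin_transform u).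
Proof.
apply: (@measurable_Rintegral_param _ _ _ _ _ mu (fun xi x => u x * sin (x * xi))).
by meas.
Qed.

Lemma cos_transform_le xi : `|cos_transform u xi| <= \int[mu]_x `|u x|.
Proof.
apply: le_trans (le_normr_Rintegral _ (integrable_mul_cos xi)) _ => //.
apply: le_Rintegral => //.
- exact: (integrable_abse (integrable_mul_cos xi)).
- exact: (integrable_abse iu).
- by move=> x _; rewrite normrM ler_piMr// cos_max.
Qed.

Lemma sin_transform_le xi : `|sin_transform u xi| <= \int[mu]_x `|u x|.
Proof.
apply: le_trans (le_normr_Rintegral _ (integrable_mul_sin xi)) _ => //.
apply: le_Rintegral => //.
- exact: (integrable_abse (integrable_mul_sin xi)).
- exact: (integrable_abse iu).
- by move=> x _; rewrite normrM ler_piMr// sin_max.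
Qed.

Lemma Rintegral_cos_sin (a b : R) xi :
  \int[mu]_y (u y * (a * cos (y * xi) + b * sin (y * xi))) =
  a * cos_transform u xi + b * sin_transform u xi.
Proof.
rewrite /cos_transform /sin_transform -!RintegralZl//; last 2 first.
- exact: integrable_mul_sin.
- exact: integrable_mul_cos.
rewrite -RintegralD//; last 2 first.
- exact: (integrableZl measurableT a (integrable_mul_cos xi)).
- exact: (integrableZl measurableT b (integrable_mul_sin xi)).
by apply: eq_Rintegral => y _; ring.
Qed.

Variable e : R.
Hypothesis e0 : 0 < e.
Let w (xi : R) := expR (- (e * `|xi|)).

Let iw : mu.-integrable setT (fun xi => (w xi)%:E) := integrable_expNabs e0.

Let mw : measurable_fun setT w. Proof. exact: Rintegrable_measurable iw. Qed.

(** By the addition formula this is the integral of u(y) cos((x - y) xi) in y. In the separated form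
    its measurability and its bound by twice the L^1 norm of [u] are immediate, and these are what
    Fubini's theorem asks for. *)
Let c xi x := cos_transform u xi * cos (x * xi) + sin_transform u xi * sin (x * xi).

Let mct := measurable_cos_transform.
Let mst := measurable_sin_transform.

Let L1 := \int[mu]_x `|u x|.

Let c_le xi x : `|c xi x| <= L1 * 1 + L1 * 1.
Proof.
apply: le_trans (ler_normD _ _) _; rewrite !normrM.
by apply: lerD; apply: ler_pM; rewrite ?cos_max ?sin_max ?cos_transform_le ?sin_transform_le.
Qed.

Let inner_x xi : \int[mu]_x (w xi * u x * c xi x) =
  w xi * (cos_transform u xi ^+ 2 + sin_transform u xi ^+ 2).
Proof.
rewrite 2!expr2 -(Rintegral_cos_sin _ _ xi) -RintegralZl//; last first.
  apply: (@integrable_mul_bounded _ _ _ mu u (c xi)) (c_le xi) iu.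
  by rewrite /c; meas.
by apply: eq_Rintegral => x _; rewrite mulrA.
Qed.

Let c_Rintegral xi x : \int[mu]_y (u y * cos ((x - y) * xi)) = c xi x.
Proof.
rewrite /c mulrC [X in _ + X]mulrC -(Rintegral_cos_sin _ _ xi).
by apply: eq_Rintegral => y _; rewrite mulrBl cosB; ring.
Qed.

(* The weight makes Fubini's theorem applicable; the cosine transform of
   exp(- e |xi|) is a rescaled Cauchy kernel. *)
Lemma weighted_energy :
  \int[mu]_xi (w xi * (cos_transform u xi ^+ 2 + sin_transform u xi ^+ 2)) =
  \int[mu]_x \int[mu]_t (u x * u (x - e * t) * cauchy_kernel t).
Proof.
under eq_Rintegral do rewrite -inner_x.
rewrite (Rfubini (m1 := mu) (m2 := mu) (h := fun xi x => w xi * u x * c xi x)); last first.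
  apply: (@integrable_mul_bounded _ _ _ (mu \x mu)%E
    (fun p : measurableTypeR R * measurableTypeR R => w p.1 * u p.2) (fun p => c p.1 p.2)
    (L1 * 1 + L1 * 1)) => //.
    by rewrite /c; meas.
  exact: (@integrable_prod _ _ _ _ _ mu mu w u).
apply: eq_Rintegral => x _.
(* Exchanging the integrals in y and xi replaces the weighted cosine by its integral, the Poisson
   kernel at x - y. *)
transitivity (u x * \int[mu]_y (u y * (2 * e / (e ^+ 2 + (x - y) ^+ 2)))).
  have -> : \int[mu]_y (u y * (2 * e / (e ^+ 2 + (x - y) ^+ 2))) =
      \int[mu]_y \int[mu]_xi (w xi * u y * cos ((x - y) * xi)).
    apply: eq_Rintegral => y _.
    rewrite -(Rintegral_expNabs_cos _ e0) -RintegralZl//; last first.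
      apply: integrable_expNabsM => //; first by meas.
      by move=> z; exact: cos_max.
    by apply: eq_Rintegral => z _; rewrite /w; ring.
  rewrite -(Rfubini (m1 := mu) (m2 := mu) (h := fun xi y => w xi * u y * cos ((x - y) * xi))); last first.
    apply: (@integrable_mul_bounded _ _ _ (mu \x mu)%E
      (fun p : measurableTypeR R * measurableTypeR R => w p.1 * u p.2)
      (fun p => cos ((x - p.2) * p.1)) 1) => //.
    - by meas.
    - by move=> p; exact: cos_max.
    exact: (@integrable_prod _ _ _ _ _ mu mu w u).
  rewrite -RintegralZl//; last first.
    rewrite (_ : _ \o _ = fun xi => (w xi * c xi x)%:E); last first.
      apply/funext => xi /=; congr EFin; rewrite -c_Rintegral -RintegralZl//.
        by apply: eq_Rintegral => y _; rewrite mulrA.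
      apply: (@integrable_mul_bounded _ _ _ mu u (fun y => cos ((x - y) * xi)) 1) => //.
      - by meas.
      - by move=> p; exact: cos_max.
    apply: (@integrable_mul_bounded _ _ _ mu w (fun xi => c xi x) (L1 * 1 + L1 * 1)) => //.
    by rewrite /c; meas.
  apply: eq_Rintegral => xi _; rewrite -c_Rintegral -!RintegralZl//; last 2 first.
  - apply: (@integrable_mul_bounded _ _ _ mu (fun y => w xi * u y) (fun y => cos ((x - y) * xi)) 1) => //.
    + by meas.
    + by move=> p; exact: cos_max.
    + exact: (integrableZl measurableT (w xi) iu).
  - apply: (@integrable_mul_bounded _ _ _ mu u (fun y => cos ((x - y) * xi)) 1) => //.
    + by meas.
    + by move=> p; exact: cos_max.
  by apply: eq_Rintegral => y _; ring.
have ee (z : R) : 0 < e ^+ 2 + z ^+ 2 by rewrite ltr_pwDl ?exprn_gt0// sqr_ge0.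
have mP : measurable_fun setT (fun z : R => 2 * e / (e ^+ 2 + z ^+ 2)).
  by apply: measurable_cauchy_kernel; exact: exprn_gt0.
have PM z : `|2 * e / (e ^+ 2 + z ^+ 2)| <= 2 / e.
  rewrite ger0_norm; last by rewrite divr_ge0 ?mulr_ge0// ltW.
  by rewrite ler_pdivrMr// mulrAC ler_pdivlMr// mulrDr -mulrA -expr2 lerDl mulr_ge0// sqr_ge0.
have mPx : measurable_fun setT (fun y : R => 2 * e / (e ^+ 2 + (x - y) ^+ 2)).
  by apply: (measurableT_comp mP); meas.
have iP : mu.-integrable setT (fun y => (u y * (2 * e / (e ^+ 2 + (x - y) ^+ 2)))%:E).
  exact: (@integrable_mul_bounded _ _ _ mu u _ (2 / e)).
rewrite -RintegralZl// /Rintegral; congr fine.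
(* The substitution y = x - e t: the factor e and the kernel 2 e / (e^2 + e^2 t^2) multiply to 2 /
   (1 + t^2). *)
rewrite (@integral_affine _ (- e) x) ?oppr_eq0 ?gt_eqF//; last 2 first.
- apply/measurable_EFinP; apply: measurable_funM; first by meas.
  by meas.
- exact: (integrableZl measurableT (u x) iP).
rewrite normrN gtr0_norm// -integralZl//.
  apply: eq_integral => t _; rewrite -EFinM; congr EFin.
  rewrite /cauchy_kernel (_ : - e * t + x = x - e * t); last by ring.
  rewrite (_ : x - (x - e * t) = e * t); last by ring.
  have t0 : 1 + t ^+ 2 != 0 by rewrite gt_eqF// ltr_pwDl// sqr_ge0.
  have e1 : e != 0 by rewrite gt_eqF.
  field; rewrite t0 gt_eqF//=.
have e1 : - e != 0 by rewrite oppr_eq0 gt_eqF.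
have [mf _] := integrableP _ _ _ iP.
exact: (integrableZl measurableT (u x) (integrable_affine x e1 mf iP)).
Qed.

End fourier_energy.

(** * Mean-square continuity against the Cauchy kernel *)

Section translation_energy.
Variable R : realType.
Local Notation mu := (@lebesgue_measure R).
Local Notation T := (measurableTypeR R).
Local Notation mu2 := (@lebesgue_measure R \x @lebesgue_measure R)%E.
Local Notation k := (@cauchy_kernel R).
Implicit Types (u v w : R -> R) (e : R).

Let k_ge0 t : 0 <= k t. Proof. by rewrite divr_ge0// addr_ge0// sqr_ge0. Qed.

Let mk : measurable_fun setT k. Proof. exact: measurable_cauchy_kernel. Qed.

Let ik : mu.-integrable setT (fun t => (k t)%:E).
Proof. by apply: ge0_Rintegrable => //; rewrite integral_cauchy_kernel ltry. Qed.

Let integral_fst (f : R -> R) : measurable_fun setT f -> (forall x, 0 <= f x) ->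
  (\int[mu2]_p (f p.1 * k p.2)%:E = (2 * pi)%:E * \int[mu]_x (f x)%:E)%E.
Proof.
move=> mf f0; rewrite fubini_tonelli1/=; last 2 first.
- by apply/measurable_EFinP; meas.
- by move=> p; rewrite lee_fin mulr_ge0.
rewrite /fubini_F/=; under eq_integral => x _.
  under eq_integral do rewrite EFinM.
  rewrite ge0_integralZl//; last 3 first.
  - exact/measurable_EFinP.
  - by move=> t _; rewrite lee_fin.
  - by rewrite lee_fin.
  rewrite [X in (_ * X)%E](integral_cauchy_kernel R) muleC; over.
rewrite ge0_integralZl//; last 3 first.
- exact/measurable_EFinP.
- by move=> t _; rewrite lee_fin.
by rewrite lee_fin mulr_ge0// pi_ge0.
Qed.

(** Integrating in the first variable first removes the shift, by translation invariance. *)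
Let integral_shift (f : R -> R) e : measurable_fun setT f -> (forall x, 0 <= f x) ->
  (\int[mu2]_p (f (p.1 - e * p.2) * k p.2)%:E = (2 * pi)%:E * \int[mu]_x (f x)%:E)%E.
Proof.
move=> mf f0; rewrite fubini_tonelli2/=; last 2 first.
- by apply/measurable_EFinP; meas.
- by move=> p; rewrite lee_fin mulr_ge0.
rewrite /fubini_G/=; under eq_integral => t _.
  under eq_integral do rewrite EFinM.
  rewrite ge0_integralZr//; last 3 first.
  - by apply/measurable_EFinP; meas.
  - by move=> x _; rewrite lee_fin.
  - by rewrite lee_fin.
  rewrite (_ : \int[mu]_x (f (x - e * t))%:E = \int[mu]_x (f x)%:E)%E; last first.
    rewrite [RHS](@ge0_integral_affine _ 1 (- (e * t)) (EFin \o f)) ?oner_eq0//; last exact/measurable_EFinP.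
    by rewrite normr1 mul1e; apply: eq_integral => x _ /=; rewrite mul1r.
  over.
rewrite ge0_integralZl//; last 3 first.
- exact/measurable_EFinP.
- by move=> x _; rewrite lee_fin.
- by apply: integral_ge0 => x _; rewrite lee_fin.
by rewrite [X in (_ * X)%E](integral_cauchy_kernel R) muleC.
Qed.

(** A mean-square modulus of continuity, averaged over the shifts e t. Unlike the product of [u]
    with its translate, the integrand is nonnegative and can be estimated by comparison. *)
Definition translation_energy e u : \bar R :=
  (\int[mu2]_p ((u p.1 - u (p.1 - e * p.2)) ^+ 2 * k p.2)%:E)%E.

Let sq u (x : R) := u x ^+ 2.

(** From (a - b)^2 <= 2 a^2 + 2 b^2, where the integrals of both squares carry the mass 2 pi of the
    kernel: 2 (2 pi + 2 pi) = 8 pi. *)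
Let translation_energy_le e u : measurable_fun setT u ->
  (translation_energy e u <= (8 * pi)%:E * \int[mu]_x (u x ^+ 2)%:E)%E.
Proof.
move=> mu_; have msq : measurable_fun setT (sq u) by rewrite /sq; meas.
have sq0 x : 0 <= sq u x by exact: sqr_ge0.
apply: (@le_trans _ _ (\int[mu2]_p (2%:E * ((sq u p.1 * k p.2)%:E +
    (sq u (p.1 - e * p.2) * k p.2)%:E))))%E.
  apply: ge0_le_integral => //.
  - by move=> p _; rewrite lee_fin mulr_ge0// sqr_ge0.
  - by apply/measurable_EFinP; meas.
  - apply: emeasurable_funM => //; apply: emeasurable_funD; apply/measurable_EFinP; by meas.
  move=> p _; rewrite -EFinD -EFinM lee_fin -mulrDl mulrA ler_wpM2r//.
  by rewrite /sq; have := sqr_ge0 (u p.1 + u (p.1 - e * p.2)); lra.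
rewrite ge0_integralZl//; last 2 first.
- by apply: emeasurable_funD; apply/measurable_EFinP; meas.
- by move=> p _; rewrite -EFinD lee_fin addr_ge0// mulr_ge0.
rewrite ge0_integralD//; last 4 first.
- by move=> p _; rewrite lee_fin mulr_ge0.
- by apply/measurable_EFinP; meas.
- by move=> p _; rewrite lee_fin mulr_ge0.
- by apply/measurable_EFinP; meas.
rewrite integral_fst// integral_shift// -ge0_muleDl ?lee_fin ?mulr_ge0 ?pi_ge0//.
rewrite muleA -EFinD -EFinM (_ : 2 * (2 * pi + 2 * pi) = 8 * pi)//.
by ring.
Qed.

(** The increment of [u] is that of [v] plus that of u - v, and the square of a sum is at most twice
    the sum of the squares; 16 pi is twice the constant 8 pi. This estimate reduces the vanishing of
    the energy to a dense class. *)
Lemma translation_energy_sub e u v : measurable_fun setT u -> measurable_fun setT v ->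
  (translation_energy e u <= 2%:E * translation_energy e v +
     (16 * pi)%:E * \int[mu]_x ((u x - v x) ^+ 2)%:E)%E.
Proof.
move=> mu_ mv; pose w x := u x - v x.
have mw : measurable_fun setT w by rewrite /w; meas.
have msq : measurable_fun setT (sq u) by rewrite /sq; meas.
apply: (@le_trans _ _ (2%:E * translation_energy e v + 2%:E * translation_energy e w))%E; last first.
  apply: leeD2l; rewrite (_ : 16 * pi = 2 * (8 * pi)); last by ring.
  by rewrite EFinM -muleA lee_pmul2l//; exact: translation_energy_le.
have mE (f : R -> R) : measurable_fun setT f ->
    measurable_fun setT (fun p : T * T => ((f p.1 - f (p.1 - e * p.2)) ^+ 2 * k p.2)%:E).
  by move=> mf; apply/measurable_EFinP; meas.
have E0 (f : R -> R) (p : T * T) : (0 <= ((f p.1 - f (p.1 - e * p.2)) ^+ 2 * k p.2)%:E)%E.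
  by rewrite lee_fin mulr_ge0// sqr_ge0.
rewrite /translation_energy -!ge0_integralZl//; [|exact: mE|exact: mE].
rewrite -ge0_integralD//; last 4 first.
- by move=> p _; rewrite mule_ge0.
- by apply: emeasurable_funM => //; exact: mE.
- by move=> p _; rewrite mule_ge0.
- by apply: emeasurable_funM => //; exact: mE.
apply: ge0_le_integral => //.
- exact: mE.
- by apply: emeasurable_funD; apply: emeasurable_funM => //; exact: mE.
move=> p _; rewrite -!EFinM -EFinD lee_fin /w.
move: (k p.2) (k_ge0 p.2) (u p.1) (u (p.1 - _)) (v p.1) (v (p.1 - _)) => K K0 a b c d.
rewrite !(mulrA 2) -mulrDl; apply: ler_wpM2r => //.
by have := sqr_ge0 (c - d - (a - c - (b - d))); nra.
Qed.

Definition translation_product e u := \int[mu]_x \int[mu]_t (u x * u (x - e * t) * k t).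

Let integrable_shift e (f : R -> R) : (forall x, 0 <= f x) ->
  mu.-integrable setT (fun x => (f x)%:E) ->
  mu2.-integrable setT (fun p : T * T => (f (p.1 - e * p.2) * k p.2)%:E).
Proof.
move=> f0 fi; have mf := Rintegrable_measurable fi.
apply: (@ge0_Rintegrable _ _ _ mu2 (fun p : T * T => f (p.1 - e * p.2) * k p.2)).
- by meas.
- by move=> p; rewrite mulr_ge0.
by rewrite integral_shift// -EFin_Rintegral// -EFinM ltry.
Qed.

Let integrable_fst (f : R -> R) : (forall x, 0 <= f x) ->
  mu.-integrable setT (fun x => (f x)%:E) ->
  mu2.-integrable setT (fun p : T * T => (f p.1 * k p.2)%:E).
Proof. by move=> f0 fi; exact: (@integrable_prod _ _ _ _ _ mu mu f k). Qed.

Let integrable_translation_product e u : measurable_fun setT u ->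
  mu.-integrable setT (fun x => (u x ^+ 2)%:E) ->
  mu2.-integrable setT (fun p : T * T => (u p.1 * u (p.1 - e * p.2) * k p.2)%:E).
Proof.
move=> mu_ iu.
apply: (@le_Rintegrable _ _ _ mu2 _
  (fun p : T * T => u p.1 ^+ 2 * k p.2 + u (p.1 - e * p.2) ^+ 2 * k p.2)).
- by meas.
- move=> p; rewrite -mulrDl normrM (ger0_norm (k_ge0 _)) ler_wpM2r// normrM.
  rewrite -(real_normK (num_real (u p.1))) -(real_normK (num_real (u (p.1 - _)))).
  by have := sqr_ge0 (`|u p.1| - `|u (p.1 - e * p.2)|); have := normr_ge0 (u p.1);
    have := normr_ge0 (u (p.1 - e * p.2)); nra.
have := integrableD measurableT (integrable_fst (fun x => sqr_ge0 (u x)) iu)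
  (integrable_shift e (fun x => sqr_ge0 (u x)) iu).
by [].
Qed.

(** Expansion of the square: each of the two pure squares integrates to 2 pi |u|^2. *)
Lemma translation_energyE e u : measurable_fun setT u ->
  mu.-integrable setT (fun x => (u x ^+ 2)%:E) ->
  translation_energy e u =
    (4 * pi * \int[mu]_x (u x ^+ 2) - 2 * translation_product e u)%:E.
Proof.
move=> mu_ iu; have sq0 x : 0 <= sq u x by exact: sqr_ge0.
have iA := integrable_fst sq0 iu; have iB := integrable_shift e sq0 iu.
have iQ := integrable_translation_product e mu_ iu.
have msq : measurable_fun setT (sq u) by rewrite /sq; meas.
rewrite /translation_energy.
under eq_integral => p _.
  rewrite (_ : _ * k p.2 = (sq u p.1 * k p.2 + sq u (p.1 - e * p.2) * k p.2) -
    2 * (u p.1 * u (p.1 - e * p.2) * k p.2)); last by rewrite /sq; ring.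
  rewrite EFinB EFinD [X in (_ - X)%E]EFinM; over.
rewrite integralB//; last 2 first.
- exact: integrableD.
- exact: (integrableZl measurableT 2 iQ).
rewrite integralD// integralZl// integral_fst// integral_shift//.
rewrite -(EFin_Rintegral iu) -(EFin_Rintegral iQ).
rewrite /translation_product (Rintegral12 (m1 := mu) (m2 := mu)
  (h := fun x t => u x * u (x - e * t) * k t))//.
rewrite -!(EFinM, EFinD, EFinN); congr EFin; ring.
Qed.

Local Notation e_ n := (n.+1%:R^-1 : R).

Let cvg_e : (fun n : nat => e_ n) @ \oo --> (0 : R). Proof. exact: cvg_harmonic. Qed.

(** Dominated convergence with the bound M |w(x)| k(t), integrable because [w] and the kernel are;
    the pointwise limit is the continuity of [w]. *)
Let translation_product_cvg w (M : R) : continuous w -> (forall x, `|w x| <= M) ->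
  mu.-integrable setT (fun x => (w x)%:E) ->
  translation_product (e_ n) w @[n --> \oo] --> 2 * pi * \int[mu]_x (w x ^+ 2).
Proof.
move=> cw wM iw.
have mw := Rintegrable_measurable iw.
have M0 : 0 <= M by exact: le_trans (wM 0).
have iw2 : mu.-integrable setT (fun x => (w x ^+ 2)%:E).
  under eq_fun do rewrite expr2.
  exact: (@integrable_mul_bounded _ _ _ mu w w M).
have iQ n := integrable_translation_product (e_ n) mw iw2.
have E n : (translation_product (e_ n) w)%:E =
    (\int[mu2]_p (w p.1 * w (p.1 - e_ n * p.2) * k p.2)%:E)%E.
  rewrite /translation_product (Rintegral12 (m1 := mu) (m2 := mu)
    (h := fun x t => w x * w (x - e_ n * t) * k t))// EFin_Rintegral//.
suff /fine_cvg : (translation_product (e_ n) w)%:E @[n --> \oo] -->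
    (2 * pi * \int[mu]_x (w x ^+ 2))%:E by [].
have mw2 : measurable_fun setT (fun x => w x ^+ 2) by meas.
rewrite EFinM (EFin_Rintegral iw2) -integral_fst//; last by move=> x; exact: sqr_ge0.
under eq_fun do rewrite E.
have := @dominated_convergence _ _ _ mu2 setT measurableT
  (fun n p => (w p.1 * w (p.1 - e_ n * p.2) * k p.2)%:E)
  (fun p => (w p.1 ^+ 2 * k p.2)%:E) (fun p => (`|w p.1| * k p.2 * M)%:E).
case => //.
- by move=> n; apply/measurable_EFinP; meas.
- by apply/measurable_EFinP; meas.
- apply: aeW => p _; apply/cvg_EFin; first exact: nearW.
  rewrite expr2; apply: cvgM; last exact: cvg_cst.
  apply: cvgM; first exact: cvg_cst.
  apply: (@cvg_comp _ _ _ (fun n => p.1 - e_ n * p.2) w); last exact: cw.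
  have : p.1 - e_ n * p.2 @[n --> \oo] --> p.1 - 0 * p.2.
    by apply: cvgB; [exact: cvg_cst|apply: cvgM => //; exact: cvg_cst].
  by rewrite mul0r subr0.
- apply: (@integrable_mul_bounded _ _ _ mu2 (fun p : T * T => `|w p.1| * k p.2) (cst M) M) => //.
    by move=> q; rewrite /= ger0_norm.
  apply: (@integrable_prod _ _ _ _ _ mu mu (fun x => `|w x|) k) => //.
  exact: (integrable_abse iw).
- apply: aeW => p n _; rewrite lee_fin normrM (ger0_norm (k_ge0 _)) normrM mulrAC.
  by apply: ler_wpM2l => //; exact: mulr_ge0.
Unshelve. all: by end_near. Qed.

Lemma translation_energy_cvg w (M : R) : continuous w -> (forall x, `|w x| <= M) ->
  mu.-integrable setT (fun x => (w x)%:E) ->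
  translation_energy (e_ n) w @[n --> \oo] --> 0%E.
Proof.
move=> cw wM iw; have mw := Rintegrable_measurable iw.
have iw2 : mu.-integrable setT (fun x => (w x ^+ 2)%:E).
  under eq_fun do rewrite expr2.
  exact: (@integrable_mul_bounded _ _ _ mu w w M).
under eq_fun do rewrite translation_energyE//.
apply/cvg_EFin; first exact: nearW.
rewrite (_ : 0 = 4 * pi * (\int[mu]_x (w x ^+ 2)) -
  2 * (2 * pi * \int[mu]_x (w x ^+ 2))); last by ring.
apply: cvgB; first exact: cvg_cst.
by apply: cvgM; [exact: cvg_cst|exact: translation_product_cvg wM iw].
Qed.

End translation_energy.

Lemma cvge0_le (R : realType) (f : nat -> \bar R) (d : R) :
  f @ \oo --> 0%E -> 0 < d -> exists N, forall n, (N <= n)%N -> (f n <= d%:E)%E.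
Proof.
move=> /fine_cvgP[ff /cvgrPdist_le f0] /f0 fd.
have [N _ HN] : \forall n \near \oo, (f n <= d%:E)%E.
  near=> n; rewrite -[f n]fineK; last by near: n.
  rewrite lee_fin (le_trans (ler_norm _))// -normrN -sub0r.
  by near: n.
by exists N => n Nn; exact: HN.
Unshelve. all: by end_near. Qed.

(** * Bounded continuous functions are dense in L^2 of the line *)

Section density.
Variable R : realType.
Local Notation mu := (@lebesgue_measure R).
Implicit Types (x y : R).

Let clip (M y : R) : R := Num.max (- M) (Num.min M y).

Let clip_le (M y : R) : 0 <= M -> `|clip M y| <= M.
Proof.
move=> M0; rewrite /clip /Order.max /Order.min ler_norml.
by case: (ifPn (M < y)); rewrite -?leNgt => ?; case: ifPn; rewrite -?leNgt => ?;
  apply/andP; split; lra.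
Qed.

Let clip_lip (M a b : R) : 0 <= M -> `|clip M a - clip M b| <= `|a - b|.
Proof.
move=> M0; rewrite (_ : clip M a = if M < a then M else if a < - M then - M else a); last first.
  by rewrite /clip /Order.max /Order.min; case: (ifPn (M < a)); rewrite -?leNgt => ?;
    case: ifPn; rewrite -?leNgt => ?; try (case: ifPn; rewrite -?leNgt => ?); lra.
rewrite (_ : clip M b = if M < b then M else if b < - M then - M else b); last first.
  by rewrite /clip /Order.max /Order.min; case: (ifPn (M < b)); rewrite -?leNgt => ?;
    case: ifPn; rewrite -?leNgt => ?; try (case: ifPn; rewrite -?leNgt => ?); lra.
by case: (ifPn (M < a)); rewrite -?leNgt => ?; case: (ifPn (M < b)); rewrite -?leNgt => ?;
  try (case: (ifPn (a < - M)); rewrite -?leNgt => ?);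
  try (case: (ifPn (b < - M)); rewrite -?leNgt => ?);
  rewrite ler_norml; case: (ger0P (a - b)) => ?; apply/andP; split; lra.
Qed.

Let clip_id (M y : R) : `|y| <= M -> clip M y = y.
Proof.
rewrite ler_norml /clip /Order.max /Order.min => /andP[? ?].
by case: (ifPn (M < y)); rewrite -?leNgt => ?; case: ifPn; rewrite -?leNgt => ?; lra.
Qed.

(** The subtracted number lies between 0 and [y], so the remainder is no larger than [y]. This
    supplies the dominating function u^2 below. *)
Let clip_sqr_le (M y t : R) : 0 <= M -> 0 <= t <= 1 -> (y - clip M y * t) ^+ 2 <= y ^+ 2.
Proof.
rewrite /clip /Order.max /Order.min => M0 /andP[t0 t1].
suff : 0 <= clip M y * t * (2 * y - clip M y * t) by rewrite /clip /Order.max /Order.min; nra.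
rewrite /clip /Order.max /Order.min.
case: (ifPn (M < y)); rewrite -?leNgt => ?; case: ifPn; rewrite -?leNgt => ?.
- by apply: mulr_ge0; nra.
- by apply: mulr_ge0; nra.
- rewrite (_ : y * t * (2 * y - y * t) = y ^+ 2 * (t * (2 - t))); last by ring.
  by rewrite mulr_ge0 ?sqr_ge0// mulr_ge0//; lra.
- by rewrite -mulrNN; apply: mulr_ge0; nra.
Qed.

Let measurable_clip M : measurable_fun setT (clip M).
Proof. by apply: measurable_maxr => //; exact: measurable_minr. Qed.

Let continuous_clip (M : R) (g : R -> R) : continuous g -> continuous (fun x => clip M (g x)).
Proof.
move=> cg x.
apply: (@continuous_max _ _ (cst (- M)) (fun x => Num.min M (g x))); first exact: cst_continuous.
by apply: (@continuous_min _ _ (cst M) g); [exact: cst_continuous|exact: cg].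
Qed.

Let tent (M x : R) : R := Num.max 0 (1 - `|x| / M).

Let tent01 (M x : R) : 0 < M -> 0 <= tent M x <= 1.
Proof.
move=> M0; have : 0 <= `|x| / M by rewrite divr_ge0// ltW.
by rewrite /tent /Order.max; case: ifPn; rewrite -?leNgt => ? ?; apply/andP; split; lra.
Qed.

Let continuous_tent (M : R) : continuous (tent M).
Proof.
move=> x; apply: (@continuous_max _ _ (cst 0) (fun x => 1 - `|x| / M)).
  exact: cst_continuous.
apply: cvgB; first exact: cvg_cst.
by apply: cvgM; [exact: norm_continuous|exact: cvg_cst].
Qed.

Let tent_out (M x : R) : 0 < M -> M <= `|x| -> tent M x = 0.
Proof.
move=> M0 Mx; rewrite /tent max_l// subr_le0 ler_pdivlMr// mul1r//.
Qed.

Let M_ (n : nat) : R := n.+1%:R.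

Let cvg_cutoff (u : R -> R) : measurable_fun setT u ->
  mu.-integrable setT (fun x => (u x ^+ 2)%:E) ->
  (\int[mu]_x ((u x - clip (M_ n) (u x) * tent (M_ n) x) ^+ 2)%:E)%E @[n --> \oo] --> 0%E.
Proof.
move=> mu_ iu.
have mt n : measurable_fun setT (tent (M_ n)).
  by apply: continuous_measurable_fun; exact: continuous_tent.
have mc n := measurable_clip (M_ n).
have := @dominated_convergence _ _ _ mu setT measurableT
  (fun n x => ((u x - clip (M_ n) (u x) * tent (M_ n) x) ^+ 2)%:E)
  (cst 0%E) (fun x => (u x ^+ 2)%:E).
case.
- move=> n; have mtn := mt n; have mcn := mc n.
  by apply/measurable_EFinP; meas.
- exact: measurable_cst.
- apply: aeW => x _; apply/cvg_EFin; first exact: nearW.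
  have c1 : clip (M_ n) (u x) @[n --> \oo] --> u x.
    apply: cvg_near_cst; near=> n; rewrite clip_id//.
    apply: (@le_trans _ _ n%:R); last by rewrite ler_nat.
    by near: n; exact: nbhs_infty_ger.
  have c2 : tent (M_ n) x @[n --> \oo] --> (1 : R).
    have : 1 - `|x| * (M_ n)^-1 @[n --> \oo] --> 1 - `|x| * 0.
      apply: cvgB; first exact: cvg_cst.
      by apply: cvgM; [exact: cvg_cst|exact: cvg_harmonic].
    rewrite mulr0 subr0; apply: cvg_trans; apply: near_eq_cvg.
    near=> n; rewrite /tent max_r// subr_ge0 ler_pdivrMr// mul1r.
    apply: (@le_trans _ _ n%:R); last by rewrite ler_nat.
    by near: n; exact: nbhs_infty_ger.
  rewrite (_ : 0 = (u x - u x * 1) ^+ 2); last by rewrite mulr1 subrr expr0n.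
  apply: (@cvg_comp _ _ _ (fun n => u x - clip (M_ n) (u x) * tent (M_ n) x) (fun y : R => y ^+ 2));
    last exact: exprn_continuous.
  apply: cvgB; first exact: cvg_cst.
  exact: cvgM.
- exact: iu.
- apply: aeW => x n _; rewrite /= lee_fin ger0_norm ?sqr_ge0//.
  by apply: clip_sqr_le => //; exact: tent01.
move=> _ _; rewrite integral0; exact.
Unshelve. all: by end_near. Qed.

(** Truncation in height and in space brings [u] into L^1 of [-M, M], where continuous
    approximations exist. Clipping the approximation at the same height [M] turns its L^1 error into
    an L^2 error: a difference bounded by 2 M has a square bounded by 2 M times its absolute
    value. *)
Lemma bounded_continuous_dense (u : R -> R) (d : R) : 0 < d -> measurable_fun setT u ->
  mu.-integrable setT (fun x => (u x ^+ 2)%:E) ->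
  exists w M, [/\ continuous w, forall x, `|w x| <= M, mu.-integrable setT (fun x => (w x)%:E)
    & (\int[mu]_x ((u x - w x) ^+ 2)%:E <= d%:E)%E].
Proof.
move=> d0 mu_ iu.
(* Two errors d / 4, from the truncation and from the continuous approximation, add up to d after
   the doubling in (a + b)^2 <= 2 a^2 + 2 b^2. The second one arises below as 2 M times d / (8
   M). *)
have [n] : exists n, (\int[mu]_x ((u x - clip (M_ n) (u x) * tent (M_ n) x) ^+ 2)%:E <= (d / 4)%:E)%E.
  have d4 : 0 < d / 4 by rewrite divr_gt0.
  have [N HN] := cvge0_le (cvg_cutoff mu_ iu) d4.
  by exists N; exact: HN.
set M := M_ n => un; have M0 : 0 < M by exact: ltr0Sn.
have M0' := ltW M0.
pose E := `[- M, M]%classic : set (measurableTypeR R).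
have mE : measurable E by exact: measurable_itv.
have Eoo : (mu E < +oo)%E.
  by rewrite /E lebesgue_measure_itv/=; case: ifP => _; rewrite ltry.
pose v x := clip M (u x).
have mv : measurable_fun setT v by exact: measurableT_comp.
have iv : mu.-integrable E (EFin \o v).
  apply: measurable_bounded_integrable => //; first exact: measurable_funTS.
  by exists M; split; [exact: num_real|move=> x Mx y _ /=; apply: le_trans (clip_le _ M0') (ltW Mx)].
have [g [cg ig gv]] := approximation_continuous_integrable mE Eoo iv.
have [m um] : exists m, (\int[mu]_(x in E) `|(v x - g m x)%:E| <= (d / (8 * M))%:E)%E.
  have d4 : 0 < d / (8 * M) by rewrite divr_gt0// mulr_gt0.
  have [N HN] := cvge0_le gv d4.
  by exists N; exact: HN.
have mt : measurable_fun setT (tent M).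
  by apply: continuous_measurable_fun; exact: continuous_tent.
have mg : measurable_fun setT (g m) by exact: continuous_measurable_fun.
have mcg : measurable_fun setT (fun x => clip M (g m x)).
  exact: (measurableT_comp (measurable_clip M)).
pose w x := clip M (g m x) * tent M x.
have mw : measurable_fun setT w by rewrite /w; meas.
have wM x : `|w x| <= M.
  rewrite normrM -[leRHS]mulr1; apply: ler_pM => //; first exact: clip_le.
  by have /andP[t0 t1] := tent01 x M0; rewrite ger0_norm.
have tE x : x \notin E -> tent M x = 0.
  rewrite notin_setE /E/= in_itv/= -ler_norml => /negP; rewrite -ltNge => /ltW.
  exact: tent_out.
exists w, M; split => //.
- move=> x; apply: (@continuousM _ _ (fun x => clip M (g m x)) (tent M)).
    exact: continuous_clip.
  exact: continuous_tent.
- apply: (@le_Rintegrable _ _ _ mu w (fun x => M * \1_E x)).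
  + by [].
  + move=> x; rewrite indicE; have [xE|xE] := boolP (x \in E); first by rewrite mulr1.
    by rewrite /w tE// mulr0 normr0 mulr0.
  + exact: (integrableZl measurableT M (integrable_indic_itv (- M) M true false)).
pose a x := u x - v x * tent M x.
pose b x := v x * tent M x - w x.
have ma : measurable_fun setT a by rewrite /a; meas.
have mb : measurable_fun setT b by rewrite /b; meas.
apply: (@le_trans _ _ (\int[mu]_x (2%:E * ((a x ^+ 2)%:E + (b x ^+ 2)%:E)))%E).
  apply: ge0_le_integral => //.
  - by move=> x _; rewrite lee_fin sqr_ge0.
  - by apply/measurable_EFinP; meas.
  - apply: emeasurable_funM => //; apply: emeasurable_funD; apply/measurable_EFinP; by meas.
  move=> x _; rewrite -EFinD -EFinM lee_fin (_ : u x - w x = a x + b x); last first.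
    by rewrite /a /b; ring.
  by have := sqr_ge0 (a x - b x); lra.
rewrite ge0_integralZl//; last 2 first.
- by apply: emeasurable_funD; apply/measurable_EFinP; meas.
- by move=> x _; rewrite -EFinD lee_fin addr_ge0// sqr_ge0.
rewrite ge0_integralD//; last 4 first.
- by move=> p _; rewrite lee_fin sqr_ge0.
- by apply/measurable_EFinP; meas.
- by move=> p _; rewrite lee_fin sqr_ge0.
- by apply/measurable_EFinP; meas.
apply: (@le_trans _ _ (2%:E * ((d / 4)%:E + (d / 4)%:E))%E); last first.
  by rewrite -EFinD -EFinM lee_fin; lra.
rewrite lee_pmul2l//; apply: leeD; first exact: un.
have mvg : measurable_fun [set: measurableTypeR R] (fun x : measurableTypeR R => (2 * M)%:E * `|(v x - g m x)%:E|)%E.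
  by apply: emeasurable_funM => //; apply: measurableT_comp => //; apply/measurable_EFinP; meas.
apply: (@le_trans _ _ (\int[mu]_(x in E) ((2 * M)%:E * `|(v x - g m x)%:E|))%E).
  rewrite [leRHS]integral_mkcond; apply: ge0_le_integral => //.
  - by move=> x _; rewrite lee_fin sqr_ge0.
  - by apply/measurable_EFinP; meas.
  - by apply/(measurable_restrictT _ mE); apply: measurable_funS mvg.
  move=> x _; rewrite patchE; case: ifPn => xE; last first.
    by rewrite /b /w tE// !mulr0 subrr expr0n.
  rewrite -EFinM lee_fin /b /w -mulrBl.
  have /andP[t0 t1] := tent01 x M0.
  rewrite exprMn (le_trans (_ : _ <= (v x - clip M (g m x)) ^+ 2 * 1))//.
    by rewrite ler_wpM2l ?sqr_ge0// expr_le1.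
  rewrite mulr1 -(real_normK (num_real _)) expr2; apply: ler_pM => //.
    rewrite (le_trans (ler_normB _ _))// (_ : 2 * M = M + M); last by ring.
    by rewrite lerD// clip_le.
  (* [v x] is fixed by the clipping, so that the Lipschitz bound of [clip] compares it with the
     clipped approximation. *)
  have {1}<- : clip M (v x) = v x by apply: clip_id; exact: clip_le.
  exact: clip_lip.
rewrite ge0_integralZl//; last 2 first.
- by apply: measurable_funTS; apply: measurableT_comp => //; apply/measurable_EFinP; meas.
- by rewrite lee_fin mulr_ge0.
apply: (@le_trans _ _ ((2 * M)%:E * (d / (8 * M))%:E)%E).
  by apply: lee_wpmul2l um; rewrite lee_fin mulr_ge0.
rewrite -EFinM lee_fin (_ : 2 * M * _ = d / 4)//; field; rewrite gt_eqF//.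
Qed.

End density.

(** * Removal of the weight *)

Section real_plancherel.
Variable R : realType.
Local Notation mu := (@lebesgue_measure R).
Variable u : R -> R.
Hypothesis iu : mu.-integrable setT (fun x => (u x)%:E).
Hypothesis iu2 : mu.-integrable setT (fun x => (u x ^+ 2)%:E).

Let mu_ : measurable_fun setT u. Proof. exact: Rintegrable_measurable iu. Qed.

Let e_ (n : nat) : R := n.+1%:R^-1.

Let energy_cvg0 : translation_energy (e_ n) u @[n --> \oo] --> 0%E.
Proof.
apply/fine_cvgP; split.
  by apply: nearW => n; rewrite translation_energyE.
apply/cvgrPdist_le => d d0.
have p0 := @pi_gt0 R.
(* Chosen, with d / 4 below, so that 2 (d / 4) + 16 pi (d / (32 pi)) = d in
   [translation_energy_sub]. *)
have d2 : 0 < d / (32 * pi) by rewrite divr_gt0// mulr_gt0.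
have [w [M [cw wM iw uw]]] := bounded_continuous_dense d2 mu_ iu2.
have d4 : 0 < d / 4 by rewrite divr_gt0.
have [N HN] := cvge0_le (translation_energy_cvg cw wM iw) d4; exists N => // n Nn /=.
rewrite sub0r normrN ger0_norm; last first.
  by apply: fine_ge0; apply: integral_ge0 => p _; rewrite lee_fin mulr_ge0 ?sqr_ge0// divr_ge0// addr_ge0// sqr_ge0.
rewrite -lee_fin fineK; last by rewrite translation_energyE.
have mw := Rintegrable_measurable iw.
apply: le_trans (translation_energy_sub _ mu_ mw) _.
apply: (@le_trans _ _ (2%:E * (d / 4)%:E + (16 * pi)%:E * (d / (32 * pi))%:E)%E).
  apply: leeD.
    by rewrite lee_pmul2l//; exact: HN.
  by apply: lee_wpmul2l uw; rewrite lee_fin mulr_ge0// ltW.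
rewrite -!EFinM -EFinD lee_fin (_ : 2 * (d / 4) + _ = d)//.
have E (c p : R) : p != 0 -> 2 * (c / 4) + 16 * p * (c / (32 * p)) = c by move=> ?; field.
by apply: E; rewrite gt_eqF.
Qed.

Let product_cvg : (translation_product (e_ n) u)%:E @[n --> \oo] --> (2 * pi * \int[mu]_x (u x ^+ 2))%:E.
Proof.
have H := energy_cvg0.
apply/cvg_EFin; first exact: nearW.
rewrite [X in X @ _ --> _](_ : _ = fun n => 2 * pi * \int[mu]_x (u x ^+ 2) -
   2^-1 * fine (translation_energy (e_ n) u)); last first.
  by apply/funext => n /=; rewrite translation_energyE//=; field.
rewrite -[X in _ --> X]subr0 -(mulr0 2^-1).
apply: cvgB; first exact: cvg_cst.
by apply: cvgM; [exact: cvg_cst|exact: (fine_cvg H)].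
Qed.

(** Square integrability of the transform is part of the conclusion, so the limit on the left is
    taken by monotone convergence: exp(- e_n |xi|) increases to 1. On the right, the translation
    products converge because the translation energy vanishes. *)
Lemma real_plancherel :
  (\int[mu]_xi (cos_transform u xi ^+ 2 + sin_transform u xi ^+ 2)%:E =
   (2 * pi)%:E * \int[mu]_x (u x ^+ 2)%:E)%E.
Proof.
have mct := measurable_cos_transform iu; have mst := measurable_sin_transform iu.
pose w n (xi : R) := expR (- (e_ n * `|xi|)).
pose f xi := cos_transform u xi ^+ 2 + sin_transform u xi ^+ 2.
have f0 xi : 0 <= f xi by rewrite addr_ge0// sqr_ge0.
have e0 n : 0 < e_ n by rewrite invr_gt0.
have mw n : measurable_fun setT (w n) by exact: measurable_expNabs.
have mf : measurable_fun setT f by rewrite /f; meas.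
have [M fM] : exists M, forall xi, `|f xi| <= M.
  by exists ((\int[mu]_x `|u x|) ^+ 2 + (\int[mu]_x `|u x|) ^+ 2) => xi;
    rewrite ger0_norm// lerD// -(real_normK (num_real _)) ler_sqr ?nnegrE ?Rintegral_ge0//;
    [exact: cos_transform_le|exact: sin_transform_le].
have E n : (\int[mu]_xi (w n xi * f xi)%:E = (translation_product (e_ n) u)%:E)%E.
  rewrite -EFin_Rintegral; last exact: (@integrable_mul_bounded _ _ _ mu (w n) f M) (integrable_expNabs (e0 n)).
  by rewrite weighted_energy.
have mwf n : measurable_fun setT (fun xi => (w n xi * f xi)%:E).
  by have mwn := mw n; apply/measurable_EFinP; meas.
have w1 : forall n x, setT x -> (0 <= (w n x * f x)%:E)%E.
  by move=> n x _; rewrite lee_fin mulr_ge0// expR_ge0.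
have w2 : forall x, setT x -> {homo (fun n => (w n x * f x)%:E) : n m / (n <= m)%N >-> (n <= m)%E}.
  move=> x _ n m nm; rewrite lee_fin ler_wpM2r// ler_expR lerN2 ler_wpM2r//.
  by rewrite lef_pV2 ?posrE// ler_nat.
have := @cvg_monotone_convergence _ _ _ mu setT measurableT (fun n xi => (w n xi * f xi)%:E) mwf w1 w2.
under eq_fun do rewrite E.
rewrite -(EFin_Rintegral iu2) -EFinM => /(cvg_unique _ product_cvg) ->//.
apply: eq_integral => x _; apply/esym/cvg_lim => //.
apply/cvg_EFin; first exact: nearW.
rewrite -[X in _ --> X]mul1r; apply: cvgM; last exact: cvg_cst.
rewrite -expR0; apply: (@cvg_comp _ _ _ (fun n => - (e_ n * `|x|)) expR); last exact: continuous_expR.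
have : - (e_ n * `|x|) @[n --> \oo] --> - (0 * `|x|).
  by apply: cvgN; apply: cvgM; [exact: cvg_harmonic|exact: cvg_cst].
by rewrite mul0r oppr0.
Qed.

End real_plancherel.

(** * Plancherel theorem for complex functions: line, fibers, plane *)

Section complex_numbers.
Variable R : realType.
Implicit Types (z w : R[i]) (t : R).

Definition csq z : R := complex.Re z ^+ 2 + complex.Im z ^+ 2.

Lemma csq_ge0 z : 0 <= csq z. Proof. by rewrite addr_ge0// sqr_ge0. Qed.

Lemma csqE z : csq z = normc z ^+ 2.
Proof. by case: z => a b; rewrite /csq/= sqr_sqrtr// addr_ge0// sqr_ge0. Qed.

Lemma normc_ge0 z : 0 <= normc z.
Proof. by case: z => a b; exact: sqrtr_ge0. Qed.

Lemma ReM z w : complex.Re (z * w) = complex.Re z * complex.Re w - complex.Im z * complex.Im w.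
Proof. by case: z; case: w. Qed.

Lemma ImM z w : complex.Im (z * w) = complex.Re z * complex.Im w + complex.Im z * complex.Re w.
Proof. by case: z; case: w. Qed.

Lemma normc_expNi t : normc (expNi t) = 1.
Proof. by rewrite /= sqrrN cos2Dsin2 sqrtr1. Qed.

Lemma normr_Re_le z : `|complex.Re z| <= normc z.
Proof.
rewrite -ler_sqr ?nnegrE ?normc_ge0// real_normK ?num_real// -csqE /csq.
by rewrite lerDl sqr_ge0.
Qed.

Lemma normr_Im_le z : `|complex.Im z| <= normc z.
Proof.
rewrite -ler_sqr ?nnegrE ?normc_ge0// real_normK ?num_real// -csqE /csq.
by rewrite lerDr sqr_ge0.
Qed.

Lemma normc_le z : normc z <= `|complex.Re z| + `|complex.Im z|.
Proof.
rewrite -ler_sqr ?nnegrE ?normc_ge0 ?addr_ge0// -csqE /csq sqrrD !real_normK ?num_real//.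
have := mulr_ge0 (normr_ge0 (complex.Re z)) (normr_ge0 (complex.Im z)); rewrite mulr2n; lra.
Qed.

Lemma csqD_le z w : csq (z + w) <= 2 * (csq z + csq w).
Proof.
rewrite /csq; case: z => a b; case: w => c d /=.
by have := sqr_ge0 (a - c); have := sqr_ge0 (b - d); nra.
Qed.

End complex_numbers.

Section complex_integrals.
Context d (T : measurableType d) (R : realType) (mu : {measure set T -> \bar R}).
Implicit Types f g : T -> R[i].

Lemma cintegrableP f : cintegrable mu f <->
  mu.-integrable setT (fun x => (complex.Re (f x))%:E) /\
  mu.-integrable setT (fun x => (complex.Im (f x))%:E).
Proof.
split=> [[[mr mi] fi]|[fr fi]].
  split; apply: (le_Rintegrable _ _ fi) => // x; [exact: normr_Re_le|exact: normr_Im_le].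
have mf : cmeasurable f.
  by split; [exact: Rintegrable_measurable fr|exact: Rintegrable_measurable fi].
split=> //; apply: (@le_Rintegrable _ _ _ mu _ (fun x => `|complex.Re (f x)| + `|complex.Im (f x)|)).
- exact: cmeasurable_normc.
- by move=> x; rewrite ger0_norm ?normc_ge0 ?normc_le.
- exact: (integrableD measurableT (integrable_abse fr) (integrable_abse fi)).
Qed.

Lemma cmeasurableM f g : cmeasurable f -> cmeasurable g -> cmeasurable (fun x => f x * g x).
Proof.
move=> [fr fi] [gr gi]; split.
  have -> : (fun x => complex.Re (f x * g x)) = (fun x => complex.Re (f x) * complex.Re (g x) -
      complex.Im (f x) * complex.Im (g x)) by apply/funext => x; rewrite ReM.
  by meas.
have -> : (fun x => complex.Im (f x * g x)) = (fun x => complex.Re (f x) * complex.Im (g x) +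
    complex.Im (f x) * complex.Re (g x)) by apply/funext => x; rewrite ImM.
by meas.
Qed.

Lemma cmeasurable_csq f : cmeasurable f -> measurable_fun setT (fun x => csq (f x)).
Proof. by move=> [fr fi]; rewrite /csq; meas. Qed.

Lemma cintegrable_mul_bounded f g : cmeasurable g -> (forall x, normc (g x) = 1) ->
  cintegrable mu f -> cintegrable mu (fun x => f x * g x).
Proof.
move=> mg g1 [mf fi]; have mfg := cmeasurableM mf mg; split=> //.
apply: (le_Rintegrable _ _ fi); first exact: cmeasurable_normc.
by move=> x; rewrite ger0_norm ?normc_ge0// normcM g1 mulr1.
Qed.

Lemma cintegralZ (a : R[i]) f : cintegrable mu f ->
  cintegral mu (fun x => a * f x) = a * cintegral mu f.
Proof.
move=> /cintegrableP[fr fi]; rewrite /cintegral; case: a => a b.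
apply/eqP; rewrite eq_complex; apply/andP; split; apply/eqP => /=.
  under eq_Rintegral do rewrite ReM/=.
  rewrite RintegralB//; last 2 first.
  - exact: (integrableZl measurableT a fr).
  - exact: (integrableZl measurableT b fi).
  by rewrite !RintegralZl.
under eq_Rintegral do rewrite ImM/=.
rewrite RintegralD//; last 2 first.
- exact: (integrableZl measurableT a fi).
- exact: (integrableZl measurableT b fr).
by rewrite !RintegralZl.
Qed.

Lemma cintegralD f g : cintegrable mu f -> cintegrable mu g ->
  cintegral mu (fun x => f x + g x) = cintegral mu f + cintegral mu g.
Proof.
move=> /cintegrableP[fr fi] /cintegrableP[gr gi]; rewrite /cintegral.
apply/eqP; rewrite eq_complex; apply/andP; split; apply/eqP => /=.
  rewrite -RintegralD//; apply: eq_Rintegral => x _.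
  by case: (f x); case: (g x).
rewrite -RintegralD//; apply: eq_Rintegral => x _.
by case: (f x); case: (g x).
Qed.

Lemma cintegrableZ (a : R[i]) f : cintegrable mu f -> cintegrable mu (a *: f).
Proof.
move=> [mf fi]; split; first exact: cmeasurableZ.
rewrite (_ : _ \o _ = fun x => (normc a * normc (f x))%:E).
  exact: (integrableZl measurableT (normc a) fi).
by apply/funext => x /=; rewrite -normcM.
Qed.

Lemma cintegrableD f g : cintegrable mu f -> cintegrable mu g -> cintegrable mu (f + g).
Proof.
move=> [mf fi] [mg gi]; have mfg := cmeasurableD mf mg; split=> //.
apply: (@le_Rintegrable _ _ _ mu _ (fun x => normc (f x) + normc (g x))).
- exact: cmeasurable_normc.
- by move=> x; rewrite ger0_norm ?normc_ge0// le_normcD.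
- exact: (integrableD measurableT fi gi).
Qed.

(** The squared L^2 norm with extended values, which makes sense before square integrability is
    known. *)
Definition energy f : \bar R := (\int[mu]_x (csq (f x))%:E)%E.

Lemma energy_ge0 f : (0 <= energy f)%E.
Proof. by apply: integral_ge0 => x _; rewrite lee_fin csq_ge0. Qed.

Lemma ae_eq_energy f g : cmeasurable f -> cmeasurable g -> f = g %[ae mu] ->
  energy f = energy g.
Proof.
move=> mf mg fg; apply: ae_eq_integral => //.
- exact/measurable_EFinP/cmeasurable_csq.
- exact/measurable_EFinP/cmeasurable_csq.
by apply: filterS fg => x /(_ I) + _; rewrite /= => ->.
Qed.

End complex_integrals.

Lemma cmeasurable_expNi d (T : measurableType d) (R : realType) (f : T -> R) :
  measurable_fun setT f -> cmeasurable (fun x => expNi (f x)).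
Proof. by move=> mf; split; rewrite /=; meas. Qed.

Lemma cmeasurable_comp d d' (T : measurableType d) (U : measurableType d') (R : realType)
  (f : U -> R[i]) (g : T -> U) : cmeasurable f -> measurable_fun setT g ->
  cmeasurable (fun x => f (g x)).
Proof.
by move=> [fr fi] mg; split; [apply: (measurableT_comp fr mg)|apply: (measurableT_comp fi mg)].
Qed.

(** * Complex functions on the line *)

Section fourier1.
Variable R : realType.
Local Notation mu := (@lebesgue_measure R).
Local Notation T := (measurableTypeR R).

Definition fourier1 (f : T -> R[i]) (xi : T) : R[i] :=
  cintegral mu (fun x => f x * expNi (x * xi)).

Lemma cintegrable_fourier1 (f : T -> R[i]) (xi : R) : cintegrable mu f ->
  cintegrable mu (fun x => f x * expNi (x * xi)).
Proof.
move=> fi; apply: cintegrable_mul_bounded => //.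
  by apply: cmeasurable_expNi; meas.
by move=> x; exact: normc_expNi.
Qed.

Lemma fourier1E (f : T -> R[i]) (xi : R) : cintegrable mu f ->
  let u x := complex.Re (f x) in let v x := complex.Im (f x) in
  fourier1 f xi = (cos_transform u xi + sin_transform v xi) +i*
                  (cos_transform v xi - sin_transform u xi).
Proof.
move=> /cintegrableP[ir ii] u v; rewrite /fourier1 /cintegral.
apply/eqP; rewrite eq_complex; apply/andP; split; apply/eqP => /=.
  rewrite /cos_transform /sin_transform -RintegralD//; last 2 first.
  - exact: integrable_mul_cos.
  - exact: integrable_mul_sin.
  by apply: eq_Rintegral => x _; rewrite ReM/= mulrN opprK.
rewrite /cos_transform /sin_transform -RintegralB//; last 2 first.
- exact: integrable_mul_cos.
- exact: integrable_mul_sin.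
by apply: eq_Rintegral => x _; rewrite ImM/= mulrN addrC.
Qed.

Lemma cos_transformN (u : R -> R) xi : cos_transform u (- xi) = cos_transform u xi.
Proof. by apply: eq_Rintegral => x _; rewrite mulrN cosN. Qed.

Lemma sin_transformN (u : R -> R) xi : mu.-integrable setT (fun x => (u x)%:E) ->
  sin_transform u (- xi) = - sin_transform u xi.
Proof.
move=> iu; rewrite -[RHS]mulN1r /sin_transform -RintegralZl//; last exact: integrable_mul_sin.
by apply: eq_Rintegral => x _; rewrite mulrN sinN mulN1r mulrN.
Qed.

Lemma cmeasurable_fourier1 (f : T -> R[i]) : cmeasurable f -> cmeasurable (fourier1 f).
Proof.
move=> mf.
have [hr hi] : cmeasurable (fun p : T * T => f p.2 * expNi (p.2 * p.1)).
  apply: cmeasurableM; first exact: cmeasurable_comp.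
  by apply: cmeasurable_expNi; meas.
split; rewrite /fourier1 /cintegral/=.
  exact: (@measurable_Rintegral_param _ _ _ _ _ mu (fun xi x => complex.Re (f x * expNi (x * xi)))).
exact: (@measurable_Rintegral_param _ _ _ _ _ mu (fun xi x => complex.Im (f x * expNi (x * xi)))).
Qed.

(* The cross terms of |F f|^2 are odd in xi, hence the symmetrisation. *)
Lemma fourier1_plancherel (f : T -> R[i]) : cintegrable mu f -> (energy mu f < +oo)%E ->
  (energy mu (fourier1 f) = (2 * pi)%:E * energy mu f)%E.
Proof.
move=> fi fe; have /cintegrableP[ir ii] := fi; have [[mr mi] _] := fi.
pose u x := complex.Re (f x); pose v x := complex.Im (f x).
have mcsq := cmeasurable_csq (cmeasurable_fourier1 (conj mr mi)).
have le2 (h : T -> R) : measurable_fun setT h -> (forall x, h x ^+ 2 <= csq (f x)) ->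
    mu.-integrable setT (fun x => (h x ^+ 2)%:E).
  move=> mh hf; apply: ge0_Rintegrable; [by meas|by move=> x; exact: sqr_ge0|].
  apply: le_lt_trans fe; apply: ge0_le_integral => //.
  - by move=> x _; rewrite lee_fin sqr_ge0.
  - by apply/measurable_EFinP; meas.
  - exact/measurable_EFinP/cmeasurable_csq.
  - by move=> x _; rewrite lee_fin hf.
have iu2 : mu.-integrable setT (fun x => (u x ^+ 2)%:E).
  by apply: le2 => // x; rewrite lerDl sqr_ge0.
have iv2 : mu.-integrable setT (fun x => (v x ^+ 2)%:E).
  by apply: le2 => // x; rewrite lerDr sqr_ge0.
have mcu := measurable_cos_transform ir; have msu := measurable_sin_transform ir.
have mcv := measurable_cos_transform ii; have msv := measurable_sin_transform ii.
(* The energy of the transform is not known to be finite here, so 2 is cancelled by multiplication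
   with its inverse. *)
have half (x y : \bar R) : (x + x = y + y -> x = y)%E.
  move=> xy; rewrite -[x]mul1e -[y]mul1e.
  rewrite (_ : 1%E = (2^-1)%:E * 2%:E)%E; last by rewrite -EFinM mulVf.
  by rewrite -!muleA !mule_natl !mule2n xy.
apply: half.
have {1}<- : (\int[mu]_xi (csq (fourier1 f (- xi)))%:E = energy mu (fourier1 f))%E.
  rewrite (@ge0_integral_oppr _ (fun xi => (csq (fourier1 f xi))%:E))//; first exact/measurable_EFinP.
  by move=> x; rewrite lee_fin csq_ge0.
rewrite /energy -ge0_integralD//; last 4 first.
- by move=> x _; rewrite lee_fin csq_ge0.
- apply/measurable_EFinP; apply: (measurableT_comp mcsq).
  exact: oppr_measurable.
- by move=> x _; rewrite lee_fin csq_ge0.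
- exact/measurable_EFinP.
transitivity (\int[mu]_xi (2%:E * ((cos_transform u xi ^+ 2 + sin_transform u xi ^+ 2)%:E +
  (cos_transform v xi ^+ 2 + sin_transform v xi ^+ 2)%:E)))%E.
  apply: eq_integral => xi _; rewrite !(fourier1E _ fi)/= -/u -/v.
  rewrite !cos_transformN !sin_transformN// -!EFinD -EFinM /csq/=; congr EFin; ring.
rewrite ge0_integralZl//; last 2 first.
- by apply: emeasurable_funD; apply/measurable_EFinP; meas.
- by move=> x _; rewrite -EFinD lee_fin !addr_ge0// sqr_ge0.
rewrite ge0_integralD//; last 4 first.
- by move=> x _; rewrite lee_fin addr_ge0// sqr_ge0.
- by apply/measurable_EFinP; meas.
- by move=> x _; rewrite lee_fin addr_ge0// sqr_ge0.
- by apply/measurable_EFinP; meas.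
rewrite !real_plancherel// mule_natl mule2n -ge0_muleDr; last 2 first.
- by apply: integral_ge0 => x _; rewrite lee_fin sqr_ge0.
- by apply: integral_ge0 => x _; rewrite lee_fin sqr_ge0.
rewrite -ge0_integralD//; last 4 first.
- by move=> x _; rewrite lee_fin sqr_ge0.
- by apply/measurable_EFinP; meas.
- by move=> x _; rewrite lee_fin sqr_ge0.
- by apply/measurable_EFinP; meas.
Qed.

End fourier1.

Lemma expNiD (R : realType) (a b : R) : expNi (a + b) = expNi a * expNi b.
Proof.
apply/eqP; rewrite eq_complex /= cosD sinD; apply/andP; split; apply/eqP; ring.
Qed.

Lemma ae_eq_Rintegral d (T : measurableType d) (R : realType) (mu : {measure set T -> \bar R})
  (f g : T -> R) : measurable_fun setT f -> measurable_fun setT g ->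
  {ae mu, forall x, f x = g x} -> \int[mu]_x f x = \int[mu]_x g x.
Proof.
move=> mf mg fg; congr fine; apply: ae_eq_integral => //.
- exact/measurable_EFinP.
- exact/measurable_EFinP.
- by apply: filterS fg => x -> _.
Qed.

(** * Transform in the first variable of a product *)

Section fiberwise.
Context d2 (Y : measurableType d2) (R : realType).
Local Notation mu := (@lebesgue_measure R).
Local Notation T := (measurableTypeR R).
Variable nu : {sigma_finite_measure set Y -> \bar R}.
Implicit Types g : T * Y -> R[i].

(** The second factor is arbitrary: the circle gives the radial transform, the line gives the first
    half of the transform of the plane. *)
Definition fiber_fourier g (p : T * Y) : R[i] := fourier1 (fun s => g (s, p.2)) p.1.

Lemma cmeasurable_fiber_fourier g : cmeasurable g -> cmeasurable (fiber_fourier g).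
Proof.
move=> mg.
have [hr hi] : cmeasurable (fun q : (T * Y) * T => g (q.2, q.1.2) * expNi (q.2 * q.1.1)).
  apply: cmeasurableM; last by apply: cmeasurable_expNi; meas.
  apply: cmeasurable_comp => //; apply: measurable_fun_pair => //.
  exact: (measurableT_comp measurable_snd measurable_fst).
split; rewrite /fiber_fourier /fourier1 /cintegral/=.
  exact: (@measurable_Rintegral_param _ _ _ _ _ mu
    (fun p s => complex.Re (g (s, p.2) * expNi (s * p.1)))).
exact: (@measurable_Rintegral_param _ _ _ _ _ mu
  (fun p s => complex.Im (g (s, p.2) * expNi (s * p.1)))).
Qed.

Lemma ae_cintegrable2 g : cintegrable (mu \x nu)%E g ->
  {ae nu, forall y, cintegrable mu (fun s => g (s, y))}.
Proof.
move=> [mg ig]; have := ae_integrable2 (m1 := mu) (m2 := nu) ig.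
apply: filterS => y iy; split=> //.
by apply: cmeasurable_comp mg _; exact: measurable_pair2.
Qed.

Lemma ae_energy2_lty g : cmeasurable g -> (energy (mu \x nu)%E g < +oo)%E ->
  {ae nu, forall y, energy mu (fun s => g (s, y)) < +oo}%E.
Proof.
move=> mg eg; have mc := cmeasurable_csq mg.
have ig : (mu \x nu)%E.-integrable setT (fun p => (csq (g p))%:E).
  by apply: ge0_Rintegrable => // x; exact: csq_ge0.
have := ae_integrable2 (m1 := mu) (m2 := nu) ig.
apply: filterS => y /integrableP[_].
by under eq_integral do rewrite gee0_abs ?lee_fin ?csq_ge0//.
Qed.

Lemma energy2E g : cmeasurable g ->
  (energy (mu \x nu)%E g = \int[nu]_y energy mu (fun s => g (s, y)))%E.
Proof.
move=> mg; rewrite /energy fubini_tonelli2//.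
- exact/measurable_EFinP/cmeasurable_csq.
- by move=> p; rewrite lee_fin csq_ge0.
Qed.

Lemma measurable_energy2 g : cmeasurable g ->
  measurable_fun setT (fun y => energy mu (fun s => g (s, y))).
Proof.
move=> mg; apply: (measurable_fun_fubini_tonelli_G (m1 := mu) (fun p => (csq (g p))%:E)).
- exact/measurable_EFinP/cmeasurable_csq.
- by move=> p; rewrite lee_fin csq_ge0.
Qed.

Lemma fiber_plancherel g : cintegrable (mu \x nu)%E g -> (energy (mu \x nu)%E g < +oo)%E ->
  (energy (mu \x nu)%E (fiber_fourier g) = (2 * pi)%:E * energy (mu \x nu)%E g)%E.
Proof.
move=> ig eg; have mg := ig.1.
have mF := cmeasurable_fiber_fourier mg.
rewrite !energy2E// -ge0_integralZl//; last 3 first.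
- exact: measurable_energy2.
- by move=> y _; exact: energy_ge0.
- by rewrite lee_fin mulr_ge0// pi_ge0.
apply: ae_eq_integral => //.
- exact: measurable_energy2.
- apply: emeasurable_funM => //; exact: measurable_energy2.
apply: filterS2 (ae_cintegrable2 ig) (ae_energy2_lty mg eg) => y iy ey _.
by rewrite -fourier1_plancherel.
Qed.

Lemma cintegrable_Rintegral1 (h : T -> Y -> R) :
  (mu \x nu)%E.-integrable setT (fun p => (h p.1 p.2)%:E) ->
  nu.-integrable setT (fun y => (\int[mu]_x h x y)%:E).
Proof.
move=> ih; have mh : measurable_fun setT (fun p : T * Y => h p.1 p.2).
  exact: Rintegrable_measurable ih.
have mG : measurable_fun setT (fun y => \int[mu]_x h x y).
  apply: (measurable_Rintegral_param mu (h := fun y x => h x y)).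
  exact: (measurable_swapF (h := fun p : T * Y => h p.1 p.2)).
apply/integrableP; split; first exact/measurable_EFinP.
apply: le_lt_trans ((integrable21ltyP mu nu (measurable_int _ ih)).1 ih).
have mhE : measurable_fun setT (fun p : T * Y => (h p.1 p.2)%:E) by exact/measurable_EFinP.
apply: ge0_le_integral => //.
- by apply: measurableT_comp => //; exact/measurable_EFinP.
- apply: (measurable_fun_fubini_tonelli_G (m1 := mu) (fun p => `|(h p.1 p.2)%:E|))%E => //.
  exact: measurableT_comp.
move=> y _; rewrite /Rintegral.
apply: (@le_trans _ _ `|\int[mu]_x (h x y)%:E|%E).
  by case: (\int[mu]_x _)%E => //= *; rewrite ?lexx ?normr0 ?leey.
apply: le_abse_integral => //; apply/measurable_EFinP.
exact: (measurableT_comp mh (measurable_pair2 y)).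
Qed.

End fiberwise.

(** * The transform of the plane as an iterated transform *)

Section fourier2.
Variable R : realType.
Local Notation mu := (@lebesgue_measure R).
Local Notation T := (measurableTypeR R).
Variable f : T * T -> R[i].
Hypothesis fi : cintegrable (mu \x mu)%E f.

Let G := fiber_fourier f.

Let mG : cmeasurable G. Proof. exact: cmeasurable_fiber_fourier fi.1. Qed.

Let ife xi : cintegrable (mu \x mu)%E (fun p : T * T => f p * expNi (p.1 * xi)).
Proof.
apply: cintegrable_mul_bounded => //; last by move=> p; exact: normc_expNi.
by apply: cmeasurable_expNi; meas.
Qed.

(** Valid at every [xi]: multiplication by a character preserves integrability on the plane, and the
    partial integrals of an integrable function are integrable. *)
Let iG xi : cintegrable mu (fun y => G (xi, y)).
Proof.
have /cintegrableP[hr hi] := ife xi.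
apply/cintegrableP; split.
  apply: (cintegrable_Rintegral1 (h := fun x y => complex.Re (f (x, y) * expNi (x * xi)))).
  by move: hr; apply: eq_integrable => // -[].
apply: (cintegrable_Rintegral1 (h := fun x y => complex.Im (f (x, y) * expNi (x * xi)))).
by move: hi; apply: eq_integrable => // -[].
Qed.

(** The character factorizes, and Fubini's theorem applies at each [xi]. Only the identity of the
    inner integrals is restricted to almost every y, namely to integrable fibers. *)
Lemma fourier2E (xi : T * T) :
  cintegral (mu \x mu)%E (fun p : T * T => f p * expNi (p.1 * xi.1 + p.2 * xi.2)) =
  fourier1 (fun y => G (xi.1, y)) xi.2.
Proof.
have iH : cintegrable (mu \x mu)%E (fun p : T * T => f p * expNi (p.1 * xi.1 + p.2 * xi.2)).
  apply: cintegrable_mul_bounded => //; last by move=> p; exact: normc_expNi.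
  by apply: cmeasurable_expNi; meas.
have /cintegrableP[hr hi] := iH; have [[mr mi] _] := iH.
have [gr gi] : cmeasurable (fun y => G (xi.1, y) * expNi (y * xi.2)).
  apply: cmeasurableM; last by apply: cmeasurable_expNi; meas.
  by apply: cmeasurable_comp mG _; exact: measurable_pair1.
have inner : {ae mu, forall y, cintegral mu (fun x => f (x, y) * expNi (x * xi.1 + y * xi.2)) =
    G (xi.1, y) * expNi (y * xi.2)}.
  apply: filterS (ae_cintegrable2 fi) => y iy.
  rewrite [RHS]mulrC /G /fiber_fourier /fourier1 -cintegralZ; last exact: cintegrable_fourier1.
  by congr cintegral; apply/funext => x /=; rewrite expNiD; ring.
rewrite /fourier1 /cintegral; congr (_ +i* _).
  transitivity (\int[(mu \x mu)%E]_p complex.Re (f (p.1, p.2) * expNi (p.1 * xi.1 + p.2 * xi.2))).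
    by apply: eq_Rintegral => -[].
  rewrite -(Rintegral21 (m1 := mu) (m2 := mu)
    (h := fun x y => complex.Re (f (x, y) * expNi (x * xi.1 + y * xi.2)))); last first.
    by move: hr; apply: eq_integrable => // -[].
  apply: ae_eq_Rintegral => //.
    apply: (measurable_Rintegral_param mu
      (h := fun y x => complex.Re (f (x, y) * expNi (x * xi.1 + y * xi.2)))).
    exact: (measurable_swapF mr).
  by apply: filterS inner => y <-.
transitivity (\int[(mu \x mu)%E]_p complex.Im (f (p.1, p.2) * expNi (p.1 * xi.1 + p.2 * xi.2))).
  by apply: eq_Rintegral => -[].
rewrite -(Rintegral21 (m1 := mu) (m2 := mu)
  (h := fun x y => complex.Im (f (x, y) * expNi (x * xi.1 + y * xi.2)))); last first.
  by move: hi; apply: eq_integrable => // -[].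
apply: ae_eq_Rintegral => //.
  apply: (measurable_Rintegral_param mu
    (h := fun y x => complex.Im (f (x, y) * expNi (x * xi.1 + y * xi.2)))).
  exact: (measurable_swapF mi).
by apply: filterS inner => y <-.
Qed.

Let F (xi : T * T) := fourier1 (fun y => G (xi.1, y)) xi.2.

Lemma cmeasurable_fourier2 :
  cmeasurable (fun xi : T * T => fourier1 (fun y => fiber_fourier f (xi.1, y)) xi.2).
Proof.
have mGs : cmeasurable (fun p : T * T => G (p.2, p.1)).
  apply: cmeasurable_comp mG _; exact: measurable_fun_pair.
have := cmeasurable_fiber_fourier mGs.
move=> /(@cmeasurable_comp _ _ _ _ _ _ (fun p : T * T => (p.2, p.1))); apply.
exact: measurable_fun_pair.
Qed.

(** The partial transform [G] need not be integrable on the plane, so the fiberwise theorem cannot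
    simply be used a second time. The theorem on the line is applied instead to y -> G(x, y), which
    is integrable for every x by [iG] and of finite energy for almost every x. *)
Lemma fourier2_plancherel : (energy (mu \x mu)%E f < +oo)%E ->
  (energy (mu \x mu)%E F = ((2 * pi) ^+ 2)%:E * energy (mu \x mu)%E f)%E.
Proof.
move=> fe; have mF := cmeasurable_fourier2.
have eG := fiber_plancherel fi fe.
have eGy : (energy (mu \x mu)%E G < +oo)%E.
  by rewrite /G eG lte_mul_pinfty// ?energy_ge0// lee_fin mulr_ge0// pi_ge0.
rewrite expr2 EFinM -muleA -eG -/G.
rewrite {1 2}/energy !fubini_tonelli1//; last 4 first.
- exact/measurable_EFinP/cmeasurable_csq.
- by move=> p; rewrite lee_fin csq_ge0.
- exact/measurable_EFinP/cmeasurable_csq.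
- by move=> p; rewrite lee_fin csq_ge0.
have mEF : forall H : T * T -> R[i], cmeasurable H ->
    measurable_fun setT (fubini_F mu (fun p => (csq (H p))%:E)).
  move=> H mH; apply: measurable_fun_fubini_tonelli_F.
  - exact/measurable_EFinP/cmeasurable_csq.
  - by move=> p; rewrite lee_fin csq_ge0.
rewrite -ge0_integralZl//; last 3 first.
- exact: mEF.
- by move=> x _; apply: energy_ge0.
- by rewrite lee_fin mulr_ge0// pi_ge0.
apply: ae_eq_integral => //.
- exact: mEF.
- apply: emeasurable_funM => //; exact: mEF.
have mcG := cmeasurable_csq mG.
have igG : (mu \x mu)%E.-integrable setT (fun p => (csq (G p))%:E).
  by apply: ge0_Rintegrable => // x; exact: csq_ge0.
have := ae_integrable1 (m1 := mu) (m2 := mu) igG.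
apply: filterS => x /integrableP[_ ex] _.
rewrite /fubini_F/= -[RHS]/((2 * pi)%:E * energy mu (fun y => G (x, y)))%E.
rewrite -fourier1_plancherel//.
by move: ex; under eq_integral do rewrite gee0_abs ?lee_fin ?csq_ge0//.
Qed.

End fourier2.

(** * Polar coordinates *)

Section measure_restriction.
Context d (T : measurableType d) (R : realType) (mu : {measure set T -> \bar R}).
Local Open Scope ereal_scope.

Lemma ge0_integral_mrestr (D : set T) (mD : measurable D) (f : T -> \bar R) :
  measurable_fun setT f -> (forall x, 0 <= f x) ->
  \int[mrestr mu mD]_x f x = \int[mu]_(x in D) f x.
Proof.
move=> mf f0; rewrite -(setUv D) ge0_integral_setU//; last 3 first.
- exact: measurableC.
- by rewrite setUv.
- exact/disj_setPCl.
rewrite [X in _ + X](@eq_measure_integral _ _ _ _ mzero); last first.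
  move=> A mA AD; rewrite /mzero /=; transitivity (mu (A `&` D)); first by [].
  rewrite (_ : A `&` D = set0) ?measure0//.
  by apply/seteqP; split => // x [/AD].
rewrite [X in _ + X]integral_measure_zero.
rewrite adde0; apply: eq_measure_integral => A mA AD.
by rewrite /mrestr /=; congr (mu _); apply/setIidPl.
Qed.

End measure_restriction.

Section subgraph.
Context d (T : measurableType d) (R : realType).
Variable mu : {sigma_finite_measure set T -> \bar R}.
Variable w : T -> R.
Hypotheses (mw : measurable_fun setT w) (w0 : forall x, 0 <= w x).
Local Notation leb := (@lebesgue_measure R).

Definition subgraph : set (T * measurableTypeR R) := [set p | 0 <= p.2 < w p.1].

Lemma measurable_subgraph : measurable subgraph.
Proof.
rewrite (_ : subgraph = ((fun p : T * measurableTypeR R => p.2) @^-1` `[0%R, +oo[%classic) `&`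
  ((fun p : T * measurableTypeR R => w p.1 - p.2) @^-1` `]0%R, +oo[%classic)); last first.
  apply/seteqP; split=> p; rewrite /subgraph/= !in_itv/= !andbT subr_gt0.
    by move=> /andP.
  by move=> [-> ->].
have m1 : measurable_fun setT (fun p : T * measurableTypeR R => w p.1 - p.2) by meas.
apply: measurableI; rewrite -[X in measurable X]setTI.
  by apply: measurable_snd => //; exact: measurable_itv.
by apply: m1 => //; exact: measurable_itv.
Qed.

(* Turns a density into the restriction of a product measure, whose
   push-forwards can be integrated against. *)
Lemma integral_subgraph (f : T -> \bar R) : measurable_fun setT f -> (forall x, (0 <= f x)%E) ->
  (\int[mu \x leb]_(p in subgraph) f p.1 = \int[mu]_x (f x * (w x)%:E))%E.
Proof.
move=> mf f0; rewrite integral_mkcond fubini_tonelli1; last 2 first.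
- apply/(measurable_restrictT _ measurable_subgraph); apply: measurable_funTS.
  exact: (measurableT_comp mf measurable_fst).
- by move=> p; rewrite patchE; case: ifP.
apply: eq_integral => x _; rewrite /fubini_F/=.
transitivity (\int[leb]_(s in `[0%R, w x[) f x)%E.
  rewrite [RHS]integral_mkcond; apply: eq_integral => s _; rewrite !patchE.
  by congr (if _ then _ else _); apply/idP/idP; rewrite !inE /subgraph/= in_itv.
rewrite integral_cst//= lebesgue_measure_itv/= lte_fin.
by case: ltP => wx; rewrite ?sube0//; congr (_ * _%:E)%E; apply/eqP; rewrite eq_le w0 wx.
Qed.

End subgraph.

(** * The substitution by the tangent *)

Section tangent_substitution.
Variable R : realType.
Local Notation mu := (@lebesgue_measure R).
Local Notation T := (measurableTypeR R).
Local Notation I := (`](- (pi / 2)), (pi / 2)[%classic : set R).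

(** Both functions are extended by 0 outside the interval, where the vanishing density [w] makes the
    value of [tanI] irrelevant. *)
Let tanI : T -> T := @tan R \_ I.
Let w : T -> R := (fun x : R => (cos x) ^- 2) \_ I.

Let mI : measurable (I : set T). Proof. exact: measurable_itv. Qed.

Let cosI (x : R) : I x -> 0 < cos x.
Proof. by rewrite /= in_itv/= => xI; rewrite cos_gt0_pihalf. Qed.

Let mtanI : measurable_fun setT tanI.
Proof.
apply/(measurable_restrictT _ mI); apply: open_continuous_measurable_fun.
  exact: interval_open.
by move=> x; rewrite inE => xI; apply: continuous_tan; rewrite gt_eqF// cosI.
Qed.

Let cont_cosX2 (x : R) : cos x != 0 -> {for x, continuous (fun x : R => (cos x) ^- 2)}.
Proof.
move=> cx; apply: (@continuousV _ _ (fun x : R => cos x ^+ 2)); first by rewrite expf_neq0.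
apply: (@continuous_comp _ _ _ (@cos R) (fun x => x ^+ 2)); first exact: continuous_cos.
exact: exprn_continuous.
Qed.

Let mw : measurable_fun setT w.
Proof.
apply/(measurable_restrictT _ mI); apply: open_continuous_measurable_fun.
  exact: interval_open.
by move=> x; rewrite inE => xI; apply: cont_cosX2; rewrite gt_eqF// cosI.
Qed.

Let w0 x : 0 <= w x.
Proof. by rewrite /w patchE; case: ifP => // _; rewrite invr_ge0 sqr_ge0. Qed.

Let atanI (a : R) : I (atan a).
Proof. by rewrite /= in_itv/= atan_gtNpi2 atan_ltpi2. Qed.

(** The density is the derivative of the tangent, integrated over the preimage ]atan a, atan b] by
    the fundamental theorem of calculus. *)
Let integral_w (a b : R) : a < b ->
  (\int[mu]_x ((\1_(`]a, b]%classic : set R) (tanI x))%:E * (w x)%:E) = (b - a)%:E)%E.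
Proof.
move=> ab; have ab' : atan a < atan b by exact: lt_atan.
transitivity (\int[mu]_(x in `]atan a, atan b]) ((cos x) ^- 2)%:E)%E.
  rewrite [RHS]integral_mkcond; apply: eq_integral => x _.
  rewrite /w /tanI !patchE; case: ifPn => xI; last first.
    rewrite mule0 ifN//; apply: contra xI; rewrite !inE/= !in_itv/= => /andP[x1 x2].
    by rewrite (lt_trans (atan_gtNpi2 a) x1) (le_lt_trans x2 (atan_ltpi2 b)).
  have xI' : x \in `](- (pi / 2)), (pi / 2)[ by move: xI; rewrite inE.
  have aI (c : R) : atan c \in `](- (pi / 2)), (pi / 2)[ by exact: atanI.
  have E : (tan x \in `]a, b]%classic) = (x \in `]atan a, atan b]%classic).
    have e1 : (a < tan x) = (atan a < x) by rewrite -{1}(atanK a) ltr_tan.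
    have e2 : (tan x <= b) = (x <= atan b) by rewrite -{1}(atanK b) !leNgt ltr_tan.
    by apply/idP/idP; rewrite !inE/= !in_itv/= e1 e2.
  by rewrite indicE E; case: ifP; rewrite ?mul1e ?mul0e.
rewrite integral_itv_obnd_cbnd; last first.
  apply/measurable_EFinP; apply: (measurable_funS mI).
    move=> x /=; rewrite !in_itv/= => /andP[x1 x2].
    by rewrite (lt_trans (atan_gtNpi2 a) x1) (le_lt_trans x2 (atan_ltpi2 b)).
  apply: open_continuous_measurable_fun; first exact: interval_open.
  by move=> x; rewrite inE => xI; apply: cont_cosX2; rewrite gt_eqF// cosI.
have cosn (x : R) : atan a <= x <= atan b -> cos x != 0.
  move=> /andP[x1 x2]; rewrite gt_eqF// cosI//= in_itv/=.
  by rewrite (lt_le_trans (atan_gtNpi2 a) x1) (le_lt_trans x2 (atan_ltpi2 b)).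
rewrite (@continuous_FTC2 _ _ (@tan R))//.
- by rewrite !atanK EFinB.
- apply/continuous_in_subspaceT => x; rewrite inE/= in_itv/= => xab.
  exact/cont_cosX2/cosn.
- split.
  + by move=> x; rewrite in_itv/= => /andP[x1 x2]; apply: derivable_tan; apply: cosn; rewrite !ltW.
  + by apply/cvg_at_right_filter; apply: continuous_tan; apply: cosn; rewrite lexx ltW.
  + by apply/cvg_at_left_filter; apply: continuous_tan; apply: cosn; rewrite lexx ltW.
- move=> x; rewrite in_itv/= => /andP[x1 x2].
  have cx : cos x != 0 by apply: cosn; rewrite !ltW.
  by rewrite derive1E; case: (is_derive_tan cx).
Qed.

(** The area below the graph of [w] is pushed forward by the tangent of the first coordinate. By
    [integral_w] the image measure gives intervals their length, hence it is Lebesgue measure. *)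
Lemma integral_tan (g : R -> \bar R) : measurable_fun setT g -> (forall x, 0 <= g x)%E ->
  (\int[mu]_t g t = \int[mu]_(x in I) (g (tan x) * ((cos x) ^- 2)%:E))%E.
Proof.
move=> mg g0; have mS := measurable_subgraph mw.
have mtf : measurable_fun setT (fun p : T * T => tanI p.1).
  exact: (measurableT_comp mtanI measurable_fst).
unshelve epose (pf := (pushforward (mrestr (mu \x mu)%E mS) (fun p : T * T => tanI p.1) :
  {measure set T -> \bar R})); first exact: mtf.
transitivity (\int[pf]_t g t)%E.
  apply: eq_measure_integral => A mA _.
  apply: (@lebesgue_measure_unique R pf) => // _ [[a b]] _ <-.
  rewrite /pf/= /pushforward /mrestr/= lebesgue_measure_itv/= lte_fin.
  have mB : measurable_fun setT (\1_(`]a, b]%classic) : T -> R) by exact: measurable_indic.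
  have mB' : measurable_fun setT (fun x : T => (\1_(`]a, b]%classic : set R) (tanI x) : R)%:E).
    by apply/measurable_EFinP; exact: (measurableT_comp mB mtanI).
  have mBp : measurable ((fun p : T * T => tanI p.1) @^-1` `]a, b]).
    by rewrite -[X in measurable X]setTI; exact: (mtf measurableT _ (measurable_itv _)).
  transitivity (\int[mu \x mu]_(p in subgraph w) ((\1_(`]a, b]%classic : set R) (tanI p.1))%:E))%E.
    rewrite (integral_subgraph mu mw w0 mB')//.
    case: (ltP a b) => ab; first by rewrite integral_w// EFinB.
    apply/esym; apply: integral0_eq => x _; rewrite indicE set_itv_ge ?in_set0 ?mul0e//.
    by rewrite bnd_simp -leNgt.
  rewrite -[LHS]/(\int[mu \x mu]_(p in subgraph w) (\1_((fun p : T * T => tanI p.1) @^-1` `]a, b]) p)%:E)%E.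
  by rewrite integral_indic.
rewrite ge0_integral_pushforward//.
rewrite preimage_setT ge0_integral_mrestr//=; last exact: (measurableT_comp mg mtf).
rewrite (integral_subgraph mu mw w0 (f := fun x => g (tanI x)))//; last exact: measurableT_comp mg mtanI.
rewrite [RHS]integral_mkcond; apply: eq_integral => x _.
by rewrite /w /tanI !patchE; case: ifP => // _; rewrite mule0.
Qed.

End tangent_substitution.

Section affine_sets.
Variable R : realType.
Local Notation mu := (@lebesgue_measure R).

Lemma ge0_integral_affine_set (a b : R) (A : set R) (f : R -> \bar R) : a != 0 ->
  measurable (A : set (measurableTypeR R)) -> measurable_fun setT f -> (forall x, 0 <= f x)%E ->
  (\int[mu]_(x in A) f x =
   `|a|%:E * \int[mu]_(x in (fun x : R => (a * x + b)%R) @^-1` A) f (a * x + b)%R)%E.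
Proof.
move=> a0 mA mf f0; rewrite integral_mkcond (@ge0_integral_affine _ a b)//; last 2 first.
- by apply/(measurable_restrictT _ mA); exact: measurable_funTS.
- by move=> x; rewrite patchE; case: ifP.
congr (_ * _)%E; rewrite [RHS]integral_mkcond; apply: eq_integral => x _.
by rewrite !patchE; congr (if _ then _ else _); apply/idP/idP; rewrite !inE.
Qed.

End affine_sets.

(** * Integration in polar coordinates *)

Section polar_coordinates.
Variable R : realType.
Local Notation mu := (@lebesgue_measure R).
Local Notation T := (measurableTypeR R).
Variable h : plane R -> \bar R.
Hypotheses (mh : measurable_fun setT h) (h0 : forall x, (0 <= h x)%E).

Let pc (t s : T) : plane R := (s * cos t, s * sin t).

(** The integral runs over the full line of direction [t], with both signs of s, so that an interval
    of angles of length pi already covers the plane. *)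
Let ray (t : R) : \bar R :=
  (\int[mu]_s ((`|s|%R)%:E * h (pc t s)))%E.

Let mabs : measurable_fun setT (fun s : T => (`|s|%R)%:E).
Proof. by apply/measurable_EFinP; meas. Qed.

Let mpc : measurable_fun setT (fun p : T * T => pc p.1 p.2).
Proof. by rewrite /pc; apply: (@measurable_fun_pair _ _ _ (T * T)%type T T); meas. Qed.

Let mpc2 t : measurable_fun setT (pc t).
Proof. by rewrite /pc; apply: (@measurable_fun_pair _ _ _ T T T); meas. Qed.

Let mray2 : measurable_fun setT
  (fun p : T * T => ((`|p.2|%R)%:E * h (pc p.1 p.2))%E).
Proof.
apply: emeasurable_funM; first exact: (measurableT_comp mabs measurable_snd).
exact: (measurableT_comp mh mpc).
Qed.

Let ray_ge0 t : (0 <= ray t)%E.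
Proof. by apply: integral_ge0 => s _; rewrite mule_ge0// lee_fin. Qed.

Let mray : measurable_fun setT ray.
Proof. exact: (measurable_integral_param mu mray2). Qed.

Let mhs (t : R) : measurable_fun setT (fun s : T => h (pc t s)).
Proof. exact: (measurableT_comp mh (mpc2 t)). Qed.

Let rayDpi t : ray (t + pi) = ray t.
Proof.
rewrite /ray -[RHS]ge0_integral_oppr.
- by apply: eq_integral => s _; rewrite /pc normrN cosDpi sinDpi !mulrN !mulNr.
- by apply: emeasurable_funM => //; exact: mhs.
- by move=> s; rewrite mule_ge0// lee_fin.
Qed.

Let pi0 : 0 < pi :> R. Proof. exact: pi_gt0. Qed.

Let integral_ray_angles :
  (\int[mu]_(t in @angles R) ray t = 2%:E * \int[mu]_(t in `]0%R, pi[) ray t)%E.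
Proof.
rewrite /angles (_ : `[0, 2 * pi[%classic = `[0, pi[%classic `|` `[pi, 2 * pi[%classic); last first.
  rewrite -itv_bndbnd_setU//= bnd_simp; first exact: ltW.
  by have := pi0; lra.
rewrite ge0_integral_setU//; last 2 first.
- exact: measurable_funTS.
- by apply/disj_set2P; apply/seteqP; split=> // x [/=]; rewrite !in_itv/= => /andP[_ x1] /andP[x2 _];
    move: (lt_le_trans x1 x2); rewrite ltxx.
rewrite [X in (_ + X)%E](@ge0_integral_affine_set _ 1 pi)//.
rewrite normr1 mul1e (_ : (fun x : R => 1 * x + pi) @^-1` _ = `[0, pi[%classic); last first.
  apply/seteqP; split=> x /=; rewrite !in_itv/= mul1r lerDr (_ : 2 * pi = pi + pi) ?ltrD2r//; ring.
under [X in (_ + X)%E]eq_integral do rewrite mul1r rayDpi.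
rewrite mule_natl mule2n; congr (_ + _)%E; rewrite -integral_itv_obnd_cbnd//; exact: measurable_funTS.
Qed.

Let integral_ray_half :
  (\int[mu]_(t in `](- (pi / 2))%R, (pi / 2)%R[) ray (pi / 2 - t) = \int[mu]_(t in `]0%R, pi[) ray t)%E.
Proof.
rewrite [RHS](@ge0_integral_affine_set _ (-1) (pi / 2) _ _ _ _ mray ray_ge0); last 2 first.
- by rewrite oppr_eq0 oner_eq0.
- exact: measurable_itv.
rewrite normrN1 mul1e (_ : (fun x : R => -1 * x + pi / 2) @^-1` _ = `](- (pi / 2)), (pi / 2)[%classic); last first.
  by apply/seteqP; split=> x /=; rewrite !in_itv/= => /andP[? ?]; apply/andP; split; lra.
by apply: eq_integral => t _; rewrite mulN1r addrC.
Qed.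

Let mhk : measurable_fun setT (fun p : T * T => ((`|p.1|%R)%:E * h ((p.1 * p.2)%R : R, p.1 : R))%E).
Proof.
apply: emeasurable_funM; first exact: (measurableT_comp mabs measurable_fst).
by apply: (measurableT_comp mh); apply: (@measurable_fun_pair _ _ _ (T * T)%type T T); meas.
Qed.

Let hk0 (p : T * T) : (0 <= (`|p.1|%R)%:E * h ((p.1 * p.2)%R : R, p.1 : R))%E.
Proof. by rewrite mule_ge0// lee_fin. Qed.

(* The one-dimensional substitutions x = y t, t = tan phi and y = s cos phi
   stand in for the change of variables theorem of the plane. *)
Lemma integral_plane_ray : (\int[leb2 R]_x h x = \int[mu]_(t in `]0%R, pi[) ray t)%E.
Proof.
rewrite (fubini_tonelli2 (m1 := mu) (m2 := mu) h mh h0) /fubini_G.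
transitivity (\int[mu]_y \int[mu]_t ((`|y|%R)%:E * h ((y * t)%R : R, y : R)))%E.
  apply: ae_eq_integral.
  - exact: measurableT.
  - exact: (measurable_fun_fubini_tonelli_G (m1 := mu) h mh h0).
  - exact: (measurable_integral_param mu mhk).
  (* The substitution x = y t degenerates only at y = 0. *)
  exists [set 0]; split; [exact: measurable_set1|exact: lebesgue_measure_set1|].
  move=> y /= yP; apply: contrapT => y0; apply: yP => _.
  have {}y0 : y != 0 by apply/eqP.
  have mhy : measurable_fun setT (fun x : T => h (x, y)).
    exact: (measurableT_comp mh (measurable_pair2 y)).
  rewrite (@ge0_integral_affine _ y 0 (fun x => h (x, y)) y0 mhy); last by move=> x; exact: h0.
  rewrite -ge0_integralZl; first by apply: eq_integral => x _; rewrite addr0.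
  - exact: measurableT.
  - by apply: (measurableT_comp mhy); meas.
  - by move=> x _; exact: h0.
  - by rewrite lee_fin.
rewrite (fubini_tonelli (m1 := mu) (m2 := mu) (fun p : T * T => ((`|p.1|%R)%:E * h ((p.1 * p.2)%R : R, p.1 : R))%E) mhk hk0).
rewrite integral_tan; last 2 first.
- exact: (measurable_fun_fubini_tonelli_G (m1 := mu) _ mhk hk0).
- by move=> t; apply: integral_ge0 => s _; exact: (hk0 (s, t)).
(* The angle of the tangent satisfies x = y tan t and is measured from the vertical axis: the polar
   angle is pi / 2 - t. *)
rewrite -integral_ray_half; apply: eq_integral => t.
rewrite inE/= in_itv/= => tI; have c0 : 0 < cos t by rewrite cos_gt0_pihalf.
have cn0 : cos t != 0 by rewrite gt_eqF.
have mk := measurableT_comp mhk (measurable_pair2 (tan t)).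
rewrite (@ge0_integral_affine _ (cos t) 0 (fun y => (`|y|%R)%:E * h ((y * tan t)%R : R, y : R))%E cn0 mk); last first.
  by move=> y; exact: (hk0 (y, tan t)).
rewrite muleC muleA -EFinM -ge0_integralZl; last 4 first.
- exact: measurableT.
- have ma : measurable_fun setT (fun x : T => (cos t * x + 0)%R) by meas.
  exact: (measurableT_comp mk ma).
- by move=> y _; exact: (hk0 (_, tan t)).
- by rewrite lee_fin mulr_ge0// invr_ge0 sqr_ge0.
(* The factor cos t of the last substitution, |y| = |s| cos t, and the density (cos t)^-2 multiply
   to |s|. *)
apply: eq_integral => s _; rewrite /pc addr0 muleA -EFinM; congr (_%:E * h (_, _))%E.
- by rewrite normrM (gtr0_norm c0); field.
- by rewrite cosB cos_pihalf sin_pihalf mul0r add0r mul1r /tan; field.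
- by rewrite sinB cos_pihalf sin_pihalf mul0r subr0 mul1r mulrC.
Qed.

Let h_polar (p : line R * circle R) : \bar R := ((`|p.1|%R)%:E * h (polar p))%E.

Lemma measurable_polar : measurable_fun setT (@polar R).
Proof.
have mval : measurable_fun setT (fun w : circle R => sval w).
  by move=> _ A mA; exists A.
have m1 : measurable_fun setT (fun p : line R * circle R => (sval p.2).1).
  exact: (measurableT_comp measurable_fst (measurableT_comp mval measurable_snd)).
have m2 : measurable_fun setT (fun p : line R * circle R => (sval p.2).2).
  exact: (measurableT_comp (@measurable_snd _ _ T T) (measurableT_comp mval measurable_snd)).
have m3 : measurable_fun setT (fun p : line R * circle R => p.1) by exact: measurable_fst.
rewrite /polar; apply: (@measurable_fun_pair _ _ _ (line R * circle R)%type T T).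
  exact: (measurable_funM m3 m1).
exact: (measurable_funM m3 m2).
Qed.

(** The factor 2 appears because (s, w) and (- s, - w) have the same image under [polar]. Arc length
    being a push-forward, the integral over the circle is one over the angles in [0, 2 pi[. *)
Lemma integral_polar :
  (\int[@leb_arc R]_p ((`|p.1|%R)%:E * h (polar p)) = 2%:E * \int[leb2 R]_x h x)%E.
Proof.
have mhp : measurable_fun setT h_polar.
  apply: emeasurable_funM; last exact: (measurableT_comp mh measurable_polar).
  exact: (measurableT_comp mabs measurable_fst).
have hp0 p : (0 <= h_polar p)%E by rewrite mule_ge0// lee_fin.
rewrite integral_plane_ray -integral_ray_angles.
rewrite (fubini_tonelli2 (m1 := mu) (m2 := @arc_length R) h_polar mhp hp0) /fubini_G.
pose G w := (\int[mu]_x h_polar (x, w))%E.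
have mG : measurable_fun setT G.
  exact: (measurable_fun_fubini_tonelli_G (m1 := mu) h_polar mhp hp0).
have G0 w : (0 <= G w)%E by apply: integral_ge0 => s _; exact: hp0.
have mr : measurable_fun setT (ray : T -> \bar R) by [].
rewrite -(ge0_integral_mrestr mu (@measurable_angles R) mr ray_ge0).
unshelve epose (pf := (pushforward (mrestr mu (@measurable_angles R)) (@circle_angle R) :
  {measure set _ -> \bar R})); first exact: measurable_circle_angle.
transitivity (\int[pf]_w G w)%E; first exact: eq_measure_integral.
rewrite ge0_integral_pushforward//; exact: measurable_circle_angle.
Qed.

End polar_coordinates.

(** * Topology and completeness of L^2 *)

Section L2_basics.
Context d (T : measurableType d) (R : realType).
Variable mu : {measure set T -> \bar R}.
Implicit Types (f g : L2 mu) (u v : T -> R[i]).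

Lemma cmeasurableB u v : cmeasurable u -> cmeasurable v -> cmeasurable (u - v).
Proof. by move=> mu' mv; rewrite -scaleN1r; apply: cmeasurableD => //; exact: cmeasurableZ. Qed.

Lemma energyD_le u v : cmeasurable u -> cmeasurable v ->
  (energy mu (u + v)%R <= 2%:E * (energy mu u + energy mu v))%E.
Proof.
move=> mu' mv; have mcu := cmeasurable_csq mu'; have mcv := cmeasurable_csq mv.
rewrite /energy -ge0_integralD//; last 4 first.
- by move=> x _; rewrite lee_fin csq_ge0.
- exact/measurable_EFinP.
- by move=> x _; rewrite lee_fin csq_ge0.
- exact/measurable_EFinP.
rewrite -ge0_integralZl//; last 2 first.
- by apply: emeasurable_funD; exact/measurable_EFinP.
- by move=> x _; rewrite adde_ge0// lee_fin csq_ge0.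
apply: ge0_le_integral => //.
- by move=> x _; rewrite lee_fin csq_ge0.
- by apply/measurable_EFinP; exact: cmeasurable_csq (cmeasurableD mu' mv).
- by apply: emeasurable_funM => //; apply: emeasurable_funD; exact/measurable_EFinP.
- by move=> x _; rewrite -EFinD -EFinM lee_fin csqD_le.
Qed.

Lemma energyN u : energy mu (- u) = energy mu u.
Proof. by apply: eq_integral => x _; rewrite /csq fctE; case: (u x) => a b /=; rewrite !sqrrN. Qed.

Lemma energyB_lty u v : cmeasurable u -> cmeasurable v -> (energy mu u < +oo)%E ->
  (energy mu v < +oo)%E -> (energy mu (u - v)%R < +oo)%E.
Proof.
move=> mu' mv eu ev; have mNv : cmeasurable (- v) by rewrite -sub0r; apply: cmeasurableB => //; split; exact: measurable_cst.
apply: le_lt_trans (energyD_le mu' mNv) _.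
by rewrite energyN lte_mul_pinfty ?lee_fin// lte_add_pinfty.
Qed.

Lemma cLnormE u : 'N[mu]_2%:E [EFin \o (fun x => normc (u x))]%E = (energy mu u `^ 2^-1)%E.
Proof.
rewrite unlock; congr (_ `^ _)%E; apply: eq_integral => x _ /=.
by rewrite csqE ger0_norm ?normc_ge0// powR_mulrn ?normc_ge0.
Qed.

Lemma finite_cnormE u : finite_norm mu 2%:E (fun x => normc (u x)) <-> (energy mu u < +oo)%E.
Proof.
rewrite /finite_norm cLnormE; have := energy_ge0 mu u; case: (energy mu u) => [r r0| |] //=.
- by rewrite !ltry.
- by rewrite invr_eq0 pnatr_eq0/= !ltxx.
Qed.

Lemma L2_energy f : energy mu f = ((L2norm f ^+ 2)%:E)%E.
Proof.
have e0 := energy_ge0 mu f.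
rewrite -powR_mulrn; last by rewrite -lee_fin L2normE Lnorm_ge0.
rewrite -poweR_EFin L2normE cLnormE -poweRrM mulVf ?poweRe1//.
Qed.

Lemma L2_energy_lty f : (energy mu f < +oo)%E.
Proof. by rewrite L2_energy ltry. Qed.

Lemma L2norm_ge0 f : 0 <= L2norm f.
Proof. by rewrite -lee_fin L2normE Lnorm_ge0. Qed.

Lemma ex_L2 u : cmeasurable u -> (energy mu u < +oo)%E -> exists f : L2 mu, f = u %[ae mu].
Proof.
move=> mu' eu; have uL : u \in L2fun_pred mu by rewrite inE; split=> //; exact/finite_cnormE.
by exists (\pi_(L2 mu) (MkL2fun uL)); exact: L2_pi.
Qed.

Lemma L2norm_energy f u : cmeasurable u -> f = u %[ae mu] -> ((L2norm f ^+ 2)%:E = energy mu u)%E.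
Proof. by move=> mu' fu; rewrite -L2_energy; apply: ae_eq_energy => //; exact: L2_cmeasurable. Qed.

Lemma L2_NE f : (- f : L2 mu) = - (f : T -> R[i]) %[ae mu].
Proof. exact: L2oppE. Qed.

Lemma L2_BE f g : (f - g : L2 mu) = (f : T -> R[i]) - (g : T -> R[i]) %[ae mu].
Proof.
apply: ae_eq_trans (L2_DE f (- g)) _; move: (L2_NE g).
by apply: filterS => x /[apply]; rewrite !fctE => ->.
Qed.

Lemma L2norm0 : L2norm (0 : L2 mu) = 0.
Proof. by have := normr0 (L2 mu); rewrite L2_normE => -[]. Qed.

Lemma L2norm_eq0 f : L2norm f = 0 -> f = 0.
Proof. by move=> f0; apply: L2norm0_eq0; rewrite f0. Qed.

Lemma L2normZ_real (a : R[i]) f : L2norm (a *: f) = normc a * L2norm f.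
Proof. by have := L2normZ a f; rewrite -[`|a|]/((normc a)%:C) -rmorphM => -[]. Qed.

Lemma L2normN f : L2norm (- f) = L2norm f.
Proof. by rewrite -scaleN1r L2normZ_real normcN normc1 mul1r. Qed.

Lemma L2normBC f g : L2norm (f - g) = L2norm (g - f).
Proof. by rewrite -L2normN opprB. Qed.

Lemma L2norm_triangle f g : L2norm (f + g) <= L2norm f + L2norm g.
Proof. by have := L2normD f g; rewrite -rmorphD lecR. Qed.

Lemma L2norm_triangleB h f g : L2norm (f - g) <= L2norm (f - h) + L2norm (h - g).
Proof. by apply: le_trans (L2norm_triangle _ _); rewrite addrA subrK. Qed.

(** The norm of the normed module is valued in R[i], where a positive element is real; balls may
    therefore be indexed by real radii. *)
Lemma nbhs_L2P f (A : set (L2 mu)) :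
  nbhs f A <-> exists e : R, 0 < e /\ forall g, L2norm (f - g) < e -> A g.
Proof.
split=> [/nbhs_normP[e /= e0 eA]|[e [e0 eA]]].
  have eE : e = (complex.Re e)%:C by rewrite -[e]RRe_real// gtr0_real.
  exists (complex.Re e); split; first by rewrite -ltcR -eE.
  by move=> g fg; apply: eA; rewrite /= L2_normE eE ltcR.
apply/nbhs_normP; exists e%:C; first by rewrite /= ltcR.
by move=> g /=; rewrite L2_normE ltcR; exact: eA.
Qed.

Lemma cvg_L2P (F : set_system (L2 mu)) (FF : Filter F) f :
  F --> f <-> forall e : R, 0 < e -> F [set g | L2norm (f - g) < e].
Proof.
split=> [Ff e e0|H A /nbhs_L2P[e [e0 eA]]].
  by apply: Ff; apply/nbhs_L2P; exists e.
by apply: filterS (H _ e0) => g; exact: eA.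
Qed.

Lemma cauchy_L2P (F : set_system (L2 mu)) (FF : ProperFilter F) : cauchy F ->
  forall e : R, 0 < e -> exists f, F [set g | L2norm (f - g) < e].
Proof.
move=> /cauchyP H e e0; have e0' : 0 < e%:C by rewrite ltcR.
have [f Ff] := H _ e0'; exists f; apply: filterS Ff => g.
by rewrite -ball_normE /= L2_normE ltcR.
Qed.

Lemma closure_L2P (A : set (L2 mu)) f :
  closure A f <-> forall e : R, 0 < e -> exists g, A g /\ L2norm (f - g) < e.
Proof.
split=> [cf e e0|H B /nbhs_L2P[e [e0 eB]]].
  have /cf[g [Ag gB]] : nbhs f [set g | L2norm (f - g) < e] by apply/nbhs_L2P; exists e.
  by exists g.
by have [g [Ag /eB Bg]] := H _ e0; exists g.
Qed.

End L2_basics.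

Lemma closure_L2prodP d d' (T : measurableType d) (U : measurableType d') (R : realType)
  (mu : {measure set T -> \bar R}) (nu : {measure set U -> \bar R}) (A : set (L2 mu * L2 nu)) f g :
  closure A (f, g) <-> forall e : R, 0 < e ->
    exists u v, [/\ A (u, v), L2norm (f - u) < e & L2norm (g - v) < e].
Proof.
split=> [cf e e0|H B [[B1 B2] [/= /nbhs_L2P[e1 [e10 eB1]] /nbhs_L2P[e2 [e20 eB2]]] B12]].
  have /cf[[u v] [Auv [/= u1 v1]]] : nbhs (f, g)
      [set p : L2 mu * L2 nu | L2norm (f - p.1) < e /\ L2norm (g - p.2) < e].
    exists ([set u | L2norm (f - u) < e], [set v | L2norm (g - v) < e]) => //=.
    by split; apply/nbhs_L2P; exists e.
  by exists u, v.
have e0 : 0 < Num.min e1 e2 by rewrite lt_min e10 e20.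
have [u [v [Auv fu gv]]] := H _ e0; exists (u, v); split=> //; apply: B12; split=> /=.
  by apply: eB1; rewrite (lt_le_trans fu)// ge_min lexx.
by apply: eB2; rewrite (lt_le_trans gv)// ge_min lexx orbT.
Qed.

Lemma lipschitz_within d d' (T : measurableType d) (U : measurableType d') (R : realType)
  (mu : {measure set T -> \bar R}) (nu : {measure set U -> \bar R}) (A : set (L2 mu))
  (F : L2 mu -> L2 nu) (C : R) :
  (forall u v, A u -> A v -> L2norm (F u - F v) <= C * L2norm (u - v)) ->
  {within A, continuous F}.
Proof.
move=> FC; apply/subspace_continuousP => u Au; apply/cvg_L2P => e e0.
pose k := Num.max 1 C; have k0 : 0 < k by rewrite lt_max ltr01.
apply/nbhs_L2P; exists (e / k); split=> [|v uv Av /=]; first by rewrite divr_gt0.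
apply: le_lt_trans (FC _ _ Au Av) _.
apply: (@le_lt_trans _ _ (k * L2norm (u - v))); last by rewrite mulrC -ltr_pdivlMr.
by rewrite ler_wpM2r ?L2norm_ge0// le_max lexx orbT.
Qed.

Lemma ReB (R : realType) (z w : R[i]) : complex.Re (z - w) = complex.Re z - complex.Re w.
Proof. by case: z w => ? ? []. Qed.

Lemma ImB (R : realType) (z w : R[i]) : complex.Im (z - w) = complex.Im z - complex.Im w.
Proof. by case: z w => ? ? []. Qed.

Lemma fatou_le d (T : measurableType d) (R : realType) (mu : {measure set T -> \bar R})
  (f_ : (T -> \bar R)^nat) (f : T -> \bar R) (C : \bar R) (N : nat) :
  (forall n, measurable_fun setT (f_ n)) -> (forall n x, 0 <= f_ n x)%E ->
  (forall x, f_ ^~ x @ \oo --> f x) ->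
  (forall n, (N <= n)%N -> (\int[mu]_x f_ n x <= C)%E) -> (\int[mu]_x f x <= C)%E.
Proof.
move=> mf f0 ff fC.
have -> : (\int[mu]_x f x = \int[mu]_x limn_einf (f_ ^~ x))%E.
  by apply: eq_integral => x _; have [] := cvg_limn_einf_sup (ff x).
apply: (le_trans (fatou mu measurableT mf (fun n x _ => f0 n x))).
rewrite limn_einf_lim; apply: lime_le; first exact: is_cvg_einfs.
near=> n; apply: (le_trans _ (fC n _)); last by near: n; exists N.
by apply: ereal_inf_lbound; exists n => /=.
Unshelve. all: by end_near. Qed.

Lemma geometric_cauchy_cvg (R : realType) (a : R ^nat) (K : R) :
  (forall n, `|a n - a n.+1| <= K * 2^-1 ^+ n) -> cvgn a.
Proof.
move=> aK; have aE : a = cst (a 0%N) + series (telescope a).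
  by apply/funext => n; rewrite telescopeK !fctE addrC subrK.
rewrite aE; apply: is_cvgD; first exact: is_cvg_cst.
apply: normed_cvg; apply: (series_le_cvg (v_ := geometric K 2^-1)).
- by move=> n; exact: normr_ge0.
- move=> n /=; rewrite mulr_ge0 ?exprn_ge0 ?invr_ge0//.
  by have := le_trans (normr_ge0 _) (aK 0%N); rewrite expr0 mulr1.
- by move=> n; rewrite /telescope/= distrC.
- apply: is_cvg_geometric_series.
  by rewrite gtr0_norm ?invr_gt0// invf_lt1// ltr1n.
Qed.

(** * Limits of rapidly converging sequences *)

Section riesz_fischer.
Context d (T : measurableType d) (R : realType).
Variable mu : {measure set T -> \bar R}.
Variable f : (L2 mu)^nat.
Hypothesis df : forall n, L2norm (f n - f n.+1) <= 4^-1 ^+ n.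

Let L2norm_tail n m : (n <= m)%N -> L2norm (f n - f m) <= 2 * 4^-1 ^+ n.
Proof.
move=> /subnK <-; move: (m - n)%N => k.
(* The exact partial sum of the geometric series passes through the induction, which the cruder
   bound 2 * 4^-1 ^+ n does not. *)
have : L2norm (f n - f (k + n)%N) <= (4 / 3) * (4^-1 ^+ n - 4^-1 ^+ (k + n)).
  elim: k => [|k IH]; first by rewrite add0n !subrr mulr0 L2norm0.
  apply: le_trans (L2norm_triangleB (f (k + n)%N) _ _) _.
  apply: le_trans (lerD IH (df _)) _.
  by rewrite addSn (exprS 4^-1 (k + n)); have := lexx (4^-1 ^+ (k + n) : R); lra.
move=> /le_trans; apply.
have : 0 <= 4^-1 ^+ (k + n) :> R by rewrite exprn_ge0// invr_ge0.
have : 0 <= 4^-1 ^+ n :> R by rewrite exprn_ge0// invr_ge0.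
lra.
Qed.

(* The weights 4 ^+ n keep the series integrable and force geometric convergence
   wherever it is finite. *)
Let S x : \bar R := (\sum_(n <oo) (4 ^+ n * csq (f n x - f n.+1 x))%:E)%E.

Let mdiff n : cmeasurable ((f n : T -> R[i]) - (f n.+1 : T -> R[i])).
Proof. by rewrite -scaleN1r; apply: cmeasurableD; [|apply: cmeasurableZ]; exact: L2_cmeasurable. Qed.

Let mterm n : measurable_fun setT (fun x => (4 ^+ n * csq (f n x - f n.+1 x))%:E).
Proof. by apply/measurable_EFinP; apply: measurable_funM => //; exact: cmeasurable_csq (mdiff n). Qed.

Let term_ge0 n x : (0 <= (4 ^+ n * csq (f n x - f n.+1 x))%:E)%E.
Proof. by rewrite lee_fin mulr_ge0 ?csq_ge0 ?exprn_ge0. Qed.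

Let mS : measurable_fun setT S.
Proof. by apply: ge0_emeasurable_sum. Qed.

(** The term of index n integrates to at most 4^n (4^-n)^2 = 4^-n. *)
Let integral_S : (\int[mu]_x S x < +oo)%E.
Proof.
rewrite integral_nneseries//.
apply: (@le_lt_trans _ _ (\sum_(n <oo) (4^-1 ^+ n)%:E)%E).
  apply: lee_nneseries => [n _ _|n _]; first by apply: integral_ge0.
  under eq_integral do rewrite EFinM.
  rewrite ge0_integralZl//; last 2 first.
  - by apply/measurable_EFinP; exact: cmeasurable_csq (mdiff n).
  - by move=> x _; rewrite lee_fin csq_ge0.
  rewrite -[X in (_ * X)%E]/(energy mu ((f n : T -> R[i]) - (f n.+1 : T -> R[i]))%R)%E.
  rewrite -(L2norm_energy (mdiff n) (L2_BE _ _)) -EFinM lee_fin.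
  have : L2norm (f n - f n.+1) ^+ 2 <= (4^-1 ^+ n) ^+ 2.
    by rewrite ler_sqr ?nnegrE ?L2norm_ge0 ?exprn_ge0 ?invr_ge0//.
  move=> /(ler_wpM2l (exprn_ge0 n (ler0n R 4))) /le_trans; apply.
  by rewrite expr2 mulrA -exprMn divff// expr1n mul1r.
apply: (@le_lt_trans _ _ 2%:E); last by rewrite ltry.
apply: lime_le; first by apply: is_cvg_nneseries => n _ _; rewrite lee_fin exprn_ge0// invr_ge0.
apply: nearW => n; rewrite sumEFin lee_fin.
suff -> : \sum_(0 <= i < n) 4^-1 ^+ i = (4 / 3) * (1 - 4^-1 ^+ n) :> R.
  by have : 0 <= 4^-1 ^+ n :> R; [rewrite exprn_ge0// invr_ge0|lra].
elim: n => [|n IH]; first by rewrite big_nil subrr mulr0.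
by rewrite big_nat_recr//= IH [X in _ = _ * (1 - X)]exprS; lra.
Qed.

Let G := ~` (S @^-1` [set +oo%E]).

Let mG : measurable G.
Proof. by apply: measurableC; rewrite -[X in measurable X]setTI; exact: mS. Qed.

Let S_ge0 x : (0 <= S x)%E.
Proof. exact: nneseries_ge0. Qed.

Let aeG : {ae mu, forall x, G x}.
Proof.
have iS : mu.-integrable setT S.
  apply/integrableP; split=> //; rewrite (eq_integral S)// => x _; exact: gee0_abs.
apply: filterS (integrable_ae measurableT iS) => x /(_ I) Sx; rewrite /G /= => Soo.
by rewrite Soo in Sx.
Qed.

(** [h] stands for the real or the imaginary part. A finite value K of the series bounds the squared
    increments by K 4^-n, hence the increments by (K + 1) 2^-n, where K + 1 replaces the square root
    of K. *)
Let csq_cvg (h : R[i] -> R) x : G x -> (forall z w, h (z - w) = h z - h w) ->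
  (forall z, h z ^+ 2 <= csq z) -> cvgn (fun n => h (f n x)).
Proof.
move=> Gx hB h2; have [K K0 SK] : exists2 K : R, 0 <= K & S x = K%:E.
  move: (S_ge0 x) Gx; rewrite /G/=; case: (S x) => [r r0 _|//|//]; by exists r.
apply: (@geometric_cauchy_cvg _ _ (K + 1)) => n.
have e0 : 0 <= 2^-1 ^+ n :> R by rewrite exprn_ge0// invr_ge0.
have : 4 ^+ n * csq (f n x - f n.+1 x) <= K.
  rewrite -lee_fin -SK; apply: le_trans (nneseries_lim_ge n.+1 _) => [|k _ _]; last exact: term_ge0.
  by rewrite big_nat_recr//= leeDr// sume_ge0.
rewrite -ler_pdivlMl ?exprn_gt0// => cK.
rewrite -(@ler_sqr _ `|_|) ?nnegrE//; last by rewrite mulr_ge0// addr_ge0.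
rewrite -hB real_normK ?num_real// (le_trans (h2 _))// (le_trans cK)//.
rewrite exprMn -exprM muln2 -addnn exprD -exprMn (_ : 2^-1 * 2^-1 = 4^-1 :> R); last by field.
rewrite -exprVn mulrC ler_wpM2r ?exprn_ge0 ?invr_ge0//.
rewrite sqrrD expr1n mulr1; have := sqr_ge0 K; have := K0; lra.
Qed.

(** Set to 0 off the set of convergence, the sequence converges everywhere and its pointwise limit
    is measurable. *)
Let v n x := if x \in G then f n x else 0.

Let w x : R[i] := limn (fun n => complex.Re (v n x)) +i* limn (fun n => complex.Im (v n x)).

Let cvg_Re x : complex.Re (v n x) @[n --> \oo] --> complex.Re (w x).
Proof.
rewrite /w /= /v; case: (boolP (x \in G)) => [|_]; last exact: is_cvg_cst.
rewrite inE => Gx; apply: csq_cvg => //; first by case=> ? ? [].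
by move=> z; rewrite /csq lerDl sqr_ge0.
Qed.

Let cvg_Im x : complex.Im (v n x) @[n --> \oo] --> complex.Im (w x).
Proof.
rewrite /w /= /v; case: (boolP (x \in G)) => [|_]; last exact: is_cvg_cst.
rewrite inE => Gx; apply: csq_cvg => //; first by case=> ? ? [].
by move=> z; rewrite /csq lerDr sqr_ge0.
Qed.

Let mv n : cmeasurable (v n).
Proof.
have [mr mi] := L2_cmeasurable (f n); split.
  rewrite (_ : (fun x => _) = (fun x => complex.Re (f n x)) \_ G).
    by apply/(measurable_restrictT _ mG); exact: measurable_funTS.
  by apply/funext => x; rewrite patchE /v; case: ifP.
rewrite (_ : (fun x => _) = (fun x => complex.Im (f n x)) \_ G).
  by apply/(measurable_restrictT _ mG); exact: measurable_funTS.
by apply/funext => x; rewrite patchE /v; case: ifP.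
Qed.

Let mw : cmeasurable w.
Proof.
split.
  by apply: (measurable_fun_cvg (h := fun n x => complex.Re (v n x))) => [n|x _]; [exact: (mv n).1|exact: cvg_Re].
by apply: (measurable_fun_cvg (h := fun n x => complex.Im (v n x))) => [n|x _]; [exact: (mv n).2|exact: cvg_Im].
Qed.

(** Fatou's lemma as m tends to infinity, applied to f n - v m, whose norm is bounded by the
    geometric tail. *)
Let energy_w n : (energy mu ((f n : T -> R[i]) - w)%R <= ((2 * 4^-1 ^+ n) ^+ 2)%:E)%E.
Proof.
have mf := L2_cmeasurable (f n).
apply: (@fatou_le _ _ _ mu (fun m x => (csq (f n x - v m x))%:E) _ _ n).
- by move=> m; apply/measurable_EFinP; exact: cmeasurable_csq (cmeasurableB mf (mv m)).
- by move=> m x; rewrite lee_fin csq_ge0.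
- move=> x; apply: cvg_EFin; first exact: nearW.
  have cr : (complex.Re (f n x) - complex.Re (v m x) : R) @[m --> \oo] -->
      (complex.Re (f n x) - complex.Re (w x) : R).
    by apply: cvgB; [exact: cvg_cst|exact: cvg_Re].
  have ci : (complex.Im (f n x) - complex.Im (v m x) : R) @[m --> \oo] -->
      (complex.Im (f n x) - complex.Im (w x) : R).
    by apply: cvgB; [exact: cvg_cst|exact: cvg_Im].
  have E z : csq (f n x - z) = (complex.Re (f n x) - complex.Re z) * (complex.Re (f n x) - complex.Re z) +
      (complex.Im (f n x) - complex.Im z) * (complex.Im (f n x) - complex.Im z).
    by rewrite /csq ReB ImB !expr2.
  rewrite -[((f n : T -> R[i]) - w) x]/(f n x - w x) E.
  under eq_fun do rewrite /= E.
  by apply: cvgD; apply: cvgM.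
move=> m nm; rewrite -[X in (X <= _)%E]/(energy mu ((f n : T -> R[i]) - v m)%R)%E.
rewrite -(@L2norm_energy _ _ _ mu (f n - f m)); last 2 first.
- exact: cmeasurableB.
- apply: ae_eq_trans (L2_BE _ _) _; move: aeG; apply: filterS => x Gx _.
  by rewrite !fctE /v mem_set.
by rewrite lee_fin ler_sqr ?nnegrE ?L2norm_ge0 ?L2norm_tail.
Qed.

(** The limit is square integrable because f 0 and f 0 - w are. The explicit rate is what the later
    constructions of limits use. *)
Lemma riesz_fischer : exists g : L2 mu, forall n, L2norm (f n - g) <= 2 * 4^-1 ^+ n.
Proof.
have ew : (energy mu w < +oo)%E.
  have -> : w = (f 0%N : T -> R[i]) - ((f 0%N : T -> R[i]) - w).
    by apply/funext => x; rewrite !fctE opprB addrC subrK.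
  have mf := L2_cmeasurable (f 0%N).
  apply: energyB_lty => //; [exact: cmeasurableB|exact: L2_energy_lty|].
  by apply: le_lt_trans (energy_w 0) _; rewrite ltry.
have [g gw] := ex_L2 mw ew; exists g => n.
rewrite -(@ler_sqr _ (L2norm _)) ?nnegrE ?L2norm_ge0//.
rewrite -lee_fin (@L2norm_energy _ _ _ mu (f n - g) ((f n : T -> R[i]) - w)).
- exact: energy_w.
- by apply: cmeasurableB => //; exact: L2_cmeasurable.
- by apply: ae_eq_trans (L2_BE _ _) _; move: gw; apply: filterS => x /[apply]; rewrite !fctE => ->.
Qed.

End riesz_fischer.

Section hilbert_subspaces.
Context d (T : measurableType d) (R : realType).
Variable mu : {measure set T -> \bar R}.

Lemma L2_complete (F : set_system (L2 mu)) : ProperFilter F -> cauchy F ->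
  exists f : L2 mu, F --> f.
Proof.
(* Two consecutive radii add up to (5 / 8) 4^-n, within the rate required by [riesz_fischer]. *)
move=> FF cF; pose e n : R := 2^-1 * 4^-1 ^+ n.
have e0 n : 0 < e n by rewrite mulr_gt0 ?invr_gt0// exprn_gt0 ?invr_gt0.
have /choice[g gF] : forall n, exists g, F [set h | L2norm (g - h) < e n].
  by move=> n; exact: cauchy_L2P.
have dg n : L2norm (g n - g n.+1) <= 4^-1 ^+ n.
  have [h [/= h1 h2]] := filter_ex (filterI (gF n) (gF n.+1)).
  apply: le_trans (L2norm_triangleB h _ _) _; rewrite (L2normBC h).
  apply: le_trans (lerD (ltW h1) (ltW h2)) _; rewrite /e exprS.
  have : 0 <= 4^-1 ^+ n :> R by rewrite exprn_ge0// invr_ge0.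
  lra.
have [f fg] := riesz_fischer dg; exists f; apply/cvg_L2P => x x0.
have [n nx] : exists n, 3 * 4^-1 ^+ n < x.
  have q1 : `|4^-1| < 1 :> R by rewrite gtr0_norm ?invr_gt0// invf_lt1// ltr1n.
  have /cvgrPdist_lt/(_ (x / 3)) := cvg_expr q1.
  rewrite divr_gt0// => /(_ isT)[n _ /(_ n (leqnn n))]; rewrite sub0r normrN => nx.
  by exists n; rewrite mulrC -ltr_pdivlMr// (le_lt_trans (ler_norm _)).
apply: filterS (gF n) => h /= gh; apply: le_lt_trans (L2norm_triangleB (g n) _ _) _.
rewrite L2normBC (le_lt_trans _ nx)//.
apply: (@le_trans _ _ (2 * 4^-1 ^+ n + e n)); first by rewrite lerD// ltW.
rewrite /e; have : 0 <= 4^-1 ^+ n :> R by rewrite exprn_ge0// invr_ge0.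
lra.
Qed.

Lemma hilbert_subspaceP (A : set (L2 mu)) : A 0 ->
  (forall (a : R[i]) (u v : L2 mu), A u -> A v -> A (a *: u + v)) ->
  closed A -> hilbert_subspace A.
Proof.
move=> A0 AL cA; split=> // F FF FA cF.
have [f Ff] := L2_complete FF cF; exists f; split=> //.
apply: (cA f) => B fB; apply: (@filter_ex _ F); apply: filterI => //; exact: Ff.
Qed.

End hilbert_subspaces.

(** * Extension by continuity *)

Section density.
Context d (T : measurableType d) (R : realType).
Variable mu : {measure set T -> \bar R}.
Implicit Types (u v : T -> R[i]) (f : L2 mu).

Lemma cmeasurable_if (A : set T) u : measurable A -> cmeasurable u ->
  cmeasurable (fun x => if x \in A then u x else 0).
Proof.
move=> mA [mr mi]; split.
  rewrite (_ : (fun x => _) = (fun x => complex.Re (u x)) \_ A).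
    by apply/(measurable_restrictT _ mA); exact: measurable_funTS.
  by apply/funext => x; rewrite patchE; case: ifP.
rewrite (_ : (fun x => _) = (fun x => complex.Im (u x)) \_ A).
  by apply/(measurable_restrictT _ mA); exact: measurable_funTS.
by apply/funext => x; rewrite patchE; case: ifP.
Qed.

Lemma csq0 : csq (0 : R[i]) = 0.
Proof. by rewrite /csq/= expr0n addr0. Qed.

Lemma cintegrable_ae u v : cmeasurable v -> u = v %[ae mu] -> cintegrable mu u -> cintegrable mu v.
Proof.
move=> mv uv [mu' iu]; split=> //.
have mnu := cmeasurable_normc mu'; have mnv := cmeasurable_normc mv.
apply: ge0_Rintegrable => //; first by move=> x; exact: normc_ge0.
have /integrableP[_] := iu; apply: le_lt_trans.
rewrite le_eqVlt; apply/orP; left; apply/eqP; apply: ae_eq_integral => //.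
- exact/measurable_EFinP.
- by apply: measurableT_comp => //; exact/measurable_EFinP.
by apply: filterS uv => x /(_ I) /= -> _; rewrite ger0_norm// normc_ge0.
Qed.

(** The small values of [f] are cut off: where |f| >= 1 / n one has |f| <= n |f|^2, which is
    integrable. The cut-off functions converge to [f] at every point, being equal to it for large n
    where [f] does not vanish. *)
Lemma dense_cintegrable f (e : R) : 0 < e ->
  exists g : L2 mu, cintegrable mu g /\ L2norm (f - g) < e.
Proof.
move=> e0; have mf := L2_cmeasurable f; have mnf := cmeasurable_normc mf.
have mcf := cmeasurable_csq mf; have ef := L2_energy_lty f.
have if2 : mu.-integrable setT (fun x => (csq (f x))%:E).
  by apply: ge0_Rintegrable => // x; exact: csq_ge0.
pose A n : set T := [set x | 1 <= n%:R * normc (f x)].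
have mA n : measurable (A n).
  rewrite (_ : A n = (fun x => n%:R * normc (f x)) @^-1` `[1, +oo[%classic); last first.
    by apply/seteqP; split=> x /=; rewrite in_itv/= andbT.
  rewrite -[X in measurable X]setTI; apply: measurable_funM => //; exact: measurable_itv.
pose h n x := if x \in A n then f x else 0.
have mh n : cmeasurable (h n) by exact: cmeasurable_if.
have hf n x : csq (h n x) <= csq (f x).
  by rewrite /h; case: ifP => // _; rewrite csq0 csq_ge0.
have hf' n x : csq (f x - h n x) <= csq (f x).
  by rewrite /h; case: ifP => // _; rewrite ?subr0// subrr csq0 csq_ge0.
have eh n : (energy mu (h n) < +oo)%E.
  apply: le_lt_trans ef; apply: ge0_le_integral => //.
  - by move=> x _; rewrite lee_fin csq_ge0.
  - exact/measurable_EFinP/cmeasurable_csq.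
  - exact/measurable_EFinP.
  - by move=> x _; rewrite lee_fin.
have ih n : cintegrable mu (h n).
  split=> //; apply: (@le_Rintegrable _ _ _ mu _ (fun x => n%:R * csq (f x))).
  - exact: cmeasurable_normc.
  - move=> x; rewrite ger0_norm ?normc_ge0// /h; case: ifPn => [|_]; last first.
      by rewrite normc0 mulr_ge0// csq_ge0.
    by rewrite inE /A/= => xA; rewrite csqE expr2 mulrA ler_peMl ?normc_ge0.
  - exact: (integrableZl measurableT n%:R if2).
have mfh n : measurable_fun setT (fun x => (csq (f x - h n x))%:E).
  by apply/measurable_EFinP; exact: cmeasurable_csq (cmeasurableB mf (mh n)).
have cv : {ae mu, forall x, setT x -> (fun n => (csq (f x - h n x))%:E) @ \oo --> cst 0%E x}.
  apply: aeW => x _; have [fx|fx] := eqVneq (normc (f x)) 0.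
    rewrite (_ : (fun n => _) = cst 0%E); first exact: cvg_cst.
    apply/funext => n; congr EFin; apply/eqP; rewrite eq_le csq_ge0 andbT.
    by rewrite (le_trans (hf' n x))// csqE fx expr0n.
  apply: cvg_near_cst; near=> n; rewrite /h mem_set ?subrr ?csq0//.
  rewrite /A/= -ler_pdivrMr ?lt_neqAle 1?eq_sym ?fx ?normc_ge0//.
  by near: n; exact: nbhs_infty_ger.
have dm : {ae mu, forall x n, setT x -> (`|(csq (f x - h n x))%:E| <= (csq (f x))%:E)%E}.
  by apply: aeW => x n _; rewrite gee0_abs ?lee_fin ?csq_ge0.
have [_ _] := @dominated_convergence _ _ _ mu setT measurableT
  (fun n x => (csq (f x - h n x))%:E) (cst 0%E) (fun x => (csq (f x))%:E)
  mfh (measurable_cst _) cv if2 dm.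
rewrite integral0 => H.
have [n /(_ n (leqnn n)) hn] := cvge0_le H (exprn_gt0 2 (divr_gt0 e0 (ltr0n R 2))).
have [g gh] := ex_L2 (mh n) (eh n); exists g; split.
  by apply: cintegrable_ae (ih n); [exact: L2_cmeasurable|exact: ae_eq_sym].
have : L2norm (f - g) <= e / 2.
  rewrite -(@ler_sqr _ (L2norm _)) ?nnegrE ?L2norm_ge0 ?divr_ge0 ?(ltW e0)//.
  rewrite -lee_fin (@L2norm_energy _ _ _ mu (f - g) ((f : T -> R[i]) - h n))//.
  - exact: cmeasurableB.
  - by apply: ae_eq_trans (L2_BE _ _) _; move: gh; apply: filterS => x /[apply]; rewrite !fctE => ->.
by move=> /le_lt_trans; apply; lra.
Unshelve. all: by end_near. Qed.

End density.

(** * Extension of an operator that multiplies energies by a constant *)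

Section extension.
Context d d' (T : measurableType d) (U : measurableType d') (R : realType).
Variables (mu : {measure set T -> \bar R}) (nu : {measure set U -> \bar R}).
Variables (F : (T -> R[i]) -> U -> R[i]) (c : R).
Hypothesis c0 : 0 < c.
Hypothesis mF : forall f, cintegrable mu f -> cmeasurable (F f).
Hypothesis F_linear : forall a f g, cintegrable mu f -> cintegrable mu g ->
  F (a *: f + g) = a *: F f + F g %[ae nu].
Hypothesis F_energy : forall f, cintegrable mu f -> (energy mu f < +oo)%E ->
  (energy nu (F f) = (c ^+ 2)%:E * energy mu f)%E.
Implicit Types (f : L2 mu) (g : L2 nu).

Local Notation ext := (@L2_extension _ _ T U R mu nu F).
Local Notation graph := [set p : L2 mu * L2 nu | cintegrable mu p.1 /\ p.2 = F p.1 %[ae nu]].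

Lemma extensionP f g : ext f g <-> forall e : R, 0 < e ->
  exists (u : L2 mu) (v : L2 nu), [/\ cintegrable mu u, v = F u %[ae nu], L2norm (f - u) < e & L2norm (g - v) < e].
Proof.
rewrite /L2_extension/= closure_L2prodP; split=> H e e0.
  by have [u [v [[/= iu vu] fu gv]]] := H _ e0; exists u, v.
by have [u [v [iu vu fu gv]]] := H _ e0; exists u, v.
Qed.

(** The image of u - v has energy zero by the energy identity. This makes the operator well defined
    on classes, hence its graph a linear subspace. *)
Let F_ae u v : u = v %[ae mu] -> cintegrable mu u -> cintegrable mu v -> F u = F v %[ae nu].
Proof.
move=> uv iu iv.
have iuv : cintegrable mu ((-1) *: v + u) by apply: cintegrableD => //; exact: cintegrableZ.
have e0 : energy mu ((-1) *: v + u) = 0%E.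
  rewrite (@ae_eq_energy _ _ _ mu _ (cst 0)).
  - by rewrite /energy; apply: integral0_eq => x _; rewrite csq0.
  - exact: iuv.1.
  - by split; exact: measurable_cst.
  - by apply: filterS uv => x /[apply]; rewrite !fctE => ->; rewrite scaleN1r addNr.
have := F_energy iuv; rewrite e0 mule0 => /(_ (ltry 0)) FE.
have F0 : F ((-1) *: v + u) = 0 %[ae nu].
  have eF : (energy nu (F ((-1) *: v + u)%R) < +oo)%E by rewrite FE.
  have [g gF] := ex_L2 (mF iuv) eF.
  have : L2norm g = 0.
    by apply/eqP; rewrite -sqrf_eq0; apply/eqP/EFin_inj; rewrite (L2norm_energy (mF iuv) gF).
  by move=> /L2norm_eq0 g0; apply: ae_eq_trans (ae_eq_sym gF) _; rewrite g0; exact: L2_0E.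
move: F0 (F_linear (-1) iv iu); apply: filterS2 => x /(_ I) + /(_ I) + _.
by rewrite !fctE scaleN1r => -> /esym/eqP; rewrite addrC subr_eq0 => /eqP.
Qed.

Let graph_linear a f g f' g' : graph (f, g) -> graph (f', g') -> graph (a *: f + f', a *: g + g').
Proof.
move=> [/= fi gf] [/= fi' gf'].
have E : (a *: f + f' : L2 mu) = a *: (f : T -> R[i]) + (f' : T -> R[i]) %[ae mu].
  apply: ae_eq_trans (L2_DE _ _) _; move: (L2_ZE a f).
  by apply: filterS => x /[apply]; rewrite !fctE => ->.
have i1 : cintegrable mu (a *: (f : T -> R[i]) + (f' : T -> R[i])).
  by apply: cintegrableD => //; exact: cintegrableZ.
have i2 : cintegrable mu (a *: f + f' : L2 mu).
  by apply: cintegrable_ae i1; [exact: L2_cmeasurable|exact: ae_eq_sym].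
split=> //=; apply: ae_eq_trans (L2_DE _ _) _.
apply: (ae_eq_trans _ (ae_eq_sym (F_ae E i2 i1))).
apply: (ae_eq_trans _ (ae_eq_sym (F_linear a fi fi'))).
move: (L2_ZE a g) gf gf'; apply: filterS3 => x /(_ I) + /(_ I) + /(_ I) + _.
by rewrite !fctE => -> -> ->.
Qed.

Let graph_norm f g : graph (f, g) -> L2norm g = c * L2norm f.
Proof.
move=> [/= fi gf]; apply/eqP.
rewrite -(@eqrXn2 _ 2)// ?mulr_ge0 ?L2norm_ge0 ?ltW//; apply/eqP/EFin_inj.
by rewrite (L2norm_energy (mF fi) gf) F_energy ?L2_energy_lty// L2_energy exprMn EFinM.
Qed.

Let extension_linear a f g f' g' : ext f g -> ext f' g' -> ext (a *: f + f') (a *: g + g').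
Proof.
move=> /extensionP fg /extensionP fg'; apply/extensionP => e e0.
pose k := normc a + 1; have k0 : 0 < k by rewrite ltr_wpDl// normc_ge0.
have [u [v [iu vu fu gv]]] := fg _ (divr_gt0 (divr_gt0 e0 (ltr0n R 2)) k0).
have [u' [v' [iu' vu' fu' gv']]] := fg' _ (divr_gt0 e0 (ltr0n R 2)).
have [/= iuu vuu] := graph_linear a (conj iu vu : graph (u, v)) (conj iu' vu' : graph (u', v')).
have B (V : lmodType R[i]) (x y x' y' : V) : a *: x + x' - (a *: y + y') = a *: (x - y) + (x' - y').
  by rewrite scalerBr opprD !addrA; congr (_ - _); rewrite addrAC.
have le (x : R) : x < e / 2 / k -> normc a * x <= e / 2.
  move=> xe; apply: (@le_trans _ _ (normc a * (e / 2 / k))).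
    by rewrite ler_wpM2l ?normc_ge0// ltW.
  rewrite mulrA ler_pdivrMr// mulrC ler_wpM2l//; first by rewrite divr_ge0// ltW.
  by rewrite /k lerDl.
exists (a *: u + u'), (a *: v + v'); split=> //.
- rewrite B (le_lt_trans (L2norm_triangle _ _))// L2normZ_real.
  by rewrite [ltRHS](_ : e = e / 2 + e / 2) ?ler_ltD ?le//; lra.
- rewrite B (le_lt_trans (L2norm_triangle _ _))// L2normZ_real.
  by rewrite [ltRHS](_ : e = e / 2 + e / 2) ?ler_ltD ?le//; lra.
Qed.

Let extension_norm f g : ext f g -> L2norm g = c * L2norm f.
Proof.
move=> /extensionP fg; apply/eqP; rewrite -subr_eq0 -normr_le0; apply/ler_addgt0Pl => e e0.
rewrite addr0; have k0 : 0 < 1 + c by rewrite ltr_wpDl// ltW.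
(* The error of [g] is at most e / (1 + c) and that of [f] enters with the factor c; together they
   give e. *)
have [u [v [iu vu fu gv]]] := fg _ (divr_gt0 e0 k0).
have vE := graph_norm (conj iu vu : graph (u, v)).
have N d2 (V : measurableType d2) (m : {measure set V -> \bar R}) (x y : L2 m) :
    `|L2norm x - L2norm y| <= L2norm (x - y).
  have := L2norm_triangle (x - y) y; have := L2norm_triangle (y - x) x.
  by rewrite !subrK (L2normBC y) ler_norml => ? ?; apply/andP; split; lra.
have := N _ _ _ g v; have := N _ _ _ f u.
rewrite vE => Nf Ng; rewrite [X in `|X|](_ : _ = (L2norm g - c * L2norm u) + c * (L2norm u - L2norm f)); last by ring.
rewrite (le_trans (ler_normD _ _))// normrM (gtr0_norm c0) [X in _ + _ * X]distrC.
apply: (@le_trans _ _ (e / (1 + c) + c * (e / (1 + c)))).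
  apply: lerD; first exact: (le_trans Ng (ltW gv)).
  by rewrite ler_pM2l//; exact: (le_trans Nf (ltW fu)).
by rewrite -{1}[e / _]mul1r -mulrDl mulrC divfK// gt_eqF.
Qed.

Let graph_ex (f : L2 mu) : cintegrable mu f -> exists g, graph (f, g).
Proof.
move=> fi; have eF : (energy nu (F f) < +oo)%E.
  by rewrite F_energy ?L2_energy_lty// L2_energy -EFinM ltry.
by have [g gF] := ex_L2 (mF fi) eF; exists g.
Qed.

(** Integrable approximations of [f] have images that converge rapidly, by the norm identity on the
    graph, and the target is complete. *)
Let extension_ex f : exists g, ext f g.
Proof.
(* Chosen so that c (dl n + dl n.+1) = (5 / 8) 4^-n, within the rate required by [riesz_fischer]. *)
pose dl n : R := 4^-1 ^+ n / (2 * c).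
have dl0 n : 0 < dl n by rewrite divr_gt0 ?exprn_gt0 ?invr_gt0 ?mulr_gt0.
have /choice[u uf] : forall n, exists u : L2 mu, cintegrable mu u /\ L2norm (f - u) < dl n.
  by move=> n; exact: dense_cintegrable.
have /choice[v vu] : forall n, exists v, graph (u n, v) by move=> n; exact: graph_ex (uf n).1.
have dv n : L2norm (v n - v n.+1) <= 4^-1 ^+ n.
  have := graph_linear (-1) (vu n.+1) (vu n); rewrite !scaleN1r ![- _ + _]addrC => /graph_norm ->.
  have u1 : L2norm (u n - u n.+1) <= dl n + dl n.+1.
    apply: le_trans (L2norm_triangleB f _ _) _.
    by rewrite L2normBC lerD// ltW ?(uf _).2.
  have : c * L2norm (u n - u n.+1) <= c * (dl n + dl n.+1) by rewrite ler_pM2l.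
  move/le_trans; apply; rewrite /dl exprS.
  rewrite [leLHS](_ : _ = (5 / 8) * 4^-1 ^+ n); last by field; rewrite gt_eqF.
  have : 0 <= 4^-1 ^+ n :> R by rewrite exprn_ge0// invr_ge0.
  lra.
have [g vg] := riesz_fischer dv; exists g; apply/extensionP => e e0.
have q1 : `|4^-1| < 1 :> R by rewrite gtr0_norm ?invr_gt0// invf_lt1// ltr1n.
(* The two constants belong to the errors 2 * 4^-n of the images and 4^-n / (2 c) of the
   arguments. *)
pose k := Num.max 2 (2 * c)^-1; have k0 : 0 < k by rewrite lt_max ltr0n.
have /cvgrPdist_lt/(_ (e / k)) := cvg_expr q1.
rewrite divr_gt0// => /(_ isT)[n _ /(_ n (leqnn n))]; rewrite sub0r normrN => nx.
have {}nx : k * 4^-1 ^+ n < e.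
  by rewrite mulrC -ltr_pdivlMr// (le_lt_trans (ler_norm _)).
have q0 : 0 <= 4^-1 ^+ n :> R by rewrite exprn_ge0// invr_ge0.
exists (u n), (v n); split; [exact: (uf n).1|exact: (vu n).2| |].
- apply: lt_trans (uf n).2 _; apply: le_lt_trans nx.
  by rewrite /dl mulrC ler_wpM2r// le_max lexx orbT.
- rewrite L2normBC; apply: le_lt_trans (vg n) _; apply: le_lt_trans nx.
  by rewrite ler_wpM2r// le_max lexx.
Qed.

Local Notation extend f := (xget 0 (ext f)).

(** Two values at [f] differ by a value of the extension at 0, whose norm is 0. This is the
    uniqueness behind the choice made by [xget]. *)
Lemma extensionE f g : ext f g -> extend f = g.
Proof.
have [g' fg'] := extension_ex f; move=> fg.
have uniq (h h' : L2 nu) : ext f h -> ext f h' -> h = h'.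
  move=> fh fh'; have := extension_linear (a := -1) fh fh'; rewrite !scaleN1r addNr.
  move=> /extension_norm; rewrite L2norm0 mulr0 => /L2norm_eq0/eqP.
  by rewrite addrC subr_eq0 => /eqP.
by apply: uniq fg; exact: (@xgetPex _ 0 (ext f)).
Qed.

Lemma ext_extension f : ext f (extend f).
Proof. by apply: (@xgetPex _ 0 (ext f)); exact: extension_ex. Qed.

Lemma extension_linearE (a : R[i]) f f' : extend (a *: f + f') = a *: extend f + extend f' :> L2 nu.
Proof. by apply: extensionE; apply: extension_linear; exact: ext_extension. Qed.

Lemma L2norm_extension f : L2norm (extend f : L2 nu) = c * L2norm f.
Proof. by apply: extension_norm; exact: ext_extension. Qed.

Lemma extension_integrable f : cintegrable mu f -> (extend f : L2 nu) = F f %[ae nu].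
Proof.
move=> fi; have [g fg] := graph_ex fi.
have -> : extend f = g.
  by apply: extensionE; apply/extensionP => e e0; exists f, g; rewrite !subrr !L2norm0; case: fg.
by case: fg.
Qed.

End extension.

Lemma ae_prod2 d d' (X : measurableType d) (Y : measurableType d') (R : realType)
  (m1 : {sigma_finite_measure set X -> \bar R}) (m2 : {sigma_finite_measure set Y -> \bar R})
  (P : Y -> Prop) : {ae m2, forall y, P y} -> {ae (m1 \x m2)%E, forall p, P p.2}.
Proof.
move=> [N [mN N0 PN]]; exists (setT `*` N); split.
- exact: measurableX.
- by rewrite -[LHS]/((m1 \x m2)%E (setT `*` N)) product_measure1E// N0 mule0.
- by move=> p Pp; split=> //; exact: PN.
Qed.

Section cintegral_kernels.
Context d (T : measurableType d) (R : realType) (mu : {measure set T -> \bar R}).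

Lemma cintegral_linear (a : R[i]) (f g e : T -> R[i]) : cmeasurable e ->
  (forall x, normc (e x) = 1) -> cintegrable mu f -> cintegrable mu g ->
  cintegral mu (fun x => (a *: f + g) x * e x) =
  a * cintegral mu (fun x => f x * e x) + cintegral mu (fun x => g x * e x).
Proof.
move=> me e1 fi gi.
have fe := cintegrable_mul_bounded me e1 fi; have ge := cintegrable_mul_bounded me e1 gi.
rewrite -cintegralZ// -cintegralD//; last exact: (cintegrableZ a fe).
by congr (cintegral mu _); apply/funext => x; rewrite !fctE mulrDl mulrA.
Qed.

End cintegral_kernels.

(** * The two Fourier transforms on L^2 *)

Section fourier_transforms.
Variable R : realType.
Local Notation mu := (@lebesgue_measure R).
Local Notation T := (measurableTypeR R).

Let pi0 : 0 < 2 * pi :> R. Proof. by rewrite mulr_gt0// pi_gt0. Qed.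

Lemma fourier_integralE f (xi : plane R) : cintegrable (@leb2 R) f ->
  fourier_integral f xi = fourier1 (fun y => fiber_fourier f (xi.1, y)) xi.2.
Proof. by move=> fi; rewrite -(fourier2E fi). Qed.

Let mF2 f : cintegrable (@leb2 R) f -> cmeasurable (fourier_integral f).
Proof.
move=> fi; have -> : fourier_integral f = fun xi : plane R => fourier1 (fun y => fiber_fourier f (xi.1, y)) xi.2.
  by apply/funext => xi; exact: fourier_integralE.
exact: (cmeasurable_fourier2 fi).
Qed.

Let F2_linear a f g : cintegrable (@leb2 R) f -> cintegrable (@leb2 R) g ->
  fourier_integral (a *: f + g) = a *: fourier_integral f + fourier_integral g %[ae @leb2 R].
Proof.
move=> fi gi; apply: aeW => xi _; rewrite !fctE /fourier_integral.
apply: (@cintegral_linear _ _ _ (@leb2 R) a f g (fun x => expNi (x.1 * xi.1 + x.2 * xi.2))) => //.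
- apply: cmeasurable_expNi.
  have m1 : measurable_fun setT (fun x : plane R => x.1) by exact: measurable_fst.
  have m2 : measurable_fun setT (fun x : plane R => x.2) by exact: measurable_snd.
  by apply: measurable_funD; apply: measurable_funM.
- by move=> x; exact: normc_expNi.
Qed.

Let F2_energy f : cintegrable (@leb2 R) f -> (energy (@leb2 R) f < +oo)%E ->
  (energy (@leb2 R) (fourier_integral f) = ((2 * pi) ^+ 2)%:E * energy (@leb2 R) f)%E.
Proof.
move=> fi fe; rewrite -(fourier2_plancherel fi fe); congr energy.
by apply/funext => xi; exact: fourier_integralE.
Qed.

Lemma fourier_linear (a : R[i]) (f g : L2 (@leb2 R)) : fourier (a *: f + g) = a *: fourier f + fourier g.
Proof. exact: (extension_linearE pi0 mF2 F2_linear F2_energy). Qed.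

Lemma L2norm_fourier (f : L2 (@leb2 R)) : L2norm (fourier f) = 2 * pi * L2norm f.
Proof. exact: (L2norm_extension pi0 mF2 F2_linear F2_energy). Qed.

Let c := Num.sqrt (2 * pi : R).
Let c0 : 0 < c. Proof. by rewrite sqrtr_gt0. Qed.

Let mFr g : cintegrable (@leb_arc R) g -> cmeasurable (radial_fourier_integral g).
Proof. by move=> [mg _]; exact: (cmeasurable_fiber_fourier mg). Qed.

(** An integrable function on the cylinder has integrable fibers for almost every direction only, so
    additivity is claimed off a null set of directions. *)
Let Fr_linear a f g : cintegrable (@leb_arc R) f -> cintegrable (@leb_arc R) g ->
  radial_fourier_integral (a *: f + g) =
    a *: radial_fourier_integral f + radial_fourier_integral g %[ae @leb_arc R].
Proof.
move=> fi gi; have af := ae_cintegrable2 fi; have ag := ae_cintegrable2 gi.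
have afg : {ae @arc_length R, forall w, cintegrable mu (fun s => f (s, w)) /\ cintegrable mu (fun s => g (s, w))}.
  by move: af ag; apply: filterS2.
move: (ae_prod2 mu afg); apply: filterS => -[s w] /= [fw gw] _; rewrite !fctE /radial_fourier_integral/=.
apply: (@cintegral_linear _ _ _ mu a (fun x => f (x, w)) (fun x => g (x, w)) (fun x => expNi (x * s))) => //.
- by apply: cmeasurable_expNi; meas.
- by move=> x; exact: normc_expNi.
Qed.

Let Fr_energy g : cintegrable (@leb_arc R) g -> (energy (@leb_arc R) g < +oo)%E ->
  (energy (@leb_arc R) (radial_fourier_integral g) = (c ^+ 2)%:E * energy (@leb_arc R) g)%E.
Proof.
by move=> gi ge; rewrite sqr_sqrtr ?ltW// -[RHS](fiber_plancherel gi ge).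
Qed.

Lemma radial_fourier_linear (a : R[i]) (f g : L2 (@leb_arc R)) :
  radial_fourier (a *: f + g) = a *: radial_fourier f + radial_fourier g.
Proof. exact: (extension_linearE c0 mFr Fr_linear Fr_energy). Qed.

Lemma L2norm_radial_fourier (f : L2 (@leb_arc R)) :
  L2norm (radial_fourier f) = Num.sqrt (2 * pi) * L2norm f.
Proof. exact: (L2norm_extension c0 mFr Fr_linear Fr_energy). Qed.

Lemma radial_fourierE (f : L2 (@leb_arc R)) : cintegrable (@leb_arc R) f ->
  radial_fourier f = radial_fourier_integral f %[ae @leb_arc R].
Proof. exact: (extension_integrable c0 mFr Fr_linear Fr_energy). Qed.

End fourier_transforms.

(** * Inversion of the radial Fourier transform *)

Section bilinear_form.
Context d (T : measurableType d) (R : realType).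
Variable mu : {measure set T -> \bar R}.
Implicit Types (f g h : L2 mu) (u v : T -> R[i]).

Lemma ReD (z w : R[i]) : complex.Re (z + w) = complex.Re z + complex.Re w.
Proof. by case: z w => ? ? []. Qed.

Lemma csq_conjc (z : R[i]) : csq (conjc z) = csq z.
Proof. by case: z => a b; rewrite /csq/= sqrrN. Qed.

Lemma cmeasurable_conjc u : cmeasurable u -> cmeasurable (fun x => conjc (u x)).
Proof.
move=> [mr mi]; split.
  by rewrite (_ : (fun x => _) = (fun x => complex.Re (u x)))//; apply/funext => x; case: (u x).
rewrite (_ : (fun x => _) = (fun x => - complex.Im (u x))); first by meas.
by apply/funext => x; case: (u x).
Qed.

Lemma energy_conjc u : energy mu (fun x => conjc (u x)) = energy mu u.
Proof. by apply: eq_integral => x _; rewrite csq_conjc. Qed.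

Fact L2conj_ex f : exists g : L2 mu, g = (fun x => conjc (f x)) %[ae mu].
Proof.
apply: ex_L2; first exact: cmeasurable_conjc (L2_cmeasurable f).
by rewrite energy_conjc L2_energy_lty.
Qed.

Definition L2conj f : L2 mu := projT1 (cid (L2conj_ex f)).

Lemma L2conjE f : L2conj f = (fun x => conjc (f x)) %[ae mu].
Proof. exact: (projT2 (cid (L2conj_ex f))). Qed.

Lemma L2conjK f : L2conj (L2conj f) = f.
Proof.
apply/L2_eqP; move: (L2conjE (L2conj f)) (L2conjE f).
by apply: filterS2 => x /(_ I) + /(_ I) + _ => -> ->; rewrite conjcK.
Qed.

Lemma L2norm_conj f : L2norm (L2conj f) = L2norm f.
Proof.
apply/eqP; rewrite -(@eqrXn2 _ 2)// ?L2norm_ge0//; apply/eqP/EFin_inj.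
rewrite (L2norm_energy _ (L2conjE f)); last exact: cmeasurable_conjc (L2_cmeasurable f).
by rewrite energy_conjc L2_energy.
Qed.

(** Bilinear rather than sesquilinear: the kernel exp(-i s sigma) is symmetric in its two variables,
    so the radial transform is its own transpose for this form. *)
Definition dot f g : R := \int[mu]_x complex.Re (f x * g x).

Lemma Re_mul_le (z w : R[i]) : `|complex.Re (z * w)| <= csq z + csq w.
Proof.
apply: (le_trans (normr_Re_le _)); rewrite normcM !csqE.
have := sqr_ge0 (normc z - normc w); have := normc_ge0 z; have := normc_ge0 w; nra.
Qed.

Lemma cmeasurable_ReM u v : cmeasurable u -> cmeasurable v ->
  measurable_fun setT (fun x => complex.Re (u x * v x)).
Proof. by move=> mu' mv; have [] := cmeasurableM mu' mv. Qed.

Lemma integrable_csq f : mu.-integrable setT (fun x => (csq (f x))%:E).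
Proof.
apply: ge0_Rintegrable; [exact: cmeasurable_csq (L2_cmeasurable f)|by move=> x; exact: csq_ge0|].
exact: L2_energy_lty.
Qed.

Lemma integrable_dot f g : mu.-integrable setT (fun x => (complex.Re (f x * g x))%:E).
Proof.
apply: (@le_Rintegrable _ _ _ mu _ (fun x => csq (f x) + csq (g x))).
- exact: cmeasurable_ReM (L2_cmeasurable f) (L2_cmeasurable g).
- by move=> x; exact: Re_mul_le.
- exact: (integrableD measurableT (integrable_csq f) (integrable_csq g)).
Qed.

Lemma eq_dot f g u v : cmeasurable u -> cmeasurable v -> f = u %[ae mu] -> g = v %[ae mu] ->
  dot f g = \int[mu]_x complex.Re (u x * v x).
Proof.
move=> mu' mv fu gv; apply: ae_eq_Rintegral.
- exact: cmeasurable_ReM (L2_cmeasurable f) (L2_cmeasurable g).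
- exact: cmeasurable_ReM.
by move: fu gv; apply: filterS2 => x /(_ I) -> /(_ I) ->.
Qed.

Lemma dotC f g : dot f g = dot g f.
Proof. by apply: eq_Rintegral => x _; rewrite mulrC. Qed.

Lemma dotDl f g h : dot (f + g) h = dot f h + dot g h.
Proof.
rewrite (eq_dot (cmeasurableD (L2_cmeasurable f) (L2_cmeasurable g)) (L2_cmeasurable h) (L2_DE f g) (ae_eq_refl _ _ _)).
rewrite -RintegralD//; try exact: integrable_dot.
by apply: eq_Rintegral => x _; rewrite fctE mulrDl ReD.
Qed.

Lemma L2norm_csq f : L2norm f ^+ 2 = \int[mu]_x csq (f x).
Proof. apply: EFin_inj; rewrite -L2_energy EFin_Rintegral//; exact: integrable_csq. Qed.

(* [dot] polarizes the norm, up to a conjugation of the second argument *)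
Lemma L2norm_addZconj f g (t : R) :
  L2norm (f + t%:C *: L2conj g) ^+ 2 = L2norm f ^+ 2 + t ^+ 2 * L2norm g ^+ 2 + 2 * t * dot f g.
Proof.
rewrite !L2norm_csq -RintegralZl//; last exact: integrable_csq.
rewrite -RintegralZl//; last exact: integrable_dot.
have i1 := integrable_csq f.
have i2 : mu.-integrable setT (fun x => (t ^+ 2 * csq (g x))%:E).
  exact: (integrableZl measurableT (t ^+ 2) (integrable_csq g)).
have i3 : mu.-integrable setT (fun x => (2 * t * complex.Re (f x * g x))%:E).
  exact: (integrableZl measurableT (2 * t) (integrable_dot f g)).
have i12 : mu.-integrable setT (fun x => (csq (f x) + t ^+ 2 * csq (g x))%:E).
  exact: (integrableD measurableT i1 i2).
rewrite -(RintegralD measurableT i1 i2) -(RintegralD measurableT i12 i3).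
have mf := cmeasurable_csq (L2_cmeasurable f); have mg := cmeasurable_csq (L2_cmeasurable g).
apply: ae_eq_Rintegral.
- exact: cmeasurable_csq (L2_cmeasurable _).
- apply: measurable_funD; first by apply: measurable_funD => //; exact: measurable_funM.
  by apply: measurable_funM => //; exact: cmeasurable_ReM (L2_cmeasurable f) (L2_cmeasurable g).
move: (L2_DE f (t%:C *: L2conj g)) (L2_ZE t%:C (L2conj g)) (L2conjE g).
apply: filterS3 => x /(_ I) + /(_ I) + /(_ I) +; rewrite !fctE => -> -> ->.
case: (f x) (g x) => a b [a' b'].
rewrite -[t%:C *: _]/(t%:C * (a' -i* b')) /csq/=; ring.
Qed.

(** The Cauchy-Schwarz inequality, drawn from the triangle inequality for f + t conj g with t = 1
    and t = -1. *)
Lemma dot_le f g : `|dot f g| <= L2norm f * L2norm g.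
Proof.
have N t : `|t| = 1 -> 2 * t * dot f g <= 2 * (L2norm f * L2norm g).
  move=> t1; have := L2norm_addZconj f g t; rewrite -(real_normK (num_real t)) t1 expr1n mul1r.
  have := L2norm_triangle f (t%:C *: L2conj g).
  rewrite L2normZ_real L2norm_conj [normc _](_ : _ = 1) ?mul1r; last first.
    by rewrite /= expr0n addr0 sqrtr_sqr.
  move=> le e.
  have : L2norm (f + t%:C *: L2conj g) ^+ 2 <= (L2norm f + L2norm g) ^+ 2.
    by rewrite ler_sqr// nnegrE ?L2norm_ge0// addr_ge0// L2norm_ge0.
  rewrite e sqrrD mulr2n; lra.
have := N 1; have := N (-1); rewrite normrN1 normr1 => /(_ erefl) h1 /(_ erefl) h2.
by rewrite ler_norml; apply/andP; split; lra.
Qed.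

Lemma dot_conj f : dot (L2conj f) f = L2norm f ^+ 2.
Proof.
rewrite (eq_dot (cmeasurable_conjc (L2_cmeasurable f)) (L2_cmeasurable f) (L2conjE f) (ae_eq_refl _ _ _)) L2norm_csq.
by apply: eq_Rintegral => x _; case: (f x) => a b; rewrite /csq/= !expr2 mulNr opprK.
Qed.

End bilinear_form.

Lemma ae_Rintegrable d (T : measurableType d) (R : realType) (mu : {measure set T -> \bar R})
  (f g : T -> R) : measurable_fun setT g -> {ae mu, forall x, f x = g x} ->
  mu.-integrable setT (fun x => (f x)%:E) -> mu.-integrable setT (fun x => (g x)%:E).
Proof.
move=> mg fg fi; have mf := Rintegrable_measurable fi.
have /integrableP[_ fi'] := fi; apply/integrableP; split; first exact/measurable_EFinP.
have -> : (\int[mu]_x `|(g x)%:E| = \int[mu]_x `|(f x)%:E|)%E; last by [].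
apply: ae_eq_integral => //.
- by apply: measurableT_comp => //; exact/measurable_EFinP.
- by apply: measurableT_comp => //; exact/measurable_EFinP.
- by apply: filterS fg => x ->.
Qed.

Section adjoint1.
Variable R : realType.
Local Notation mu := (@lebesgue_measure R).
Local Notation T := (measurableTypeR R).

(** Both sides are iterated integrals of f(x) g(xi) exp(-i x xi), whose modulus is the integrable
    product |f(x)| |g(xi)|. *)
Lemma fourier1_adjoint (f g : T -> R[i]) : cintegrable mu f -> cintegrable mu g ->
  \int[mu]_xi complex.Re (fourier1 f xi * g xi) = \int[mu]_x complex.Re (f x * fourier1 g x).
Proof.
move=> fi gi.
pose H x xi := complex.Re (f x * g xi * expNi (x * xi)).
have HH : (mu \x mu)%E.-integrable setT (fun p : T * T => (H p.1 p.2)%:E).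
  have mfg : cmeasurable (fun p : T * T => f p.1 * g p.2).
    by apply: cmeasurableM; [exact: cmeasurable_comp fi.1 _|exact: cmeasurable_comp gi.1 _].
  have ifg : cintegrable (mu \x mu)%E (fun p : T * T => f p.1 * g p.2).
    split=> //.
    have := integrable_prod (m1 := mu) (m2 := mu) fi.2 gi.2.
    by apply: eq_integrable => // p _ /=; rewrite normcM.
  have me : cmeasurable (fun p : T * T => expNi (p.1 * p.2)) by apply: cmeasurable_expNi; meas.
  have ie : cintegrable (mu \x mu)%E (fun p : T * T => f p.1 * g p.2 * expNi (p.1 * p.2)).
    by apply: cintegrable_mul_bounded => // p; exact: normc_expNi.
  by have /cintegrableP[] := ie.
transitivity (\int[mu]_xi \int[mu]_x H x xi).
  apply: eq_Rintegral => xi _; rewrite mulrC /fourier1 -cintegralZ; last exact: cintegrable_fourier1.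
  by apply: eq_Rintegral => x _; rewrite /H; congr (complex.Re _); ring.
rewrite -(Rfubini (m1 := mu) (m2 := mu) HH).
apply: eq_Rintegral => x _; rewrite /fourier1 -cintegralZ; last exact: cintegrable_fourier1.
by apply: eq_Rintegral => xi _; rewrite /H; congr (complex.Re _); rewrite [xi * x]mulrC; ring.
Qed.

End adjoint1.

(** * Transposition and inversion on the cylinder *)

Section radial_inversion.
Variable R : realType.
Local Notation mu := (@lebesgue_measure R).
Local Notation T := (measurableTypeR R).
Implicit Types f g : L2 (@leb_arc R).

Let adjoint_integrable f g : cintegrable (@leb_arc R) f -> cintegrable (@leb_arc R) g ->
  dot (radial_fourier f) g = dot f (radial_fourier g).
Proof.
move=> fi gi.
have mFf : cmeasurable (radial_fourier_integral f) := cmeasurable_fiber_fourier fi.1.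
have mFg : cmeasurable (radial_fourier_integral g) := cmeasurable_fiber_fourier gi.1.
have mf := L2_cmeasurable f; have mg := L2_cmeasurable g.
have iFf := integrable_dot (radial_fourier f) g.
have iFg := integrable_dot f (radial_fourier g).
have gae : (g : _ -> R[i]) = g %[ae @leb_arc R] by exact: ae_eq_refl.
have fae : (f : _ -> R[i]) = f %[ae @leb_arc R] by exact: ae_eq_refl.
rewrite (eq_dot mFf mg (radial_fourierE fi) gae) (eq_dot mf mFg fae (radial_fourierE gi)).
have ae_int (h k : L2 (@leb_arc R)) (u v : T * circle R -> R[i]) : cmeasurable u -> cmeasurable v ->
    h = u %[ae @leb_arc R] -> k = v %[ae @leb_arc R] ->
    \int[@leb_arc R]_p complex.Re (u p * v p) = \int[@arc_length R]_w \int[mu]_s complex.Re (u (s, w) * v (s, w)).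
  move=> mu' mv hu kv; symmetry.
  transitivity (\int[@leb_arc R]_p complex.Re (u (p.1, p.2) * v (p.1, p.2))); last first.
    by apply: eq_Rintegral => -[].
  apply: (Rintegral21 (m1 := mu) (m2 := @arc_length R) (h := fun s w => complex.Re (u (s, w) * v (s, w)))).
  apply: (@ae_Rintegrable _ _ _ (@leb_arc R) (fun p => complex.Re (h p * k p))).
  - have := cmeasurable_ReM mu' mv.
    by rewrite (_ : (fun p => _) = (fun p => complex.Re (u (p.1, p.2) * v (p.1, p.2))))//; apply/funext => -[].
  - by move: hu kv; apply: filterS2 => -[s w] /(_ I) -> /(_ I) ->.
  - exact: integrable_dot.
rewrite (ae_int _ _ _ _ mFf mg (radial_fourierE fi) gae) (ae_int _ _ _ _ mf mFg fae (radial_fourierE gi)).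
have mint (u v : T * circle R -> R[i]) : cmeasurable u -> cmeasurable v ->
    measurable_fun setT (fun w => \int[mu]_s complex.Re (u (s, w) * v (s, w))).
  move=> mu' mv.
  apply: (measurable_Rintegral_param mu (h := fun w s => complex.Re (u (s, w) * v (s, w)))).
  exact: (measurable_swapF (h := fun p => complex.Re (u p * v p)) (cmeasurable_ReM mu' mv)).
apply: ae_eq_Rintegral; [exact: mint|exact: mint|].
move: (ae_cintegrable2 fi) (ae_cintegrable2 gi); apply: filterS2 => w fw gw.
exact: (fourier1_adjoint fw gw).
Qed.

Let radial_fourierB f g : radial_fourier (f - g) = radial_fourier f - radial_fourier g.
Proof. by rewrite -scaleN1r addrC radial_fourier_linear scaleN1r addrC. Qed.

Let dotBl f g h : dot (f - g) h = dot f h - dot g h.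
Proof. by apply/eqP; rewrite eq_sym subr_eq -dotDl subrK. Qed.

Let dotBr f g h : dot h (f - g) = dot h f - dot h g.
Proof. by rewrite ![dot h _]dotC dotBl. Qed.

(** Both sides are continuous in the two arguments, by Cauchy-Schwarz and the norm identity, and
    they agree on the dense class of integrable elements. *)
Lemma radial_fourier_adjoint f g : dot (radial_fourier f) g = dot f (radial_fourier g).
Proof.
pose c : R := Num.sqrt (2 * pi); have c0 : 0 <= c by exact: sqrtr_ge0.
apply/eqP; rewrite -subr_eq0 -normr_le0; apply/ler_addgt0Pl => e e0; rewrite addr0.
(* The bounds [b1] to [b4] add up to (K - 1) dl, the norm of the approximation of [f] being at most
   that of [f] plus 1. The last summand makes [K] positive. *)
pose K := 2 * c * (L2norm f + L2norm g + 1) + 1.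
have K0 : 0 < K.
  by rewrite ltr_wpDl// !mulr_ge0// addr_ge0// addr_ge0 ?L2norm_ge0.
pose dl := Num.min 1 (e / K).
have dl0 : 0 < dl by rewrite lt_min ltr01 divr_gt0.
have [f' [fi' ff']] := dense_cintegrable f dl0; have [g' [gi' gg']] := dense_cintegrable g dl0.
have E : dot (radial_fourier f) g - dot f (radial_fourier g) =
    (dot (radial_fourier (f - f')) g + dot (radial_fourier f') (g - g')) -
    (dot (f - f') (radial_fourier g) + dot f' (radial_fourier (g - g'))).
  have G0 (a b x y z : R) : a - y = (a - b + (b - x)) - (y - z + (z - x)) by ring.
  by rewrite !radial_fourierB !dotBl !dotBr (adjoint_integrable fi' gi') -G0.
have N (h k : L2 (@leb_arc R)) : `|dot (radial_fourier h) k| <= c * (L2norm h * L2norm k).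
  by rewrite (le_trans (dot_le _ _))// L2norm_radial_fourier mulrA.
have N' (h k : L2 (@leb_arc R)) : `|dot h (radial_fourier k)| <= c * (L2norm h * L2norm k).
  by rewrite dotC [X in c * X]mulrC.
have f'n : L2norm f' <= L2norm f + 1.
  have := L2norm_triangle (f' - f) f; rewrite subrK L2normBC => /le_trans; apply.
  by rewrite addrC lerD2l (le_trans (ltW ff'))// ge_min lexx.
have mono (h k h0 : R) : 0 <= h -> 0 <= k -> h <= h0 -> k <= dl -> c * (h * k) <= c * (h0 * dl).
  by move=> ? ? ? ?; rewrite ler_wpM2l// ler_pM.
rewrite E (le_trans (ler_normB _ _))//.
have b1 : `|dot (radial_fourier (f - f')) g| <= c * (L2norm g * dl).
  by apply: le_trans (N _ _) _; rewrite [L2norm _ * _]mulrC; apply: mono; rewrite ?L2norm_ge0// ltW.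
have b2 : `|dot (radial_fourier f') (g - g')| <= c * ((L2norm f + 1) * dl).
  by apply: le_trans (N _ _) _; apply: mono; rewrite ?L2norm_ge0// ltW.
have b3 : `|dot (f - f') (radial_fourier g)| <= c * (L2norm g * dl).
  by apply: le_trans (N' _ _) _; rewrite [L2norm _ * _]mulrC; apply: mono; rewrite ?L2norm_ge0// ltW.
have b4 : `|dot f' (radial_fourier (g - g'))| <= c * ((L2norm f + 1) * dl).
  by apply: le_trans (N' _ _) _; apply: mono; rewrite ?L2norm_ge0// ltW.
apply: (@le_trans _ _ (K * dl)); last by rewrite mulrC -ler_pdivlMr// ge_min lexx orbT.
apply: le_trans (lerD (ler_normD _ _) (ler_normD _ _)) _.
apply: le_trans (lerD (lerD b1 b2) (lerD b3 b4)) _.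
have G (k x y z : R) : (2 * k * (x + y + 1) + 1) * z =
  k * (y * z) + k * ((x + 1) * z) + (k * (y * z) + k * ((x + 1) * z)) + z by ring.
by rewrite /K G lerDl ltW.
Qed.

(* Both sides have the same norm, and the adjoint identity gives the case of
   equality in the Cauchy-Schwarz inequality. *)
Lemma radial_fourier_inversion f :
  radial_fourier (L2conj (radial_fourier f)) = (2 * pi)%:C *: L2conj f.
Proof.
have p0 : 0 <= 2 * pi :> R by rewrite mulr_ge0// pi_ge0.
apply/eqP; rewrite -subr_eq0; apply/eqP/L2norm_eq0/eqP; rewrite -sqrf_eq0; apply/eqP.
(* With dot(conj(F_s f), F_s f) = 2 pi |f|^2, the three terms are (2 pi)^2 |f|^2 twice and - 2 (2
   pi)^2 |f|^2. *)
rewrite -scaleNr -rmorphN L2norm_addZconj radial_fourier_adjoint dot_conj.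
rewrite !L2norm_radial_fourier L2norm_conj L2norm_radial_fourier !exprMn sqr_sqrtr//; ring.
Qed.

(** The inversion formula at conj h exhibits a preimage. *)
Lemma radial_fourier_surj h : exists g, radial_fourier g = h.
Proof.
have p0 : (2 * pi)%:C != 0 :> R[i] by rewrite (inj_eq (@complexI R)) mulf_neq0// gt_eqF// pi_gt0.
(* The summand 0 gives the witness the shape [a *: f + g] to which linearity applies. *)
exists ((2 * pi)%:C^-1 *: L2conj (radial_fourier (L2conj h)) + 0).
rewrite radial_fourier_linear radial_fourier_inversion L2conjK scalerA mulVf// scale1r.
by have := radial_fourierB 0 0; rewrite !subrr => ->; rewrite addr0.
Qed.

End radial_inversion.

(** * Radon transform of bandpass functions *)

Section bounded_below.
Context d d' (T : measurableType d) (U : measurableType d') (R : realType).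
Variables (mu : {measure set T -> \bar R}) (nu : {measure set U -> \bar R}).
Variables (A : set (L2 mu)) (F : L2 mu -> L2 nu) (c C : R).
Hypotheses (c0 : 0 < c) (C0 : 0 < C) (A0 : A 0).
Hypothesis A_linear : forall (a : R[i]) u v, A u -> A v -> A (a *: u + v).
Hypothesis A_closed : closed A.
Hypothesis F_linear : forall (a : R[i]) u v, A u -> A v -> F (a *: u + v) = a *: F u + F v.
Hypothesis F_ge : forall u, A u -> c * L2norm u <= L2norm (F u).
Hypothesis F_le : forall u, A u -> L2norm (F u) <= C * L2norm u.

Let AB u v : A u -> A v -> A (u - v).
Proof. by move=> Au Av; rewrite addrC -scaleN1r; exact: A_linear. Qed.

Let FB u v : A u -> A v -> F (u - v) = F u - F v.
Proof. by move=> Au Av; rewrite addrC -scaleN1r F_linear// scaleN1r addrC. Qed.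

Let F_inj u v : A u -> A v -> F u = F v -> u = v.
Proof.
move=> Au Av Fuv; apply/eqP; rewrite -subr_eq0; apply/eqP/L2norm_eq0/eqP.
rewrite eq_le L2norm_ge0 andbT -(@pmulr_rle0 _ c)//.
by apply: le_trans (F_ge (AB Au Av)) _; rewrite FB// Fuv subrr L2norm0.
Qed.

Let pow4_small (e : R) : 0 < e -> exists n, 4^-1 ^+ n < e.
Proof.
move=> e0; have q1 : `|4^-1| < 1 :> R by rewrite gtr0_norm ?invr_gt0// invf_lt1// ltr1n.
have /cvgrPdist_lt/(_ e e0)[n _ /(_ n (leqnn n))] := cvg_expr q1.
by rewrite sub0r normrN => nx; exists n; exact: le_lt_trans (ler_norm _) nx.
Qed.

(** The lower bound makes preimages of approximations of a limit point converge, their limit stays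
    in the closed set [A], and the upper bound identifies its image. *)
Let image_closed : closed (F @` A).
Proof.
(* Then dl n + dl n.+1 = (5 / 8) c 4^-n, and division by the lower bound c yields the rate of
   [riesz_fischer]. *)
move=> v /closure_L2P cv; pose dl n : R := 4^-1 ^+ n * (c / 2).
have dl0 n : 0 < dl n by rewrite mulr_gt0 ?exprn_gt0 ?invr_gt0 ?divr_gt0.
have /choice[u uP] : forall n, exists u, A u /\ L2norm (v - F u) < dl n.
  by move=> n; have [_ [[u Au <-] vu]] := cv _ (dl0 n); exists u.
have du n : L2norm (u n - u n.+1) <= 4^-1 ^+ n.
  rewrite -(ler_pM2l c0); apply: le_trans (F_ge (AB (uP _).1 (uP _).1)) _.
  rewrite FB; try exact: (uP _).1.
  apply: le_trans (L2norm_triangleB v _ _) _; rewrite L2normBC.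
  apply: le_trans (lerD (ltW (uP n).2) (ltW (uP n.+1).2)) _.
  have : 0 <= c * 4^-1 ^+ n by rewrite mulr_ge0 ?ltW// exprn_gt0// invr_gt0.
  rewrite /dl exprS; lra.
have [w uw] := riesz_fischer du.
have Aw : A w.
  apply: A_closed; apply/closure_L2P => e e0.
  have [n ne] := pow4_small (divr_gt0 e0 (ltr0n R 2)).
  exists (u n); split; first exact: (uP n).1.
  by rewrite L2normBC (le_lt_trans (uw n))// mulrC -ltr_pdivlMr.
exists w => //; apply/eqP; rewrite -subr_eq0; apply/eqP/L2norm_eq0/eqP.
rewrite -normr_le0 ger0_norm ?L2norm_ge0//; apply/ler_addgt0Pl => e e0; rewrite addr0.
have k0 : 0 < 2 * C + c by rewrite addr_gt0// mulr_gt0.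
have [n ne] := pow4_small (divr_gt0 e0 k0).
apply: le_trans (L2norm_triangleB (F (u n)) _ _) _.
apply: (@le_trans _ _ (C * (2 * 4^-1 ^+ n) + dl n)).
  apply: lerD; last by rewrite L2normBC ltW// (uP n).2.
  rewrite -(FB Aw (uP n).1); apply: le_trans (F_le (AB Aw (uP n).1)) _.
  by rewrite L2normBC ler_pM2l.
move: ne; rewrite ltr_pdivlMr// => ne; apply: le_trans (ltW ne); rewrite /dl.
have : 0 <= 4^-1 ^+ n * c by rewrite mulr_ge0 ?ltW// exprn_gt0// invr_gt0.
lra.
Qed.

(** The inverse selects the preimage in [A], unique by the lower bound. The two maps are Lipschitz
    with constants [C] and [c^-1]. *)
Lemma bounded_below_isomorphism : hilbert_isomorphism A (F @` A) F.
Proof.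
have F0 : F 0 = 0.
  apply/L2norm_eq0/eqP; rewrite eq_le L2norm_ge0 andbT.
  by apply: le_trans (F_le A0) _; rewrite L2norm0 mulr0.
pose G v := xget 0 [set u | A u /\ F u = v].
have GF u : A u -> G (F u) = u.
  move=> Au; have [AG FG] : A (G (F u)) /\ F (G (F u)) = F u.
    by apply: (@xgetPex _ 0 [set u' | A u' /\ F u' = F u]); exists u.
  exact: F_inj.
split.
- split; first exact: hilbert_subspaceP.
  apply: hilbert_subspaceP; [by exists 0| |exact: image_closed].
  by move=> a _ _ [u Au <-] [v Av <-]; exists (a *: u + v); [exact: A_linear|exact: F_linear].
- exact: F_linear.
- split=> //.
  + by move=> u v; rewrite !inE; exact: F_inj.
- by apply: (@lipschitz_within _ _ _ _ _ _ _ _ _ C) => u v Au Av; rewrite -FB// F_le//; exact: AB.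
exists G; split; first by move=> u; rewrite inE; exact: GF.
apply: (@lipschitz_within _ _ _ _ _ _ _ _ _ c^-1) => _ _ [u Au <-] [v Av <-].
by rewrite !GF// mulrC ler_pdivlMr// mulrC -FB// F_ge//; exact: AB.
Qed.

End bounded_below.

Lemma L2_linE d (T : measurableType d) (R : realType) (mu : {measure set T -> \bar R})
  (a : R[i]) (f g : L2 mu) : {ae mu, forall x, (a *: f + g : L2 mu) x = a * f x + g x}.
Proof.
move: (L2_DE (a *: f) g) (L2_ZE a f).
by apply: filterS2 => x /(_ I) -> /(_ I) E; rewrite fctE E.
Qed.

Lemma ae_eq_lin d (T : measurableType d) (R : realType) (mu : {measure set T -> \bar R})
  (a : R[i]) (f f' g g' h h' : T -> R[i]) : f = f' %[ae mu] -> g = g' %[ae mu] ->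
  {ae mu, forall x, h x = a * f x + g x} -> {ae mu, forall x, h' x = a * f' x + g' x} ->
  h = h' %[ae mu].
Proof.
move=> ff gg hf hf'.
have ffgg : {ae mu, forall x, f x = f' x /\ g x = g' x}.
  by move: ff gg; apply: filterS2 => x /(_ I) ? /(_ I).
by move: ffgg hf hf'; apply: filterS3 => x [fx gx] -> -> _; rewrite fx gx.
Qed.

(** * The Radon transform on the bandpass space *)

Section bandpass_space.
Variable R : realType.
Local Notation mu := (@lebesgue_measure R).
Local Notation T := (measurableTypeR R).
Local Notation leb2 := (@leb2 R).
Local Notation leb_arc := (@leb_arc R).

Let pi0 : 0 < 2 * pi :> R. Proof. by rewrite mulr_gt0// pi_gt0. Qed.

Definition enorm (x : plane R) : R := Num.sqrt (x.1 ^+ 2 + x.2 ^+ 2).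

Lemma measurable_enorm : measurable_fun setT enorm.
Proof.
have m1 : measurable_fun setT (fun x : plane R => x.1) by exact: measurable_fst.
have m2 : measurable_fun setT (fun x : plane R => x.2) by exact: measurable_snd.
rewrite (_ : enorm = Num.sqrt \o (fun x : plane R => x.1 ^+ 2 + x.2 ^+ 2))//.
apply: measurableT_comp; first by apply: continuous_measurable_fun; exact: sqrt_continuous.
by apply: measurable_funD; exact: measurable_funX.
Qed.

Lemma enorm_polar p : enorm (polar p) = `|p.1|.
Proof.
case: p => s [[x y] /= xy]; rewrite /enorm /polar/= !exprMn -mulrDr.
by rewrite (eqP xy) mulr1 sqrtr_sqr.
Qed.

Lemma measurable_disk (rho : R) : measurable (@disk R rho).
Proof.
rewrite (_ : disk rho = enorm @^-1` `]-oo, rho[%classic); last first.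
  by apply/seteqP; split=> x /=; rewrite in_itv.
by rewrite -[X in measurable X]setTI; apply: measurable_enorm => //; exact: measurable_itv.
Qed.

Lemma fst_neq0_ae : {ae leb_arc, forall p, p.1 != 0}.
Proof.
exists ([set 0] `*` setT); split.
- by apply: measurableX => //; exact: measurable_set1.
- rewrite -[LHS]/((mu \x @arc_length R)%E ([set 0] `*` setT)) product_measure1E//.
  rewrite [X in (X * _)%E](_ : _ = 0%E) ?mul0e//; exact: lebesgue_measure_set1.
- by move=> p /= /negP; rewrite negbK => /eqP.
Qed.

(** For an exceptional set of measure 0, the polar formula shows that the weight |s| vanishes almost
    everywhere on its preimage; but the weight is zero only for s = 0, a null set. Thus [polar] may
    be composed with classes of functions. *)
Lemma ae_polar (P : plane R -> Prop) : {ae leb2, forall x, P x} -> {ae leb_arc, forall p, P (polar p)}.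
Proof.
move=> [N [mN N0 PN]].
have m1 : measurable_fun setT (fun x => (\1_N x : R)%:E) by exact/measurable_EFinP/measurable_indic.
have n0 x : (0 <= (\1_N x : R)%:E)%E by rewrite lee_fin.
have := integral_polar m1 n0; rewrite integral_indic// setIT N0 mule0 => H.
have mf : measurable_fun setT (fun p : line R * circle R => (`|p.1|%R)%:E * (\1_N (polar p) : R)%:E)%E.
  apply: emeasurable_funM; last exact: (measurableT_comp m1 (@measurable_polar R)).
  have m3 : measurable_fun setT (fun p : line R * circle R => p.1) by exact: measurable_fst.
  by apply/measurable_EFinP; exact: measurableT_comp.
have : ae_eq leb_arc setT (fun p : line R * circle R => (`|p.1|%R)%:E * (\1_N (polar p) : R)%:E)%E (cst 0%E).
  apply/ae_eq_integral_abs => //; rewrite -[RHS]H; apply: eq_integral => p _.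
  by rewrite gee0_abs// mule_ge0// lee_fin.
have FF : Filter (nbhs (almost_everywhere leb_arc)) by exact: ae_filter_ringOfSetsType.
apply: filterS2 fst_neq0_ae => p p0 /(_ I).
rewrite indicE -EFinM => -[] /eqP; rewrite mulf_eq0 normr_eq0 (negbTE p0)/=.
have [pN|/negP pN _] := boolP (polar p \in N); first by rewrite oner_eq0.
by apply: contrapT => nP; apply: pN; rewrite inE; exact: PN.
Qed.

(** The weight |s| of the polar formula is the norm of the point [polar p], which lies between [r]
    and [R'] wherever [u] does not vanish. *)
Lemma energy_polar_bounds (u : plane R -> R[i]) (r R' : R) : 0 <= r -> 0 <= R' -> cmeasurable u ->
  {ae leb2, forall x, u x != 0 -> r <= enorm x <= R'} ->
  (r%:E * energy leb_arc (u \o polar (R := R)) <= 2%:E * energy leb2 u /\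
   2%:E * energy leb2 u <= R'%:E * energy leb_arc (u \o polar (R := R)))%E.
Proof.
move=> r0 R'0 mu' ur; have mcu := cmeasurable_csq mu'.
have mcu' : measurable_fun setT (fun x => (csq (u x))%:E) by exact/measurable_EFinP.
have mcp : measurable_fun setT (fun p => (csq (u (polar p)))%:E).
  exact: (measurableT_comp mcu' (@measurable_polar R)).
have e0 : (0 <= energy leb_arc (u \o polar (R := R)))%E by exact: energy_ge0.
have m1 : measurable_fun setT (fun p : line R * circle R => (`|p.1|%R)%:E).
  have m3 : measurable_fun setT (fun p : line R * circle R => p.1) by exact: measurable_fst.
  by apply/measurable_EFinP; exact: measurableT_comp.
have m2 : measurable_fun setT (fun p : line R * circle R => (`|p.1|%R)%:E * (csq (u (polar p)))%:E)%E.
  exact: emeasurable_funM.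
have E : (2%:E * energy leb2 u = \int[leb_arc]_p ((`|p.1|%R)%:E * (csq (u (polar p)))%:E))%E.
  by rewrite (integral_polar mcu')// => x; rewrite lee_fin csq_ge0.
have FF : Filter (nbhs (almost_everywhere leb_arc)) by exact: ae_filter_ringOfSetsType.
have up := ae_polar ur.
have mcr (k : R) : measurable_fun setT (fun p => k%:E * (csq (u (polar p)))%:E)%E.
  exact: emeasurable_funM.
have c0 p : (0 <= (csq (u (polar p)))%:E)%E by rewrite lee_fin csq_ge0.
have Z (k : R) : 0 <= k -> (k%:E * energy leb_arc (u \o polar (R := R)) =
    \int[leb_arc]_p (k%:E * (csq (u (polar p)))%:E))%E.
  by move=> k0; rewrite ge0_integralZl.
rewrite E !Z//; split; apply: ae_ge0_le_integral => //.
- by move=> p _; rewrite mule_ge0.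
- by move=> p _; rewrite mule_ge0.
- apply: filterS up => p up _; rewrite -!EFinM lee_fin.
  have [->|/up/andP[rp _]] := eqVneq (u (polar p)) 0; first by rewrite csq0 !mulr0.
  by rewrite ler_wpM2r ?csq_ge0// -enorm_polar.
- by move=> p _; rewrite mule_ge0.
- by move=> p _; rewrite mule_ge0.
- apply: filterS up => p up _; rewrite -!EFinM lee_fin.
  have [->|/up/andP[_ rp]] := eqVneq (u (polar p)) 0; first by rewrite csq0 !mulr0.
  by rewrite ler_wpM2r ?csq_ge0// -enorm_polar.
Qed.

Lemma energy_le_ae d (X : measurableType d) (m : {measure set X -> \bar R}) (u v : X -> R[i]) :
  cmeasurable u -> cmeasurable v -> {ae m, forall x, csq (u x) <= csq (v x)} ->
  (energy m u <= energy m v)%E.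
Proof.
move=> mu' mv uv; apply: ae_ge0_le_integral => //.
- by move=> x _; rewrite lee_fin csq_ge0.
- exact/measurable_EFinP/cmeasurable_csq.
- by move=> x _; rewrite lee_fin csq_ge0.
- exact/measurable_EFinP/cmeasurable_csq.
- by apply: filterS uv => x ? _; rewrite lee_fin.
Qed.

Variables (r R' : R).
Hypotheses (r0 : 0 < r) (R'0 : 0 < R').
Local Notation A := (bandpass r R').
Local Notation N := (~` (disk R' `\` disk r)).

Let mN : measurable N.
Proof. by apply: measurableC; apply: measurableD; exact: measurable_disk. Qed.

Let A0 : A 0.
Proof.
rewrite /bandpass/=; have F0 : fourier (0 : L2 leb2) = 0.
  by apply: L2norm_eq0; rewrite L2norm_fourier L2norm0 mulr0.
by rewrite F0; move: (L2_0E leb2); apply: filterS => x /(_ I) ->.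
Qed.

Lemma fourier_linear_ae (a : R[i]) (u v : L2 leb2) :
  {ae leb2, forall x, fourier (a *: u + v) x = a * fourier u x + fourier v x}.
Proof.
by rewrite fourier_linear; exact: L2_linE.
Qed.

Let A_linear (a : R[i]) u v : A u -> A v -> A (a *: u + v).
Proof.
rewrite /bandpass/= => Au Av; move: Au Av (fourier_linear_ae a u v).
by apply: filterS3 => x ux vx -> Nx; rewrite ux// vx// mulr0 addr0.
Qed.

(** Let [w] be the part of F f outside the annulus. For any g in the space, F g vanishes there, so
    the norm of [w] is at most that of F (f - g), which is 2 pi |f - g| and arbitrarily small. *)
Let A_closed : closed A.
Proof.
move=> f /closure_L2P cf.
have mFf := L2_cmeasurable (fourier f).
pose w x := if x \in N then fourier f x else 0.
have mw : cmeasurable w by exact: cmeasurable_if.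
have ew : (energy leb2 w < +oo)%E.
  apply: le_lt_trans (L2_energy_lty (fourier f)); apply: energy_le_ae => //.
  by apply: aeW => x; rewrite /w; case: ifP => // _; rewrite csq0 csq_ge0.
have [W Ww] := ex_L2 mw ew.
have W0 : L2norm W = 0.
  apply/eqP; rewrite -normr_le0 ger0_norm ?L2norm_ge0//; apply/ler_addgt0Pl => e e0; rewrite addr0.
  have [g [Ag fg]] := cf _ (divr_gt0 e0 pi0).
  apply: (@le_trans _ _ (L2norm (fourier (f - g)))); last first.
    by rewrite L2norm_fourier mulrC -ler_pdivlMr// ltW.
  rewrite -ler_sqr ?nnegrE ?L2norm_ge0// -lee_fin (L2norm_energy mw Ww) -L2_energy.
  apply: energy_le_ae => //; first exact: L2_cmeasurable.
  have := fourier_linear_ae (-1) g f; rewrite scaleN1r addrC; move: Ag.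
  apply: filterS2 => x gx ->; rewrite /w; case: ifPn => [|_]; last by rewrite csq0 csq_ge0.
  by rewrite inE => /gx ->; rewrite mulr0 add0r.
have := Ww; rewrite (L2norm_eq0 W0); move: (L2_0E leb2).
by apply: filterS2 => x /(_ I) -> /(_ I); rewrite /w => + Nx; rewrite mem_set.
Qed.

Let fourier_support f : A f -> {ae leb2, forall x, fourier f x != 0 -> r <= enorm x <= R'}.
Proof.
rewrite /bandpass/=; apply: filterS => x fx nx.
have : (disk R' `\` disk r) x by apply: contrapT => /fx/eqP; exact/negP.
by rewrite /disk/= => -[/ltW xR /negP]; rewrite -leNgt => rx; rewrite /enorm rx xR.
Qed.

(** The cut-off r makes F f square integrable in polar coordinates, and F_s is onto; hence the
    defining equation has a solution and the default value of [radon] is not taken. *)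
Let radonP f : A f -> radial_fourier (radon f) = fourier f \o polar (R := R) %[ae leb_arc].
Proof.
move=> Af.
have mh : cmeasurable (fourier f \o polar (R := R)).
  exact: cmeasurable_comp (L2_cmeasurable _) (@measurable_polar R).
have [h1 h2] := energy_polar_bounds (ltW r0) (ltW R'0) (L2_cmeasurable (fourier f)) (fourier_support Af).
have eh : (energy leb_arc (fourier f \o polar (R := R)) < +oo)%E.
  rewrite ltNge leye_eq; apply/negP => /eqP E; move: h1.
  by rewrite E gt0_muley ?lte_fin// leye_eq L2_energy -EFinM.
have [h hh] := ex_L2 mh eh.
have [g gh] := radial_fourier_surj h.
apply: (@xgetPex _ 0 [set g | radial_fourier g = fourier f \o polar (R := R) %[ae leb_arc]]).
by exists g; rewrite /= gh.
Qed.

(** Injectivity of the radial transform, from its norm identity. *)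
Let radon_unique f g : A f -> radial_fourier g = fourier f \o polar (R := R) %[ae leb_arc] -> radon f = g.
Proof.
move=> Af gf; have := radonP Af => rf.
have E : radial_fourier (radon f) = radial_fourier g.
  by apply/L2_eqP; exact: ae_eq_trans rf (ae_eq_sym gf).
apply/eqP; rewrite -subr_eq0; apply/eqP/L2norm_eq0/eqP.
have c0 : 0 < Num.sqrt (2 * pi) :> R by rewrite sqrtr_gt0.
have : Num.sqrt (2 * pi) * L2norm (radon f - g) == 0.
  by rewrite -L2norm_radial_fourier addrC -scaleN1r radial_fourier_linear scaleN1r E addNr L2norm0.
by rewrite mulf_eq0 (gt_eqF c0).
Qed.

Let radon_linear (a : R[i]) u v : A u -> A v -> radon (a *: u + v) = a *: radon u + radon v.
Proof.
move=> Au Av; apply: radon_unique; first exact: A_linear.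
rewrite radial_fourier_linear.
apply: (@ae_eq_lin _ _ _ leb_arc a _ _ _ _ _ _ (radonP Au) (radonP Av)); first exact: L2_linE.
exact: (ae_polar (fourier_linear_ae a u v)).
Qed.

(** The polar bounds for F f, with 2 pi from Plancherel's theorem for F_s and (2 pi)^2 from that of
    the plane. *)
Let radon_energy f : A f ->
  r * (2 * pi * L2norm (radon f) ^+ 2) <= 2 * ((2 * pi) ^+ 2 * L2norm f ^+ 2) /\
  2 * ((2 * pi) ^+ 2 * L2norm f ^+ 2) <= R' * (2 * pi * L2norm (radon f) ^+ 2).
Proof.
move=> Af.
have mh : cmeasurable (fourier f \o polar (R := R)).
  exact: cmeasurable_comp (L2_cmeasurable _) (@measurable_polar R).
have [] := energy_polar_bounds (ltW r0) (ltW R'0) (L2_cmeasurable (fourier f)) (fourier_support Af).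
rewrite -(L2norm_energy mh (radonP Af)) L2_energy L2norm_radial_fourier L2norm_fourier.
by rewrite !exprMn (sqr_sqrtr (ltW pi0)) -!EFinM !lee_fin.
Qed.

(** Division of [radon_energy] by 2 pi leaves r |radon f|^2 <= 4 pi |f|^2 <= R' |radon f|^2; the two
    constants are the resulting square roots. *)
Lemma bandpass_isomorphism : hilbert_isomorphism A (radon (R := R) @` A) (radon (R := R)).
Proof.
have k0 (x : R) : 0 < x -> 0 < 4 * pi / x by move=> x0; rewrite divr_gt0// mulr_gt0// pi_gt0.
apply: (@bounded_below_isomorphism _ _ _ _ _ _ _ A _ (Num.sqrt (4 * pi / R')) (Num.sqrt (4 * pi / r))) => //.
- by rewrite sqrtr_gt0 k0.
- by rewrite sqrtr_gt0 k0.
- move=> u Au; have [_] := radon_energy Au.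
  move: (L2norm_ge0 u) (L2norm_ge0 (radon u)); move: (L2norm u) (L2norm (radon u)) => x y x0 y0 xy.
  rewrite -ler_sqr ?nnegrE ?y0//; last by rewrite mulr_ge0 ?sqrtr_ge0.
  rewrite exprMn sqr_sqrtr ?(ltW (k0 _ _))// mulrAC ler_pdivrMr// -(ler_pM2l pi0).
  by rewrite [leLHS](_ : _ = 2 * ((2 * pi) ^+ 2 * x ^+ 2)) ?[leRHS](_ : _ = R' * (2 * pi * y ^+ 2))//; ring.
move=> u Au; have [+ _] := radon_energy Au.
move: (L2norm_ge0 u) (L2norm_ge0 (radon u)); move: (L2norm u) (L2norm (radon u)) => x y x0 y0 xy.
rewrite -ler_sqr ?nnegrE ?y0//; last by rewrite mulr_ge0 ?sqrtr_ge0.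
rewrite exprMn sqr_sqrtr ?(ltW (k0 _ _))// mulrAC ler_pdivlMr// -(ler_pM2l pi0).
by rewrite [leRHS](_ : _ = 2 * ((2 * pi) ^+ 2 * x ^+ 2)) ?[leLHS](_ : _ = r * (2 * pi * y ^+ 2))//; ring.
Qed.

End bandpass_space.

Theorem theorem3 (R : realType) (r R' : R) (r_gt0 : 0 < r) (R'_gt0 : 0 < R') :
  hilbert_isomorphism (bandpass r R') (radon (R := R) @` bandpass r R')
    (radon (R := R)).
Proof. exact: bandpass_isomorphism. Qed.
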